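(* Let $(T,\psi)$ and $(T_1,\psi_1)$ be two solutions of the nonlinear Milne problem $$\partial_x^2T+\langle\psi-T^4\rangle=0,\quad\mu\,\partial_x\psi+(\psi-T^4)=0\ \text{ on }\mathbb{R}_+\times[-1,1],\qquad T(0)=T_b,\quad\psi(0,\mu)=\psi_b(\mu)\ (\mu\in(0,1]),$$ (with the same data $T_b\ge 0$, $\psi_b\ge0$), both satisfying the weighted estimate stated in the context. Suppose that $T$ satisfies the spectral assumption. (1) If $(T_1,\psi_1)\in\mathcal V$, where $$\mathcal V=\{(G,\phi)\in L^2_{\rm loc}(\mathbb{R}_+)\times L^2_{\rm loc}(\mathbb{R}_+\times[-1,1]):\ \|G-T\|_{L^2(\mathbb{R}_+)}\le\varepsilon\}$$ with $\varepsilon>0$ sufficiently small, then $T_1(x)=T(x)$ and $\psi_1(x,\mu)=\psi(x,\mu)$ for almost every $(x,\mu)\in\mathbb{R}_+\times[-1,1]$. (2) If the condition $(T_1,\psi_1)\in\mathcal V$ is replaced by the condition $$\frac12\int_0^1\mu(\psi_b-T_b^4)^2d\mu\le C_b,\qquad C_b=\min\left\{\frac12T_b\sqrt{3\alpha(1-\alpha)},\ \frac1{72}\gamma^{-1}T_b^3\beta(\alpha-\beta)\sqrt\alpha\right\},$$ then $T_1(x)=T(x)$ and $\psi_1(x,\mu)=\psi(x,\mu)$ for almost every $(x,\mu)\in\mathbb{R}_+\times[-1,1]$, and the solution of the nonlinear Milne problem is unique.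
   Context: Notation: $\langle f\rangle:=\int_{-1}^1f(\mu)\,d\mu$, $\mathbb{R}_+=(0,\infty)$. Solutions are bounded non-negative weak solutions in $L^2_{\rm loc}(\mathbb{R}_+)\times L^2_{\rm loc}(\mathbb{R}_+\times[-1,1])$ with boundary values at $x=0$ in the sense of traces. In $C_b$, $\alpha,\beta$ are constants with $0<\beta<\alpha<1$ and $\gamma>0$ is a constant with $T_b\le\gamma$, $\psi_b\le\gamma^4$. Weighted estimate: for every $0\le\alpha<1$, $$\int_0^\infty e^{2\alpha x}4T^3|\partial_xT|^2dx+(1-\alpha)\int_0^\infty\int_{-1}^1e^{2\alpha x}(\psi-T^4)^2d\mu dx+\frac12\int_{-1}^0|\mu|(\psi(0,\mu)-T_b^4)^2d\mu\le\frac12\int_0^1\mu(\psi_b-T_b^4)^2d\mu.$$ Spectral assumption: a (non-negative) function $T\in C^1(\mathbb{R}_+)$ satisfies the spectral assumption if there exist constants $\beta_0>0$ and $0<M<1$ such that $$M\int_0^\infty e^{2\beta_0x}(2T^{3/2})^2|\partial_xf|^2dx\ge4\int_0^\infty e^{2\beta_0x}|\partial_x(2T^{3/2})|^2f^2dx$$ for all $f\in C^1(\mathbb{R}_+)$ with $f(0)=0$. *)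

(* Defs.v *)
From HB Require Import structures.
From mathcomp Require Import all_boot all_order all_algebra.
From mathcomp Require Import all_classical all_reals all_analysis.
Set Implicit Arguments.
Unset Strict Implicit.
Unset Printing Implicit Defensive.
Import Order.TTheory GRing.Theory Num.Theory.
Import numFieldNormedType.Exports.
Local Open Scope classical_set_scope.
Local Open Scope ring_scope.

(* Functions of x on (0, +oo) and of (x, m) on (0, +oo) x [-1, 1] are total
   functions R -> R and R * R -> R; only their values on these sets matter. *)

Definition Rpos (R : realType) : set R := `]0, +oo[%classic.
Arguments Rpos : clear implicits.

Definition strip (R : realType) : set (R * R) := Rpos R `*` `[-1, 1]%classic.
Arguments strip : clear implicits.

Definition lebesgue2 (R : realType) : 
  {measure set (measurableTypeR R * measurableTypeR R) -> \bar R} :=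
  (@lebesgue_measure R \x @lebesgue_measure R)%E.
Arguments lebesgue2 : clear implicits.

Definition angular_mean (R : realType) (f : R -> R) : R :=
  \int[@lebesgue_measure R]_(m in `[-1, 1]) f m.

Definition L2loc (R : realType) (D : set R) (f : R -> R) : Prop :=
  measurable_fun D f /\
  forall K : set R, K `<=` D -> compact K ->
    (\int[@lebesgue_measure R]_(x in K) ((f x) ^+ 2)%:E < +oo)%E.

Definition L2loc2 (R : realType) (D : set (R * R)) (f : R * R -> R) : Prop :=
  measurable_fun D f /\
  forall K : set (R * R), K `<=` D -> compact K ->
    (\int[lebesgue2 R]_(p in K) ((f p) ^+ 2)%:E < +oo)%E.

Definition C1_on (R : realType) (D : set R) (f : R -> R) : Prop :=
  forall x, D x -> derivable f x 1 /\ {for x, continuous (derive1 f)}.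

Definition compact_supp_Rpos (R : realType) (eta : R -> R) : Prop :=
  exists a b : R, [/\ 0 < a, a <= b &
    forall x, x \notin `[a, b] -> eta x = 0].

Definition test_C1 (R : realType) (eta : R -> R) : Prop :=
  C1_on setT eta /\ compact_supp_Rpos eta.

Definition test_C2 (R : realType) (eta : R -> R) : Prop :=
  [/\ C1_on setT eta, C1_on setT (derive1 eta) & compact_supp_Rpos eta].

Definition Dx (R : realType) (rho : R * R -> R) (p : R * R) : R :=
  'D_((1, 0) : R * R) rho p.

Definition Dm (R : realType) (rho : R * R -> R) (p : R * R) : R :=
  'D_((0, 1) : R * R) rho p.

(* C^1 functions with compact support in (0, +oo) x [-1, 1]; they need not
   vanish at m = -1 and m = 1, since the transport equation does not
   differentiate in m. *)
Definition test_C1_strip (R : realType) (rho : R * R -> R) : Prop :=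
  [/\ forall p, derivable rho p ((1, 0) : R * R) /\
                derivable rho p ((0, 1) : R * R),
      continuous (Dx rho), continuous (Dm rho) &
      exists a b : R, [/\ 0 < a, a <= b &
        forall p, p.1 \notin `[a, b] -> rho p = 0]].

Definition weak_derivative (R : realType) (u du : R -> R) : Prop :=
  [/\ locally_integrable (Rpos R) u, locally_integrable (Rpos R) du &
      forall eta : R -> R, test_C1 eta ->
        \int[@lebesgue_measure R]_(x in Rpos R) (u x * derive1 eta x) =
        - \int[@lebesgue_measure R]_(x in Rpos R) (du x * eta x)].

(* Trace at x = 0, as the limit of averages:
   d^-1 * int_0^d |u x - a| dx --> 0 as d --> 0+. *)
Definition trace0 (R : realType) (u : R -> R) (a : R) : Prop :=
  ((d^-1)%:E *
     \int[@lebesgue_measure R]_(x in `]0%R, d[) (`|u x - a|)%:E)%E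
    @[d --> (0:R)^'+] --> 0%E.

(* Trace at x = 0, for almost every m in the angular range A. *)
Definition trace0_ae (R : realType) (A : set R) (psi : R * R -> R)
    (psi0 : R -> R) : Prop :=
  {ae @lebesgue_measure R, forall m, A m ->
    trace0 (fun x => psi (x, m)) (psi0 m)}.

Definition milne_data (R : realType) (Tb : R) (psib : R -> R) : Prop :=
  [/\ 0 <= Tb, measurable_fun (`]0, 1]%classic : set R) psib &
      {ae @lebesgue_measure R, forall m, m \in `]0, 1] -> 0 <= psib m}].

Record milne_solution (R : realType) (Tb : R) (psib : R -> R)
    (T : R -> R) (psi : R * R -> R) : Prop := MilneSolution {
  milne_L2loc_T : L2loc (Rpos R) T ;
  milne_L2loc_psi : L2loc2 (strip R) psi ;
  milne_ge0_T : {ae @lebesgue_measure R, forall x, Rpos R x -> 0 <= T x} ;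
  milne_ge0_psi : {ae lebesgue2 R, forall p, strip R p -> 0 <= psi p} ;
  milne_bounded : exists C : R,
    {ae @lebesgue_measure R, forall x, Rpos R x -> `|T x| <= C} /\
    {ae lebesgue2 R, forall p, strip R p -> `|psi p| <= C} ;
  milne_eq_T : forall eta : R -> R, test_C2 eta ->
    \int[@lebesgue_measure R]_(x in Rpos R)
      (T x * derive1 (derive1 eta) x +
       angular_mean (fun m => psi (x, m) - T x ^+ 4) * eta x) = 0 ;
  milne_eq_psi : forall rho : R * R -> R, test_C1_strip rho ->
    \int[lebesgue2 R]_(p in strip R)
      (- (p.2 * psi p * Dx rho p) + (psi p - T p.1 ^+ 4) * rho p) = 0 ;
  milne_bc_T : trace0 T Tb ;
  milne_bc_psi : trace0_ae `]0, 1]%classic psi psib }.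

Definition data_energy (R : realType) (Tb : R) (psib : R -> R) : \bar R :=
  ((2^-1)%:E * \int[@lebesgue_measure R]_(m in `]0%R, 1%R])
     (m * (psib m - Tb ^+ 4) ^+ 2)%:E)%E.

(* dT is the weak derivative of T, psi0 the outgoing trace psi(0, .). *)
Definition weighted_estimate (R : realType) (Tb : R) (psib : R -> R)
    (T : R -> R) (psi : R * R -> R) : Prop :=
  exists (dT psi0 : R -> R),
  [/\ weak_derivative T dT,
      measurable_fun (`[-1, 0[%classic : set R) psi0,
      trace0_ae `[-1, 0[%classic psi psi0 &
      forall alpha : R, 0 <= alpha < 1 ->
      (\int[@lebesgue_measure R]_(x in Rpos R)
          (expR (2 * alpha * x) * (4 * T x ^+ 3 * dT x ^+ 2))%:E
       + (1 - alpha)%:E * \int[@lebesgue_measure R]_(x in Rpos R)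
          \int[@lebesgue_measure R]_(m in `[(-1)%R, 1%R])
            (expR (2 * alpha * x) * (psi (x, m) - T x ^+ 4) ^+ 2)%:E
       + (2^-1)%:E * \int[@lebesgue_measure R]_(m in `[(-1)%R, 0%R[)
            (`|m| * (psi0 m - Tb ^+ 4) ^+ 2)%:E
       <= data_energy Tb psib)%E].

(* f ranges over C^1(0, +oo), with f(0) = 0 read as the limit at 0+; both
   sides are extended real integrals and may be infinite. *)
Definition spectral_assumption (R : realType) (T : R -> R) : Prop :=
  let w (x : R) : R := 2 * T x `^ (3 / 2) in
  [/\ C1_on (Rpos R) T, (forall x, Rpos R x -> 0 <= T x) &
  exists beta0 M : R, [/\ 0 < beta0, 0 < M < 1 &
    forall f : R -> R, C1_on (Rpos R) f -> f x @[x --> 0^'+] --> 0 ->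
    (M%:E * \int[@lebesgue_measure R]_(x in Rpos R)
       (expR (2 * beta0 * x) * w x ^+ 2 * derive1 f x ^+ 2)%:E
     >= 4%:E * \int[@lebesgue_measure R]_(x in Rpos R)
       (expR (2 * beta0 * x) * derive1 w x ^+ 2 * f x ^+ 2)%:E)%E]].

Definition calV (R : realType) (eps : R) (T : R -> R)
    : set ((R -> R) * (R * R -> R)) :=
  [set Gphi | [/\ L2loc (Rpos R) Gphi.1, L2loc2 (strip R) Gphi.2 &
    ('N[@lebesgue_measure R]_(2%:E)
       [ (fun x => ((Gphi.1 x - T x) * \1_(Rpos R) x)%R%:E) ] <= eps%:E)%E]].

Definition Cb (R : realType) (Tb alpha beta gamma : R) : R :=
  Num.min (1 / 2 * Tb * Num.sqrt (3 * alpha * (1 - alpha)))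
          (1 / 72 * gamma^-1 * Tb ^+ 3 * beta * (alpha - beta)
             * Num.sqrt alpha).

Definition ae_equal (R : realType) (T1 : R -> R) (psi1 : R * R -> R)
    (T : R -> R) (psi : R * R -> R) : Prop :=
  {ae lebesgue2 R, forall p, strip R p -> T1 p.1 = T p.1 /\ psi1 p = psi p}.

Definition milne_unique (R : realType) (Tb : R) (psib : R -> R) : Prop :=
  forall (T1 : R -> R) (psi1 : R * R -> R) (T2 : R -> R) (psi2 : R * R -> R),
    milne_solution Tb psib T1 psi1 -> milne_solution Tb psib T2 psi2 ->
    ae_equal T1 psi1 T2 psi2.

(* Main.v *)
(* Every weak solution has a classical representative for almost every direction m:
   testing with products and using the lemma of du Bois-Reymond, T + <m^2 psi> is
   constant in x, T is C^1 with T' = k = <m psi>, and psi solves the transport equation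
   pointwise.  With h = T^4, r = psi - h and F = <m r^2> one has F' = -2<r^2> - 2h'k,
   and h'k = 4T^3k^2 >= 0; hence F is nonincreasing, F <= 2 E exp(-2x), with E the
   energy of the data, and |k| <= const sqrt(E) exp(-x).

   For two solutions with difference of fluxes z = k1 - k2 and g = T1 - T2, g' = z, the
   same identity has the term -2(T1^4 - T2^4)'z, whose bad part is of order
   T^2 |g| |k2| |z|.  For small E it is absorbed by adding to F a multiple of
   Tb^3 exp(-2x) g^2.  In general, if g is small with respect to T (for Tb > 0 this
   follows from L^2 smallness, because g is Lipschitz and T is bounded below), it is
   absorbed by the spectral inequality with f' = exp(-beta0 x)|z|, for which
   |g| <= exp(beta0 x) f.  In both cases z = 0, and then g = 0 and psi1 = psi2.

   If Tb = 0 and E > 0 then T ~ ax near 0 with a > 0, and test functions concentrated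
   near 0 contradict the spectral assumption; if Tb = E = 0 all fluxes vanish. *)
Require Import Defs.
From HB Require Import structures.
From mathcomp Require Import all_boot all_order all_algebra.
From mathcomp Require Import all_classical all_reals all_analysis.
From mathcomp Require Import measurable_realfun ring lra zify.
Import Order.TTheory GRing.Theory Num.Theory.
Import numFieldNormedType.Exports.
Local Open Scope classical_set_scope.
Local Open Scope ring_scope.

Set Implicit Arguments.
Unset Strict Implicit.
Unset Printing Implicit Defensive.

(** * Bounded measurable functions *)

(** A weak solution is determined only almost everywhere, and the exceptional set in x may depend on
    m. Testing with a countable family (bumps with rational end points) yields one null set of
    directions for all tests; the remaining directions form a set [D], without m = 0, on which
    everything is pointwise. For two solutions F has no sign and need not decrease, so information
    is required at both ends: F is at most small near 0, because the incoming data agree, and |F| <=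
    <r^2> is small at points tending to infinity. The corrected functional is nonincreasing, and
    these two facts force z = 0. The condition M < 1 is what Young's inequality asks for. If g is
    negligible against T, a parameter N bounds the bad term by 4 N T^3 z^2 + (36 / N) T k2^2 g^2,
    while the good term is 8 T^3 z^2, and the spectral inequality bounds the integral of T k2^2 g^2
    by M / 9 times that of T^3 z^2. The balance 4 M / N < 8 - 4 N can be met, with N near the square
    root of M, if and only if M < 1. *)

Section bounded_measurable.
Context {d} {X : measurableType d} {R : realType}.
Implicit Types f g : X -> R.

(** Measurability and bound refer to the whole space, not to a domain of integration: the class is
    closed under ring operations, which the tactic [bm] exploits, and its members are integrable on
    every set of finite measure. *)
Definition bmeas f := measurable_fun setT f /\ exists B : R, forall x, `|f x| <= B.

Lemma bmeas_cst (c : R) : bmeas (fun=> c).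
Proof. by split => //; exists `|c|. Qed.

Lemma bmeasD f g : bmeas f -> bmeas g -> bmeas (fun x => f x + g x).
Proof.
move=> [mf [B fB]] [mg [C gC]]; split; first exact: measurable_funD.
by exists (B + C) => x; rewrite (le_trans (ler_normD _ _))// lerD.
Qed.

Lemma bmeasM f g : bmeas f -> bmeas g -> bmeas (fun x => f x * g x).
Proof.
move=> [mf [B fB]] [mg [C gC]]; split; first exact: measurable_funM.
by exists (B * C) => x; rewrite normrM ler_pM.
Qed.

Lemma bmeasN f : bmeas f -> bmeas (fun x => - f x).
Proof.
move=> [mf [B fB]]; split; first exact: measurableT_comp.
by exists B => x; rewrite normrN.
Qed.

Lemma bmeasB f g : bmeas f -> bmeas g -> bmeas (fun x => f x - g x).
Proof. by move=> bf bg; apply: bmeasD => //; exact: bmeasN. Qed.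

Lemma bmeasX f n : bmeas f -> bmeas (fun x => f x ^+ n).
Proof.
move=> bf; elim: n => [|n IH].
  by under eq_fun do rewrite expr0; exact: bmeas_cst.
by under eq_fun do rewrite exprS; exact: bmeasM.
Qed.

Lemma bmeas_norm f : bmeas f -> bmeas (fun x => `|f x|).
Proof.
move=> [mf [B fB]]; split; first exact: measurableT_comp.
by exists B => x; rewrite normr_id.
Qed.

Lemma bmeas_indic (A : set X) : measurable A -> bmeas (\1_A : X -> R).
Proof.
move=> mA; split; first exact: measurable_indic.
by exists 1 => x; rewrite indicE; case: (_ \in _); rewrite ?normr1 ?normr0.
Qed.

Lemma bmeas_bound f : bmeas f -> exists B : R, 0 < B /\ forall x, `|f x| <= B.
Proof.
move=> [_ [B fB]]; exists (`|B| + 1); split => [|x].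
  by rewrite ltr_wpDl.
by rewrite (le_trans (fB x))// (le_trans (ler_norm _))// lerDl.
Qed.

Context (mu : {measure set X -> \bar R}) (D : set X).
Hypotheses (mD : measurable D) (finD : (mu D < +oo)%E).

Lemma bmeas_integrable f : bmeas f -> mu.-integrable D (EFin \o f).
Proof.
move=> [mf [B fB]]; apply: measurable_bounded_integrable => //.
  exact: measurable_funTS.
by exists `|B|; split => // C BC x _ /=; rewrite (le_trans (fB x))// ltW// (le_lt_trans _ BC) ?ler_norm.
Qed.

Lemma bintD f g : bmeas f -> bmeas g ->
  \int[mu]_(x in D) (f x + g x) = \int[mu]_(x in D) f x + \int[mu]_(x in D) g x.
Proof. by move=> bf bg; rewrite RintegralD//; exact: bmeas_integrable. Qed.

Lemma bintB f g : bmeas f -> bmeas g ->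
  \int[mu]_(x in D) (f x - g x) = \int[mu]_(x in D) f x - \int[mu]_(x in D) g x.
Proof. by move=> bf bg; rewrite RintegralB//; exact: bmeas_integrable. Qed.

Lemma bintZl f c : bmeas f ->
  \int[mu]_(x in D) (c * f x) = c * \int[mu]_(x in D) f x.
Proof. by move=> bf; rewrite RintegralZl//; exact: bmeas_integrable. Qed.

Lemma bintZr f c : bmeas f ->
  \int[mu]_(x in D) (f x * c) = \int[mu]_(x in D) f x * c.
Proof. by move=> bf; rewrite RintegralZr//; exact: bmeas_integrable. Qed.

Lemma bintN f : bmeas f ->
  \int[mu]_(x in D) (- f x) = - \int[mu]_(x in D) f x.
Proof.
move=> bf; rewrite -mulN1r -bintZl//.
by apply: eq_Rintegral => x _; rewrite mulN1r.
Qed.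

Lemma ble_int f g : bmeas f -> bmeas g -> (forall x, D x -> f x <= g x) ->
  \int[mu]_(x in D) f x <= \int[mu]_(x in D) g x.
Proof. by move=> bf bg fg; apply: le_Rintegral => //; exact: bmeas_integrable. Qed.

Lemma bint_norm f B : bmeas f -> (forall x, D x -> `|f x| <= B) ->
  `|\int[mu]_(x in D) f x| <= B * fine (mu D).
Proof.
move=> bf fB; rewrite (le_trans (le_normr_Rintegral mD (bmeas_integrable bf)))//.
rewrite -(Rintegral_cst mu mD); apply: ble_int => //.
  exact: bmeas_norm.
exact: bmeas_cst.
Qed.

Lemma eq_bint_ae f g : bmeas f -> bmeas g ->
  {ae mu, forall x, D x -> f x = g x} ->
  \int[mu]_(x in D) f x = \int[mu]_(x in D) g x.
Proof.
move=> [mf _] [mg _] fg; congr fine; apply: ae_eq_integral => //.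
- by apply/measurable_EFinP; exact: measurable_funTS.
- by apply/measurable_EFinP; exact: measurable_funTS.
- by apply: filterS fg => x /[apply] ->.
Qed.

Lemma cvg_bint (u : (X -> R)^nat) f B :
  (forall n, bmeas (u n)) -> bmeas f -> (forall n x, D x -> `|u n x| <= B) ->
  (forall x, D x -> u n x @[n --> \oo] --> f x) ->
  \int[mu]_(x in D) u n x @[n --> \oo] --> \int[mu]_(x in D) f x.
Proof.
move=> bu bf uB uf.
have iB : mu.-integrable D (EFin \o (fun=> B)) by apply: bmeas_integrable; exact: bmeas_cst.
apply: fine_cvg; rewrite fineK; last by apply: integrable_fin_num => //; exact: bmeas_integrable.
apply: (@dominated_cvg _ _ _ mu D mD (fun n x => (u n x)%:E) (EFin \o f) (EFin \o (fun=> B))) => //.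
- by move=> n; apply/measurable_EFinP; apply: measurable_funTS; case: (bu n).
- by move=> x Dx; apply: cvg_EFin; [exact: nearW|exact: uf].

Qed.

End bounded_measurable.
Lemma bmeas_comp {d1 d2} {X1 : measurableType d1} {X2 : measurableType d2} {R : realType}
    (f : X2 -> R) (h : X1 -> X2) :
  measurable_fun setT h -> bmeas f -> bmeas (fun x => f (h x)).
Proof.
move=> mh [mf [B fB]]; split; first exact: (measurableT_comp mf mh).
by exists B => x.
Qed.

Section bmeas_fubini.
Context {d1 d2} {X1 : measurableType d1} {X2 : measurableType d2} {R : realType}.
Context (m1 : {sigma_finite_measure set X1 -> \bar R})
        (m2 : {sigma_finite_measure set X2 -> \bar R}).
Implicit Types f : X1 * X2 -> R.

Lemma bmeas_pair1 f x : bmeas f -> bmeas (fun y => f (x, y)).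
Proof. exact: bmeas_comp. Qed.

Lemma bmeas_pair2 f y : bmeas f -> bmeas (fun x => f (x, y)).
Proof. exact: bmeas_comp. Qed.

(** Tonelli's measurability theorem is applied to the nonnegative function [f + B], and the
    contribution of the constant is subtracted afterwards. *)
Lemma bmeas_int f (A : set X2) : measurable A -> (m2 A < +oo)%E -> bmeas f ->
  bmeas (fun x => \int[m2]_(y in A) f (x, y)).
Proof.
move=> mA Afin bf; have [mf [B fB]] := bf; split; last first.
  exists (B * fine (m2 A)) => x; apply: bint_norm => //; exact: bmeas_pair1.
pose g (p : X1 * X2) := ((f p + B) * \1_A p.2).
have mg : measurable_fun setT (EFin \o g).
  apply/measurable_EFinP; apply: measurable_funM.
    by apply: measurable_funD.
  exact: measurableT_comp.
have g0 p : (0 <= (EFin \o g) p)%E.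
  rewrite /= lee_fin mulr_ge0//; first by rewrite -lerBlDr sub0r lerNl (le_trans _ (fB p))// -normrN ler_norm.
have := @measurable_fun_fubini_tonelli_F _ _ _ _ _ m2 _ mg g0.
move=> /(measurableT_comp (fine_measurable measurableT)) /= m.
rewrite (_ : (fun x => _) = (fun x => fine (fubini_F m2 (EFin \o g) x) - B * fine (m2 A))).
  exact: measurable_funB.
apply/funext => x; rewrite -(Rintegral_cst m2 mA).
apply/(canRL (addrK _)); rewrite -bintD//.
- rewrite /Rintegral integral_mkcond; congr fine.
  by apply: eq_integral => y _; rewrite patchE /g /= indicE; case: ifP; rewrite ?mulr1 ?mulr0.
- exact: bmeas_pair1.
- exact: bmeas_cst.
Qed.

Lemma bfubini f (A : set X1) (B : set X2) :
  measurable A -> (m1 A < +oo)%E -> measurable B -> (m2 B < +oo)%E -> bmeas f ->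
  \int[(m1 \x m2)%E]_(p in A `*` B) f p =
    \int[m1]_(x in A) \int[m2]_(y in B) f (x, y) /\
  \int[(m1 \x m2)%E]_(p in A `*` B) f p =
    \int[m2]_(y in B) \int[m1]_(x in A) f (x, y).
Proof.
move=> mA Afin mB Bfin bf.
have mAB : measurable (A `*` B) by exact: measurableX.
have ABfin : ((m1 \x m2)%E (A `*` B) < +oo)%E.
  by rewrite product_measure1E// lte_mul_pinfty ?ge0_fin_numE.
have ig : (m1 \x m2)%E.-integrable setT ((EFin \o f) \_ (A `*` B)).
  by apply/(integrable_mkcond _ mAB); apply: bmeas_integrable mAB ABfin f bf.
split; rewrite /Rintegral integral_mkcond.
  rewrite -integral12_prod_meas1// [in RHS]integral_mkcond; congr fine.
  apply: eq_integral => x _; rewrite patchE; case: ifPn => xA.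
    rewrite fineK; last by apply: integrable_fin_num => //; apply: bmeas_integrable => //; exact: bmeas_pair1.
    rewrite [RHS]integral_mkcond; apply: eq_integral => y _.
    by rewrite !patchE in_setX /= xA.
  by rewrite [LHS]integral0_eq// => y _; rewrite patchE in_setX /= (negbTE xA).
rewrite -integral21_prod_meas1// [in RHS]integral_mkcond; congr fine.
apply: eq_integral => y _; rewrite patchE; case: ifPn => yB.
  rewrite fineK; last by apply: integrable_fin_num => //; apply: bmeas_integrable => //; exact: bmeas_pair2.
  rewrite [RHS]integral_mkcond; apply: eq_integral => x _.
  by rewrite !patchE in_setX /= yB andbT.
by rewrite [LHS]integral0_eq// => x _; rewrite patchE in_setX /= (negbTE yB) andbF.
Qed.

End bmeas_fubini.

(** * Tactics for bounded measurability and for derivatives *)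

Ltac bm_step := first [ assumption |
  lazymatch goal with
  | |- bmeas (fun _ => ?c) => exact: bmeas_cst
  | |- bmeas (fun y => @?f y + @?g y) => apply (@bmeasD _ _ _ f g)
  | |- bmeas (fun y => - @?f y) => apply (@bmeasN _ _ _ f)
  | |- bmeas (fun y => @?f y * @?g y) => apply (@bmeasM _ _ _ f g)
  | |- bmeas (fun y => @?f y ^+ ?n) => apply (@bmeasX _ _ _ f n)
  end ].
Ltac bm := repeat bm_step.

(* The library rules in pointwise form, which the tactic [der] below matches syntactically. *)
Section pointwise_derivatives.
Context {R : realType}.
Implicit Types (f g : R -> R) (x df dg : R).

Lemma der_cst (c : R) x : is_derive x 1 (fun=> c) 0.
Proof. exact: is_derive_cst. Qed.

Lemma der_id x : is_derive x 1 (fun y : R => y) 1.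
Proof. exact: is_derive_id. Qed.

Lemma derD f g x df dg : is_derive x 1 f df -> is_derive x 1 g dg ->
  is_derive x 1 (fun y => f y + g y) (df + dg).
Proof. by move=> hf hg; exact: is_deriveD. Qed.

Lemma derN f x df : is_derive x 1 f df -> is_derive x 1 (fun y => - f y) (- df).
Proof. by move=> hf; exact: is_deriveN. Qed.

Lemma derM f g x df dg : is_derive x 1 f df -> is_derive x 1 g dg ->
  is_derive x 1 (fun y => f y * g y) (df * g x + f x * dg).
Proof.
move=> hf hg; have h := is_deriveM hf hg.
by apply: is_derive_eq h _; rewrite /GRing.scale /= addrC (mulrC df).
Qed.

Lemma derV f x df : f x != 0 -> is_derive x 1 f df ->
  is_derive x 1 (fun y => (f y)^-1) (- df / f x ^+ 2).
Proof.
move=> f0 hf; have h := is_deriveV f0 hf.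
by apply: is_derive_eq h _; rewrite /GRing.scale /= !mulNr mulrC.
Qed.

Lemma derX f n x df : is_derive x 1 f df ->
  is_derive x 1 (fun y => f y ^+ n) (n%:R * f x ^+ n.-1 * df).
Proof.
move=> hf; rewrite (_ : (fun _ => _) = f ^+ n); first exact: is_deriveX.
by rewrite exprfctE.
Qed.

Lemma der_comp f g x dg df : is_derive (g x) 1 f df -> is_derive x 1 g dg ->
  is_derive x 1 (fun y => f (g y)) (df * dg).
Proof. by move=> hf hg; exact: is_derive1_comp hf hg. Qed.

Lemma der_eq f x df dg : is_derive x 1 f df -> df = dg -> is_derive x 1 f dg.
Proof. by move=> h <-. Qed.

Lemma der_cont f x df : is_derive x 1 f df -> {for x, continuous f}.
Proof.
by move=> [d _]; apply: differentiable_continuous; exact/derivable1_diffP.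
Qed.

Lemma der_derive1 f x df : is_derive x 1 f df -> derive1 f x = df.
Proof. by move=> h; rewrite derive1E; exact: derive_val. Qed.

Lemma cvg_exprn {T} {F : set_system T} {FF : Filter F} (f : T -> R) (l : R) n :
  f @ F --> l -> f t ^+ n @[t --> F] --> l ^+ n.
Proof.
move=> fl; elim: n => [|n IH]; first by under eq_fun do rewrite expr0; exact: cvg_cst.
by under eq_fun do rewrite exprS; rewrite exprS; exact: cvgM.
Qed.

End pointwise_derivatives.

Ltac der_step :=
  lazymatch goal with
  | |- is_derive _ _ (fun _ => ?c) _ => exact: der_cst
  | |- is_derive _ _ (fun y => y) _ => exact: der_id
  | |- is_derive _ _ (fun y => @?f y + @?g y) _ => eapply (@derD _ f g)
  | |- is_derive _ _ (fun y => - @?f y) _ => eapply (@derN _ f)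
  | |- is_derive _ _ (fun y => @?f y * @?g y) _ => eapply (@derM _ f g)
  | |- is_derive _ _ (fun y => @?f y ^+ ?n) _ => eapply (@derX _ f n)
  | |- _ => eassumption
  end.
Ltac der := repeat der_step.

(** * Almost-everywhere statements *)

Section almost_everywhere.
Context {d} {X : measurableType d} {R : realType} {mu : {measure set X -> \bar R}}.
Implicit Types P Q : X -> Prop.

Lemma ae_sub P Q : (forall x, P x -> Q x) ->
  {ae mu, forall x, P x} -> {ae mu, forall x, Q x}.
Proof. by move=> PQ; exact: filterS. Qed.

Lemma ae_and P Q : {ae mu, forall x, P x} -> {ae mu, forall x, Q x} ->
  {ae mu, forall x, P x /\ Q x}.
Proof. by move=> p q; exact: filterI. Qed.

Lemma ae_all {I : countType} (P : I -> X -> Prop) :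
  (forall i, {ae mu, forall x, P i x}) -> {ae mu, forall x, forall i, P i x}.
Proof.
move=> H; have : {ae mu, forall x, forall n : nat, if (pickle_inv n : option I) is Some i then P i x else True}.
  by apply: ae_foralln => n; case: pickle_inv => [i|]; [exact: H|exact: aeW].
by apply: ae_sub => x Hx i; have := Hx (pickle i); rewrite pickleK_inv.
Qed.

End almost_everywhere.

Lemma Rintegral0_eq {d} {X : measurableType d} {R : realType}
    (mu : {measure set X -> \bar R}) (D : set X) (f : X -> R) :
  (forall x, D x -> f x = 0) -> \int[mu]_(x in D) f x = 0.
Proof. by move=> f0; rewrite /Rintegral integral0_eq// => x Dx; rewrite f0. Qed.

Lemma derivable_der {R : realType} (f : R -> R) (x : R) :
  derivable f x 1 -> is_derive x 1 f (derive1 f x).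
Proof. by move=> d; rewrite derive1E; exact: derivableP. Qed.

(** * C^1 approximations of indicators of intervals *)

Section real_line.
Context {R : realType}.
Local Notation mu := (@lebesgue_measure R).
Implicit Types (f : R -> R) (a b x y : R).

(** Serves for functions defined by cases, such as [sqpos], at the junction of the cases. *)
Lemma is_derive_quadratic f x l C :
  (forall h, `|f (x + h) - f x - l * h| <= C * h ^+ 2) -> is_derive x 1 f l.
Proof.
move=> H.
have C0 : 0 <= C by have := le_trans (normr_ge0 _) (H 1); rewrite expr1n mulr1.
have cvgl : h^-1 *: (f (h *: 1 + x) - f x) @[h --> 0^'] --> l.
  apply/cvgrPdist_le => e e0; near=> h.
  have h0 : h != 0 by near: h; exact: nbhs_dnbhs_neq.
  have hn : 0 < `|h| by rewrite normr_gt0.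
  rewrite distrC /GRing.scale /= mulr1 (addrC h).
  rewrite (_ : h^-1 * _ - l = h^-1 * (f (x + h) - f x - l * h)); last first.
    by rewrite [RHS]mulrBr (mulrC l h) mulKf.
  rewrite normrM normfV mulrC ler_pdivrMr// (le_trans (H h))//.
  rewrite -real_normK ?num_real// expr2 mulrA ler_pM2r//.
  suff : `|h| <= e / (C + 1).
    rewrite ler_pdivlMr ?ltr_wpDl// => le_e.
    by rewrite (le_trans _ le_e)// mulrC ler_wpM2l// lerDl.
  near: h; apply: dnbhs0_le; rewrite divr_gt0// ltr_wpDl//.
have dv : derivable f x 1 by apply/cvg_ex; exists l.
by apply: DeriveDef => //; exact/cvg_lim.
Unshelve. all: by end_near. Qed.

Definition sqpos y : R := Num.max y 0 ^+ 2.

Lemma is_derive_sqpos y : is_derive y 1 sqpos (2 * Num.max y 0).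
Proof.
apply: (@is_derive_quadratic _ _ _ 1) => h; rewrite /sqpos ler_norml.
by have [|] := leP y 0; have [|] := leP (y + h) 0 => *; apply/andP; split; nra.
Qed.

Lemma sqpos_ge0 y : 0 <= sqpos y. Proof. exact: sqr_ge0. Qed.

Lemma continuous_max0 : continuous (fun y : R => Num.max y 0).
Proof.
move=> y; rewrite (_ : (fun _ => _) = (fun y => (y + `|y|) / 2)).
  apply: cvgM; last exact: cvg_cst.
  by apply: cvgD => //; exact: cvg_norm.
by apply/funext => z; have [z0|z0] := leP z 0; rewrite ?(ler0_norm z0) ?(gtr0_norm z0); lra.
Qed.

(** The product (x - a) (b - x) is positive exactly on ]a, b[; its squared positive part is C^1, and
    s |-> 1 - 1 / (1 + n s) sends 0 to 0 and tends to 1 for s > 0 as n grows. This rational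
    construction is only C^1, which is all that the tests require. *)
Definition bump a b (n : nat) x : R := 1 - (1 + n%:R * sqpos ((x - a) * (b - x)))^-1.
Definition bump' a b (n : nat) x : R :=
  n%:R * (2 * Num.max ((x - a) * (b - x)) 0) * (a + b - 2 * x)
   / (1 + n%:R * sqpos ((x - a) * (b - x))) ^+ 2.

Lemma bump_den_gt0 n y : 0 < 1 + n%:R * sqpos y.
Proof. by rewrite ltr_pwDl// mulr_ge0// sqpos_ge0. Qed.

Lemma is_derive_bump a b n x : is_derive x 1 (bump a b n) (bump' a b n x).
Proof.
have d0 := bump_den_gt0 n ((x - a) * (b - x)).
eapply der_eq.
  rewrite /bump; der; apply: derV; first exact: lt0r_neq0.
  der; eapply (@der_comp _ sqpos); [exact: is_derive_sqpos|der].
by rewrite /bump'; field; exact: lt0r_neq0.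
Qed.

Lemma continuous_bump a b n : continuous (bump a b n).
Proof.
by move=> x; exact: der_cont (is_derive_bump a b n x).
Qed.

Lemma continuous_bump' a b n : continuous (bump' a b n).
Proof.
move=> x; have c1 : {for x, continuous (fun x => (x - a) * (b - x))}.
  by apply: cvgM; apply: cvgB => //; exact: cvg_cst.
have c2 := continuous_comp c1 (@continuous_max0 _).
apply: cvgM.
  apply: cvgM; last first.
    by apply: cvgB; [exact: cvg_cst|apply: cvgM => //; exact: cvg_cst].
  by apply: cvgM; [exact: cvg_cst|apply: cvgM; [exact: cvg_cst|exact: c2]].
apply: cvgV; first by rewrite expf_neq0// lt0r_neq0// bump_den_gt0.
apply: cvg_exprn; apply: cvgD; first exact: cvg_cst.
by apply: cvgM; [exact: cvg_cst|apply: cvg_exprn; exact: c2].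
Qed.

Lemma bump_itv a b n x : 0 <= bump a b n x <= 1.
Proof.
have d0 := bump_den_gt0 n ((x - a) * (b - x)).
rewrite /bump subr_ge0 lerBlDr lerDl invr_ge0 (ltW d0) andbT invf_le1//.
by rewrite lerDl mulr_ge0// sqpos_ge0.
Qed.

Lemma bump_eq0 a b n x : a <= b -> ~~ (a < x < b) -> bump a b n x = 0.
Proof.
move=> ab; rewrite negb_and -!leNgt => xab.
rewrite /bump /sqpos max_r ?expr0n/= ?mulr0 ?addr0 ?invr1 ?subrr//.
by case/orP: xab => ?; nra.
Qed.

Lemma bump_gt0 a b n x : a < x < b -> 0 < bump a b n.+1 x.
Proof.
move=> /andP[ax xb]; have p : 0 < sqpos ((x - a) * (b - x)).
  have q : 0 < (x - a) * (b - x) by rewrite mulr_gt0 ?subr_gt0.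
  by rewrite /sqpos max_l ?exprn_gt0 ?ltW.
by rewrite /bump subr_gt0 invf_lt1 ?bump_den_gt0// ltrDl mulr_gt0.
Qed.

Lemma cvg_bump a b x : a <= b -> bump a b n x @[n --> \oo] --> (\1_(`]a, b[%classic) x : R).
Proof.
move=> ab; have [xab|xab] := boolP (a < x < b); last first.
  rewrite indicE memNset/=; last by rewrite in_itv/=; exact/negP.
  by under eq_fun do rewrite bump_eq0//; exact: cvg_cst.
rewrite indicE mem_set/=; last by rewrite in_itv.
rewrite -[X in _ --> X]subr0; apply: cvgB; first exact: cvg_cst.
move/andP : xab => [ax xb]; have p : 0 < sqpos ((x - a) * (b - x)).
  have q : 0 < (x - a) * (b - x) by rewrite mulr_gt0 ?subr_gt0.
  by rewrite /sqpos max_l ?exprn_gt0 ?ltW.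
apply/gtr0_cvgV0; first by near=> n; exact: bump_den_gt0.
apply/cvgryPge => A; near=> n.
suff : A / sqpos ((x - a) * (b - x)) <= n%:R.
  by rewrite ler_pdivrMr// => h; rewrite (le_trans h)// lerDr.
by near: n; exact: nbhs_infty_ger.
Unshelve. all: by end_near. Qed.

Lemma bmeas_bump a b n : bmeas (bump a b n).
Proof.
split; first by apply: continuous_measurable_fun; exact: continuous_bump.
by exists 1 => x; have /andP[? ?] := bump_itv a b n x; rewrite ger0_norm.
Qed.

End real_line.

(** * Primitives and Lebesgue differentiation *)

Section primitives.
Context {R : realType}.
Local Notation mu := (@lebesgue_measure R).
Implicit Types (f : R -> R) (a b x y : R).

Lemma lebesgue_oc a b : (mu `]a, b] < +oo)%E.
Proof. by rewrite lebesgue_measure_itv; case: ifP => // _; rewrite ltry. Qed.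

Lemma fine_lebesgue_oc a b : a <= b -> fine (mu `]a, b]) = b - a.
Proof.
rewrite le_eqVlt => /predU1P[->|ab]; first by rewrite set_itvoc0 measure0 subrr.
by rewrite lebesgue_measure_itv /= lte_fin ab.
Qed.

Lemma bmeas_integrable_oc f a b : bmeas f -> mu.-integrable `]a, b] (EFin \o f).
Proof. by move=> bf; apply: bmeas_integrable => //; exact: lebesgue_oc. Qed.

(** The value is 0 for x <= a, not minus an integral. *)
Definition prim f a x : R := \int[mu]_(t in `]a, x]) f t.

Lemma primB f a x y : bmeas f -> a <= x -> x <= y ->
  prim f a y - prim f a x = \int[mu]_(t in `]x, y]) f t.
Proof.
by move=> bf ax xy; apply: Rintegral_itvB; rewrite ?bnd_simp//; exact: bmeas_integrable_oc.
Qed.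

Lemma prim_lip f a B : bmeas f -> (forall t, a < t -> `|f t| <= B) ->
  forall x y, a <= x -> x <= y -> `|prim f a y - prim f a x| <= B * (y - x).
Proof.
move=> bf fB x y ax xy; rewrite primB// -(fine_lebesgue_oc xy).
apply: bint_norm => //; first exact: lebesgue_oc.
by move=> t /=; rewrite in_itv/= => /andP[xt _]; rewrite fB// (le_lt_trans ax).
Qed.

Lemma prim0 f a : prim f a a = 0.
Proof. by rewrite /prim set_itvoc0 Rintegral_set0. Qed.

Lemma is_derive_prim f a x : bmeas f -> a < x -> {for x, continuous f} ->
  is_derive x 1 (prim f a) (f x).
Proof.
move=> bf ax cf; have x1 : x < x + 1 by rewrite ltrDl.
have [|d e] := continuous_FTC1 x1 (@bmeas_integrable_oc f a (x + 1) bf) _ cf.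
  by [].
by apply: DeriveDef; [exact: d|rewrite -derive1E; exact: e].
Qed.

(** By Lebesgue's theorem the primitive has derivative [f x] at almost every x, and here it is
    locally constant. *)
Lemma prim_eq0_ae f a b : bmeas f -> (forall x, a < x < b -> prim f a x = 0) ->
  {ae mu, forall x, a < x < b -> f x = 0}.
Proof.
move=> bf P0.
have lf : locally_integrable setT f.
  have [mf [B fB]] := bf.
  split => //; first exact: openT.
  move=> K _ cK; have [mK finK] : measurable K /\ (mu K < +oo)%E.
    by split; [exact: compact_measurable|exact: compact_finite_measure].
  have /integrableP[_] : mu.-integrable K (EFin \o f) by exact: bmeas_integrable.
  by [].
have := FTC1 (fun y => @bmeas_integrable_oc f a y bf) lf.
apply: ae_sub => x /= H /andP[ax xb].
have [|_ <-] := H; first by [].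
have xI : x \in `]a, b[ by rewrite in_itv /= ax.
rewrite derive1E (near_eq_derive (g := fun=> 0)) ?derive_cst//.
near=> y; apply: P0; near: y.
exact: near_in_itvoo.
Unshelve. all: by end_near. Qed.

Lemma Rintegral_oc_indic f a b u v : bmeas f -> a <= u -> v <= b ->
  \int[mu]_(x in `]a, b]) (f x * \1_(`]u, v[%classic) x) = \int[mu]_(x in `]u, v]) f x.
Proof.
move=> bf au vb.
rewrite -[RHS]Rintegral_itv_bndo_bndc; last first.
  by apply: integrableS (bmeas_integrable_oc u v bf) => //; exact: subset_itv_oo_oc.
rewrite [RHS]Rintegral_mkcond [LHS]Rintegral_mkcond; apply: eq_Rintegral => x _.
rewrite !patchE indicE; have [xuv|] := boolP (x \in `]u, v[%classic); last by case: ifP; rewrite ?mulr0.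
rewrite mulr1 mem_set//=; move: xuv; rewrite inE/= !in_itv/= => /andP[ux xv].
by rewrite (le_lt_trans au ux) (le_trans (ltW xv)).
Qed.

(** As n tends to infinity the tests give equal values of the primitive at all rational points;
    being Lipschitz and 0 at a, it vanishes on ]a, b[. The tests form a countable family, so that
    for a function depending on a parameter the exceptional null sets can be united. *)
Lemma bump_eq0_ae f a b : bmeas f -> a < b ->
  (forall (p q : rat) n, a < ratr p -> ratr p < ratr q :> R -> ratr q < b ->
    \int[mu]_(x in `]a, b]) (f x * bump (ratr p) (ratr q) n x) = 0) ->
  {ae mu, forall x, a < x < b -> f x = 0}.
Proof.
move=> bf ab H; have [B [B0 fB]] := bmeas_bound bf.
have Hpq (p q : rat) : a < ratr p -> ratr p < ratr q :> R -> ratr q < b ->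
    prim f a (ratr p) = prim f a (ratr q).
  move=> ap pq qb; apply/esym/eqP; rewrite -subr_eq0 primB ?ltW//.
  rewrite -(@Rintegral_oc_indic f a b) ?ltW//; apply/eqP.
  have c1 : \int[mu]_(x in `]a, b]) (f x * bump (ratr p) (ratr q) n x) @[n --> \oo] -->
      \int[mu]_(x in `]a, b]) (f x * \1_(`]ratr p, ratr q[%classic) x).
    apply: (@cvg_bint _ _ _ _ _ _ _ _ _ B) => //.
    - exact: lebesgue_oc.
    - by move=> n; apply: bmeasM => //; exact: bmeas_bump.
    - by apply: bmeasM => //; exact: bmeas_indic.
    - move=> n x _; rewrite normrM; have /andP[? ?] := bump_itv (ratr p) (ratr q) n x.
      by rewrite -[leRHS]mulr1 ler_pM// ger0_norm.
    - by move=> x _; apply: cvgM; [exact: cvg_cst|exact: cvg_bump (ltW pq)].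
  have E : (fun n => \int[mu]_(x in `]a, b]) (f x * bump (ratr p) (ratr q) n x)) = (fun=> 0).
    by apply/funext => n; exact: H.
  by rewrite E in c1; have := cvg_lim (@Rhausdorff R) c1; rewrite lim_cst// => <-.
have lip := @prim_lip f a B bf (fun t _ => fB t).
have dens x e : a < x < b -> 0 < e -> exists q : rat, [/\ a < ratr q, ratr q < x & x - ratr q < e].
  move=> /andP[ax xb] e0; have : Num.max a (x - e) < x by rewrite gt_max ax ltrBlDr ltrDl.
  move=> /rat_in_itvoo[q]; rewrite in_itv/= gt_max => /andP[/andP[? ?] ?].
  by exists q; split => //; rewrite ltrBlDr addrC -ltrBlDr.
apply: prim_eq0_ae => // x xab; have /andP[ax xb] := xab.
apply/eqP; rewrite -normr_le0; apply/ler_addgt0Pr => e e0; rewrite add0r.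
have e4 : 0 < e / 2 / B by rewrite !divr_gt0.
have [q [aq qx xq]] := dens _ _ xab e4.
have [p [ap pa' pe]] : exists p : rat, [/\ a < ratr p, ratr p < ratr q :> R & ratr p - a < e / 2 / B].
  have : a < Num.min (ratr q) (a + e / 2 / B) by rewrite lt_min aq ltrDl.
  move=> /rat_in_itvoo[p]; rewrite in_itv/= lt_min => /andP[? /andP[? ?]].
  by exists p; split => //; rewrite ltrBlDr addrC.
have h1 := lip _ _ (ltW aq) (ltW qx).
have h2 := lip _ _ (lexx a) (ltW ap).
rewrite -(Hpq p q) ?(lt_trans qx)// in h1.
rewrite prim0 subr0 in h2.
rewrite -[prim f a x](subrK (prim f a (ratr p))) (le_trans (ler_normD _ _))//.
rewrite [leRHS]splitr lerD//.
  by rewrite (le_trans h1)// mulrC -ler_pdivlMr// ltW.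
by rewrite (le_trans h2)// mulrC -ler_pdivlMr// ltW.
Qed.

End primitives.
(** * Test functions and the fundamental lemma *)

Section test_functions.
Context {R : realType}.
Local Notation mu := (@lebesgue_measure R).
Implicit Types (f s z : R -> R) (a b x y : R).

Definition csupp a b f := forall x, ~~ (a < x < b) -> f x = 0.

Lemma bmeas_csupp a b s : continuous s -> csupp a b s -> bmeas s.
Proof.
move=> cs s0; split; first exact: continuous_measurable_fun.
have [ab|ba] := leP a b; last first.
  exists 0 => x; rewrite s0 ?normr0//; apply/negP => /andP[ax xb].
  by have := lt_trans ba (lt_trans ax xb); rewrite ltxx.
have cn : {within `[a, b], continuous (fun x => `|s x|)}.
  by apply: continuous_subspaceT => x; apply: cvg_norm; exact: cs.
have [c cab cmax] := EVT_max ab cn.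
exists `|s c| => x; have [xab|/s0 ->] := boolP (a < x < b); last by rewrite normr0.
by apply: cmax; rewrite in_itv/=; move/andP: xab => [/ltW -> /ltW ->].
Qed.

Lemma prim_csupp_lt a b s x : 0 < a -> csupp a b s -> x <= a -> prim s 0 x = 0.
Proof.
move=> a0 s0 xa; apply: Rintegral0_eq.
move=> t; rewrite /= in_itv/= => /andP[_ tx]; apply: s0.
by rewrite negb_and -leNgt (le_trans tx xa).
Qed.

Lemma prim_csupp_gt a b s x : 0 < a -> a <= b -> bmeas s -> csupp a b s -> b <= x ->
  prim s 0 x = prim s 0 b.
Proof.
move=> a0 ab bs s0 bx; apply/eqP; rewrite -subr_eq0 primB//; last by rewrite (le_trans (ltW a0)).
apply/eqP; apply: Rintegral0_eq.
move=> t; rewrite /= in_itv/= => /andP[bt _]; apply: s0.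
by rewrite negb_and -[in X in _ || X]leNgt (ltW bt) orbT.
Qed.

(** This includes x <= 0, where the support condition with a > 0 makes both sides vanish; test
    functions must be C^1 on the whole line. *)
Lemma is_derive_prim_csupp a b s x : 0 < a -> continuous s -> csupp a b s ->
  is_derive x 1 (prim s 0) (s x).
Proof.
move=> a0 cs s0; have bs := bmeas_csupp cs s0.
have [xa|ax] := ltP x a; last by apply: is_derive_prim => //; [exact: lt_le_trans ax|exact: cs].
rewrite (s0 x) ?negb_and -?leNgt ?(ltW xa)//.
have E : \near x, (fun=> 0 : R) x = prim s 0 x.
  near=> y; rewrite (prim_csupp_lt a0 s0)//.
  by apply: ltW; near: y; exact: lt_nbhsl.
exact: near_eq_is_derive E (der_cst 0 x).
Unshelve. all: by end_near. Qed.

Lemma csupp_prim a b s : 0 < a -> a <= b -> continuous s -> csupp a b s ->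
  prim s 0 b = 0 -> csupp a b (prim s 0).
Proof.
move=> a0 ab cs s0 sb x; rewrite negb_and -!leNgt => /orP[xa|bx].
  exact: prim_csupp_lt s0 xa.
by rewrite (prim_csupp_gt a0 ab (bmeas_csupp cs s0) s0).
Qed.

Lemma continuous_prim a b s : 0 < a -> continuous s -> csupp a b s -> continuous (prim s 0).
Proof. by move=> a0 cs s0 x; exact: der_cont (is_derive_prim_csupp x a0 cs s0). Qed.

Lemma compact_supp_csupp a b f : 0 < a -> a <= b -> csupp a b f -> compact_supp_Rpos f.
Proof.
move=> a0 ab f0; exists a, b; split => // x xab; apply: f0.
by apply: contra xab => /andP[ax xb]; rewrite in_itv/= !ltW.
Qed.

Lemma C1_derive f f' : (forall x, is_derive x 1 f (f' x)) -> continuous f' -> C1_on setT f.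
Proof.
move=> df cf' x _; split; first by have [] := df x.
rewrite (_ : derive1 f = f'); first exact: cf'.
by apply/funext => y; exact: der_derive1.
Qed.

Lemma test_C1_strip_prod (f f' z z' : R -> R) a b : 0 < a -> a <= b -> csupp a b f ->
  (forall x, is_derive x 1 f (f' x)) -> continuous f' ->
  (forall x, is_derive x 1 z (z' x)) -> continuous z' ->
  test_C1_strip (fun p : R * R => f p.1 * z p.2) /\
  Dx (fun p : R * R => f p.1 * z p.2) = (fun p => f' p.1 * z p.2).
Proof.
move=> a0 ab f0 df cf' dz cz'.
have cf x : {for x, continuous f} by exact: der_cont (df x).
have cz x : {for x, continuous z} by exact: der_cont (dz x).
have d1 (p : R * R) : is_derive p ((1, 0) : R * R) (fun p : R * R => f p.1 * z p.2) (f' p.1 * z p.2).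
  have lin : forall h : R, (h *: ((1, 0) : R * R) + p) = (h *: 1 + p.1, p.2).
    by move=> h; case: p => x y; apply/pair_equal_spec; split => //=; rewrite scaler0 add0r.
  have dd := derM (df p.1) (der_cst (z p.2) p.1).
  have dd' : is_derive p.1 1 (fun x => f x * z p.2) (f' p.1 * z p.2) by apply: der_eq dd _; rewrite mulr0 addr0.
  have E : (fun h : R => h^-1 *: ((fun p : R * R => f p.1 * z p.2) (h *: ((1, 0) : R * R) + p) - f p.1 * z p.2)) =
      (fun h : R => h^-1 *: ((fun x => f x * z p.2) (h *: (1 : R) + p.1) - f p.1 * z p.2)).
    by apply/funext => h; rewrite lin.
  by case: dd' => dv vl; apply: DeriveDef; rewrite /derivable /derive E.
have d2 (p : R * R) : is_derive p ((0, 1) : R * R) (fun p : R * R => f p.1 * z p.2) (f p.1 * z' p.2).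
  have lin : forall h : R, (h *: ((0, 1) : R * R) + p) = (p.1, h *: 1 + p.2).
    by move=> h; case: p => x y; apply/pair_equal_spec; split => //=; rewrite scaler0 add0r.
  have dd := derM (der_cst (f p.1) p.2) (dz p.2).
  have dd' : is_derive p.2 1 (fun x => f p.1 * z x) (f p.1 * z' p.2) by apply: der_eq dd _; rewrite mul0r add0r.
  have E : (fun h : R => h^-1 *: ((fun p : R * R => f p.1 * z p.2) (h *: ((0, 1) : R * R) + p) - f p.1 * z p.2)) =
      (fun h : R => h^-1 *: ((fun x => f p.1 * z x) (h *: (1 : R) + p.2) - f p.1 * z p.2)).
    by apply/funext => h; rewrite lin.
  by case: dd' => dv vl; apply: DeriveDef; rewrite /derivable /derive E.
have cfst (g : R -> R) (p : R * R) : {for p.1, continuous g} -> {for p, continuous (fun p : R * R => g p.1)}.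
  by move=> cg; apply: (@continuous_comp _ _ _ fst g); [exact: cvg_fst|exact: cg].
have csnd (g : R -> R) (p : R * R) : {for p.2, continuous g} -> {for p, continuous (fun p : R * R => g p.2)}.
  by move=> cg; apply: (@continuous_comp _ _ _ snd g); [exact: cvg_snd|exact: cg].
have D1 : Dx (fun p : R * R => f p.1 * z p.2) = (fun p => f' p.1 * z p.2).
  by apply/funext => p; rewrite /Dx; exact: derive_val.
have D2 : Dm (fun p : R * R => f p.1 * z p.2) = (fun p => f p.1 * z' p.2).
  by apply/funext => p; rewrite /Dm; exact: derive_val.
split => //; split.
- by move=> p; split; [case: (d1 p)|case: (d2 p)].
- by rewrite D1 => p; apply: cvgM; [apply: cfst; exact: cf'|apply: csnd; exact: cz].
- by rewrite D2 => p; apply: cvgM; [apply: cfst; exact: cf|apply: csnd; exact: cz'].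
- exists a, b; split => // p pab; rewrite f0 ?mul0r//.
  by apply: contra pab => /andP[ax xb]; rewrite in_itv/= !ltW.
Qed.

End test_functions.
Section du_Bois_Reymond.
Context {R : realType}.
Local Notation mu := (@lebesgue_measure R).
Implicit Types (f s u V : R -> R) (a b x y : R).

Lemma csupp_bump a b n : a <= b -> csupp a b (bump a b n).
Proof. by move=> ab x; exact: bump_eq0. Qed.

Lemma csuppS a b c d f : c <= a -> b <= d -> csupp a b f -> csupp c d f.
Proof.
move=> ca bd f0 x; rewrite negb_and -!leNgt => xcd; apply: f0.
by rewrite negb_and -!leNgt; case/orP: xcd => h; rewrite ?(le_trans h)// (le_trans bd) ?orbT.
Qed.

Lemma bump12_gt0 : 0 < prim (bump 1 2 1) 0 2 :> R.
Proof.
have l12 : 1 <= 2 :> R by lra.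
have d (x : R) := is_derive_prim_csupp x ltr01 (@continuous_bump R 1 2 1) (csupp_bump 1 l12).
have [||c] := @MVT _ (prim (bump 1 2 1) 0) (bump 1 2 1) 1 2 _ (fun x _ => d x).
- by lra.
- by apply: continuous_subspaceT => x; exact: der_cont (d x).
rewrite in_itv/= => c12.
rewrite (prim_csupp_lt ltr01 (csupp_bump 1 l12) (lexx 1)) subr0 => ->.
by rewrite mulr_gt0 ?bump_gt0//; lra.
Qed.

(** A fixed C^1 density of integral 1 supported in [1, 2]. It corrects test functions to mean zero,
    and a function found to be constant is identified with its average against [cutoff]. *)
Definition cutoff x : R := bump 1 2 1 x / prim (bump 1 2 1) 0 2.
Definition cutoff' x : R := bump' 1 2 1 x / prim (bump 1 2 1) 0 2.

Lemma is_derive_cutoff x : is_derive x 1 cutoff (cutoff' x).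
Proof.
rewrite /cutoff; have h := is_derive_bump 1 2 1 x; eapply der_eq; first by der.
by rewrite mulr0 addr0.
Qed.

Lemma continuous_cutoff : continuous cutoff.
Proof. by move=> x; exact: der_cont (is_derive_cutoff x). Qed.

Lemma continuous_cutoff' : continuous cutoff'.
Proof. by move=> x; apply: cvgM; [exact: continuous_bump'|exact: cvg_cst]. Qed.

Lemma csupp_cutoff : csupp 1 2 cutoff.
Proof. by move=> x x12; rewrite /cutoff bump_eq0 ?mul0r//; lra. Qed.

Lemma csupp_cutoff' : csupp 1 2 cutoff'.
Proof.
move=> x x12; rewrite /cutoff' /bump' max_r ?mulr0 ?mul0r//.
by move: x12; rewrite negb_and -!leNgt => /orP[] ?; nra.
Qed.

Lemma bmeas_cutoff : bmeas cutoff.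
Proof. exact: bmeas_csupp continuous_cutoff csupp_cutoff. Qed.

Lemma prim_cutoff : prim cutoff 0 2 = 1.
Proof.
rewrite /prim /cutoff bintZr//; last exact: bmeas_bump.
  by rewrite mulfV// gt_eqF// bump12_gt0.
exact: lebesgue_oc.
Qed.

(** Mean zero is what makes the primitive compactly supported, hence an admissible test function. *)
Definition mean_zero_bump (a b : R) n x : R := bump a b n x - prim (bump a b n) 0 b * cutoff x.

Lemma continuous_mean_zero_bump a b n : continuous (mean_zero_bump a b n).
Proof.
move=> x; apply: cvgB; first exact: continuous_bump.
by apply: cvgM; [exact: cvg_cst|exact: continuous_cutoff].
Qed.

Lemma csupp_mean_zero_bump a b n : a <= b -> csupp (Num.min a 1) (Num.max b 2) (mean_zero_bump a b n).
Proof.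
move=> ab x x0; rewrite /mean_zero_bump.
rewrite (@csuppS a b _ _ (bump a b n) _ _ (csupp_bump n ab) x x0) ?ge_min ?le_max ?lexx//.
rewrite (@csuppS 1 2 _ _ cutoff _ _ csupp_cutoff x x0) ?ge_min ?le_max ?lexx ?orbT//.
by rewrite mulr0 subr0.
Qed.

(** The bound on [V] is asked for on each ]0, N] only, since the [V] of the transport equation
    contains a primitive that may grow linearly. *)
Lemma primM_mean_zero_bump V a b n (N : R) : bmeas (fun x => V x * \1_(`]0, N]%classic) x) ->
  prim (fun x => V x * mean_zero_bump a b n x) 0 N =
  prim (fun x => V x * bump a b n x) 0 N
   - prim (bump a b n) 0 b * prim (fun x => V x * cutoff x) 0 N.
Proof.
move=> bV; pose W x := V x * \1_(`]0, N]%classic) x.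
have E (g : R -> R) : prim (fun x => V x * g x) 0 N = prim (fun x => W x * g x) 0 N.
  by apply: eq_Rintegral => x xN; rewrite /W indicE xN mulr1.
rewrite !E; have bWc := bmeasM bV bmeas_cutoff.
rewrite /prim -bintZl//; last exact: lebesgue_oc.
rewrite -bintB//.
- by apply: eq_Rintegral => x _; rewrite /mean_zero_bump mulrBr mulrCA.
- exact: lebesgue_oc.
- by apply: bmeasM => //; exact: bmeas_bump.
- by apply: bmeasM => //; exact: bmeas_cst.
Qed.

Lemma prim_mean_zero_bump a b n : 0 < a -> a <= b -> prim (mean_zero_bump a b n) 0 (Num.max b 2) = 0.
Proof.
move=> a0 ab.
have := @primM_mean_zero_bump (fun=> 1) a b n (Num.max b 2) (bmeasM (bmeas_cst 1) (bmeas_indic (measurable_itv _))).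
have one (f : R -> R) : (fun x => 1 * f x) = f by apply/funext => x; rewrite mul1r.
rewrite !one.
move=> ->; rewrite (prim_csupp_gt a0 ab (bmeas_bump _ _ _) (csupp_bump n ab)) ?le_max ?lexx//.
rewrite (prim_csupp_gt ltr01 _ bmeas_cutoff csupp_cutoff) ?le_max ?lexx ?orbT//; last lra.
by rewrite prim_cutoff mulr1 subrr.
Qed.

(** The hypothesis says that [V - c], with c the average of [V] against [cutoff], is orthogonal to
    every rational bump, so [bump_eq0_ae] applies on each ]0, N[. *)
Lemma du_Bois_Reymond V :
  (forall N : R, bmeas (fun x => V x * \1_(`]0, N]%classic) x)) ->
  (forall (p q : rat) n (N : nat), 0 < ratr p :> R -> ratr p < ratr q :> R ->
     ratr q < N%:R :> R -> 2 < N%:R :> R ->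
     prim (fun x => V x * mean_zero_bump (ratr p) (ratr q) n x) 0 N%:R = 0) ->
  {ae mu, forall x, 0 < x -> V x = prim (fun x => V x * cutoff x) 0 2}.
Proof.
move=> bV H; set c := prim _ 0 2.
have cN (N : nat) : 2 < N%:R :> R -> prim (fun x => V x * cutoff x) 0 N%:R = c.
  move=> N2; pose W x := V x * \1_(`]0, N%:R]%classic) x.
  have E M : M <= N%:R -> prim (fun x => V x * cutoff x) 0 M = prim (fun x => W x * cutoff x) 0 M.
    move=> MN; apply: eq_Rintegral => x; rewrite inE/= in_itv/= => /andP[x0 xM].
    by rewrite /W indicE mem_set ?mulr1//= in_itv/= x0 (le_trans xM).
  rewrite /c !E ?(ltW N2)//; apply: prim_csupp_gt ltr01 _ _ _ _; rewrite ?(ltW N2)//; try lra.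
    exact: bmeasM (bV _) bmeas_cutoff.
  by move=> x x0; rewrite csupp_cutoff ?mulr0.
have HN (N : nat) : 2 < N%:R :> R -> {ae mu, forall x, 0 < x < N%:R -> V x = c}.
  move=> N2; pose W x := V x * \1_(`]0, N%:R]%classic) x - c.
  have bW : bmeas W by apply: bmeasB (bV _) (bmeas_cst _).
  have : {ae mu, forall x, 0 < x < N%:R -> W x = 0}.
    apply: bump_eq0_ae => //; first by lra.
    move=> p q n p0 pq qN.
    have := H p q n N p0 pq qN N2; rewrite primM_mean_zero_bump// cN//.
    rewrite -(prim_csupp_gt p0 (ltW pq) (bmeas_bump _ _ _) (csupp_bump n (ltW pq)) (ltW qN)).
    rewrite mulrC /prim -bintZl; [|by []|exact: lebesgue_oc|exact: bmeas_bump].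
    have -> : \int[mu]_(t in `]0, N%:R]) (V t * bump (ratr p) (ratr q) n t) =
              \int[mu]_(t in `]0, N%:R]) (V t * \1_(`]0, N%:R]%classic) t * bump (ratr p) (ratr q) n t).
      by apply: eq_Rintegral => x xN; rewrite indicE xN mulr1.
    rewrite -bintB//.
    - by move=> H0; rewrite -[RHS]H0; apply: eq_Rintegral => x _; rewrite /W mulrBl.
    - exact: lebesgue_oc.
    - exact: bmeasM (bV _) (bmeas_bump _ _ _).
    - exact: bmeasM (bmeas_cst _) (bmeas_bump _ _ _).
  apply: ae_sub => x Wx xN; have /eqP := Wx xN; rewrite /W indicE mem_set ?mulr1 ?subr_eq0; last first.
    by rewrite /= in_itv/=; move/andP: xN => [-> /ltW].
  by move/eqP.
(* The shift by 3 makes N exceed 2, the right end of the support of [cutoff]. *)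
have HN' (n : nat) : {ae mu, forall x, 0 < x < n.+3%:R -> V x = c}.
  by apply: HN; rewrite ltr_nat.
have := ae_foralln HN'; apply: ae_sub => x Hx x0.
have [n xn] : exists n : nat, x < n%:R.
  by exists (Num.truncn x).+1; exact: truncnS_gt.
by apply: (Hx n); rewrite x0 (lt_trans xn)// ltr_nat; lia.
Qed.

End du_Bois_Reymond.
Section du_Bois_Reymond_second_order.
Context {R : realType}.
Local Notation mu := (@lebesgue_measure R).
Implicit Types (u : R -> R).

(* A mean-zero test function is the second derivative of a test function, up to
   [J] times the second derivative of a plateau spread over a length [L], whose
   contribution to the integral of a bounded function is O(1 / L). *)
Lemma du_Bois_Reymond2 u : bmeas u ->
  (forall (f : R -> R) (a b N : R), 0 < a -> a <= b -> b <= N -> csupp a b f -> csupp a b (derive1 f) ->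
    csupp a b (derive1 (derive1 f)) -> test_C2 f ->
    prim (fun x => u x * derive1 (derive1 f) x) 0 N = 0) ->
  {ae mu, forall x, 0 < x -> u x = prim (fun x => u x * cutoff x) 0 2}.
Proof.
move=> bu H; apply: du_Bois_Reymond => [N|p q n N p0 pq qN N2].
  exact: bmeasM bu (bmeas_indic (measurable_itv _)).
set s := mean_zero_bump _ _ n; set a := Num.min (ratr p) (1 : R); set b := Num.max (ratr q) (2 : R).
have a0 : 0 < a by rewrite lt_min p0 ltr01.
have a1 : a <= 1 by rewrite ge_min lexx orbT.
have b2 : 2 <= b by rewrite le_max lexx orbT.
have ab : a <= b by rewrite (le_trans a1)// (le_trans _ b2)//; lra.
have bN : b <= N%:R by rewrite ge_max (ltW qN) (ltW N2).
have cs : continuous s by exact: continuous_mean_zero_bump.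
have s0 : csupp a b s by exact: csupp_mean_zero_bump (ltW pq).
have sb : prim s 0 b = 0 by exact: prim_mean_zero_bump (ltW pq).
have ds x := is_derive_prim_csupp x a0 cs s0.
pose e := prim s 0.
have ce : continuous e by exact: continuous_prim cs s0.
have e0 : csupp a b e by exact: csupp_prim.
have de x := is_derive_prim_csupp x a0 ce e0.
set J := prim e 0 b.
have dS x := is_derive_prim_csupp x ltr01 (@continuous_cutoff R) (@csupp_cutoff R).
have [B [B0 uB]] := bmeas_bound bu.
have [K [K0 cK]] := bmeas_bound (bmeas_csupp (@continuous_cutoff' R) (@csupp_cutoff' R)).
have bs : bmeas s by exact: bmeas_csupp cs s0.
have us0 : csupp a b (fun x => u x * s x) by move=> x x0; rewrite s0 ?mulr0.
have key L : b <= L -> `|prim (fun x => u x * s x) 0 N%:R| <= 2 * (`|J| * B * K) / L.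
  move=> bL; have L0 : 0 < L by rewrite (lt_le_trans _ bL)// (lt_le_trans _ b2).
  (* The double primitive of [s] equals the constant [J] to the right of b. The subtracted plateau
     rises from 0 to [J] between L and 2 L, so [f] has compact support, and the second derivative of
     the plateau is of order 1 / L^2 on a length L. *)
  pose f x := prim e 0 x - J * prim cutoff 0 (L^-1 * x).
  pose f' x := e x - J * (cutoff (L^-1 * x) * L^-1).
  pose f'' x := s x - J * (cutoff' (L^-1 * x) * L^-1 * L^-1).
  have dl (x : R) : is_derive x 1 (fun y => L^-1 * y) L^-1.
    eapply der_eq; first by der.
    by rewrite mul0r mulr1 add0r.
  have df (x : R) : is_derive x 1 f (f' x).
    have h := der_comp (dS (L^-1 * x)) (dl x); have h' := de x.
    eapply der_eq; first (rewrite /f; by der).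
    by rewrite /f' mul0r add0r.
  have df' (x : R) : is_derive x 1 f' (f'' x).
    have h := der_comp (is_derive_cutoff (L^-1 * x)) (dl x); have h' := ds x.
    eapply der_eq; first (rewrite /f'; by der).
    by rewrite /f'' mul0r add0r mulr0 addr0.
  have cf'' : continuous f''.
    move=> x; apply: cvgB; first exact: cs.
    apply: cvgM; [exact: cvg_cst|apply: cvgM; [apply: cvgM|exact: cvg_cst]]; last exact: cvg_cst.
    apply: (@continuous_comp _ _ _ (fun y => L^-1 * y) cutoff' x); last exact: continuous_cutoff'.
    exact: der_cont (dl x).
  have cf' : continuous f' by move=> x; exact: der_cont (df' x).
  have f0 : csupp a (2 * L) f.
    move=> x; rewrite negb_and -!leNgt /f => /orP[xa|Lx].
      rewrite (prim_csupp_lt a0 e0 xa) (prim_csupp_lt ltr01 (@csupp_cutoff R)) ?mulr0 ?subr0//.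
      rewrite mulrC ler_pdivrMr// mul1r (le_trans xa)// (le_trans a1)// (le_trans _ bL)// (le_trans _ b2)//; lra.
    rewrite (prim_csupp_gt a0 ab (bmeas_csupp ce e0) e0); last by nra.
    rewrite (prim_csupp_gt ltr01 _ (@bmeas_cutoff R) (@csupp_cutoff R)) ?prim_cutoff ?mulr1 ?subrr//.
      by lra.
    by rewrite mulrC ler_pdivlMr.
  have tf : test_C2 f.
    have df1 : derive1 f = f' by apply/funext => x; exact: der_derive1.
    split; first exact: C1_derive df cf'.
      by rewrite df1; exact: C1_derive df' cf''.
    by apply: compact_supp_csupp a0 _ f0; nra.
  have a2L : a <= 2 * L by nra.
  have E1 : derive1 f = f' by apply/funext => x; exact: der_derive1.
  have E2 : derive1 (derive1 f) = f'' by rewrite E1; apply/funext => x; exact: der_derive1.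
  have outL x : ~~ (a < x < 2 * L) -> ~~ (1 < L^-1 * x < 2).
    apply: contra => /andP[x1 x2]; move: x1 x2.
    rewrite mulrC ltr_pdivlMr// ltr_pdivrMr// mul1r => x1 x2; rewrite x2 andbT.
    by rewrite (le_lt_trans _ x1)// (le_trans a1)// (le_trans _ bL)// (le_trans _ b2)//; lra.
  have b2L : b <= 2 * L by nra.
  have f'0 : csupp a (2 * L) f'.
    move=> x x0; rewrite /f' (csupp_cutoff (outL _ x0)).
    by rewrite (csuppS (lexx a) b2L e0 x0) mul0r mulr0 subr0.
  have f''0 : csupp a (2 * L) f''.
    move=> x x0; rewrite /f'' (csupp_cutoff' (outL _ x0)).
    by rewrite (csuppS (lexx a) b2L s0 x0) !mul0r mulr0 subr0.
  have := H f a (2 * L) (2 * L) a0 a2L (lexx _) f0.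
  rewrite E2 E1 => /(_ f'0 f''0 tf).
  have bc : bmeas (fun x => J * (cutoff' (L^-1 * x) * L^-1 * L^-1)).
    apply: bmeasM (bmeas_cst _) _; apply: bmeasM _ (bmeas_cst _); apply: bmeasM _ (bmeas_cst _).
    apply: (bmeas_comp (h := fun x : R => L^-1 * x)).
      by apply: measurable_funM => //.
    exact: bmeas_csupp (@continuous_cutoff' R) (@csupp_cutoff' R).
  have -> : (fun x => u x * f'' x) = (fun x => u x * s x - u x * (J * (cutoff' (L^-1 * x) * L^-1 * L^-1))).
    by apply/funext => x; rewrite /f'' mulrBr.
  rewrite /prim bintB //; [|exact: lebesgue_oc|exact: bmeasM|exact: bmeasM].
  move=> /eqP; rewrite subr_eq0 => /eqP E.
  have bus : bmeas (fun x => u x * s x) by exact: bmeasM.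
  have -> : \int[mu]_(t in `]0, N%:R]) (u t * s t) = \int[mu]_(t in `]0, 2 * L]) (u t * s t).
    rewrite -!/(prim (fun x => u x * s x) 0 _) !(prim_csupp_gt a0 ab bus us0)//.
  rewrite E; apply: le_trans (bint_norm (B := B * (`|J| * (K * L^-1 * L^-1))) _ _ _ _) _ => //.
  - exact: lebesgue_oc.
  - exact: bmeasM.
  - have Li : 0 <= L^-1 by rewrite invr_ge0 ltW.
    move=> x _; rewrite normrM ler_pM// normrM ler_wpM2l// normrM (ger0_norm Li) ler_wpM2r//.
    by rewrite normrM (ger0_norm Li) ler_wpM2r.
  - rewrite fine_lebesgue_oc ?subr0; last by nra.
    rewrite le_eqVlt; apply/orP; left; apply/eqP; field; exact: lt0r_neq0.
apply/eqP; rewrite -normr_le0; apply/ler_addgt0Pr => eps eps0; rewrite add0r.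
set M := 2 * (`|J| * B * K) in key.
have M0 : 0 <= M by rewrite /M !mulr_ge0// ltW.
pose L := Num.max b (M / eps).
have L0 : 0 < L by rewrite lt_max (lt_le_trans _ b2).
apply: le_trans (key L _) _; first by rewrite le_max lexx.
by rewrite ler_pdivrMr// mulrC -ler_pdivrMr// le_max lexx orbT.
Qed.

End du_Bois_Reymond_second_order.
(** * From weak to classical solutions *)

Section product_ae.
Context {d1 d2} {X1 : measurableType d1} {X2 : measurableType d2} {R : realType}.
Context (m1 : {sigma_finite_measure set X1 -> \bar R})
        (m2 : {sigma_finite_measure set X2 -> \bar R}).
Local Open Scope ereal_scope.

Lemma product_measure12 (N : set (X1 * X2)) : measurable N ->
  (m1 \x m2) N = \int[m2]_y m1 (ysection N y).
Proof.
move=> mN; rewrite (@product_measure_unique _ _ _ _ _ m1 m2 (m1 \x^ m2)%E)//.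
by move=> A B mA mB; exact: product_measure2E.
Qed.

Lemma integral_eq0_ae {d} {X : measurableType d} (m : {measure set X -> \bar R}) (f : X -> \bar R) :
  measurable_fun setT f -> (forall x, 0 <= f x) -> \int[m]_x f x = 0 ->
  {ae m, forall x, f x = 0}.
Proof.
move=> mf f0 If; have : \int[m]_x `|f x| = 0.
  by rewrite -[RHS]If; apply: eq_integral => x _; rewrite gee0_abs.
by move/(ae_eq_integral_abs m measurableT mf); apply: ae_sub => x; exact.
Qed.

Lemma ae_prod1 (P : X1 * X2 -> Prop) : {ae m1 \x m2, forall p, P p} ->
  {ae m1, forall x, {ae m2, forall y, P (x, y)}}.
Proof.
move=> [N [mN N0 PN]].
have : {ae m1, forall x, m2 (xsection N x) = 0}.
  by apply: integral_eq0_ae => //; exact: measurable_fun_xsection.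
apply: ae_sub => x Nx; exists (xsection N x); split => //.
  exact: measurable_xsection.
by move=> y /= nP; rewrite /xsection /= inE; exact: PN.
Qed.

Lemma ae_prod2 (P : X1 * X2 -> Prop) : {ae m1 \x m2, forall p, P p} ->
  {ae m2, forall y, {ae m1, forall x, P (x, y)}}.
Proof.
move=> [N [mN N0 PN]].
have : {ae m2, forall y, m1 (ysection N y) = 0}.
  apply: integral_eq0_ae => //; first exact: measurable_fun_ysection.
  by rewrite -product_measure12.
apply: ae_sub => x Nx; exists (ysection N x); split => //.
  exact: measurable_ysection.
by move=> y /= nP; rewrite /ysection /= inE; exact: PN.
Qed.

Lemma ae_prod_converse (A : set (X1 * X2)) : measurable A ->
  {ae m2, forall y, {ae m1, forall x, A (x, y)}} -> {ae m1 \x m2, forall p, A p}.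
Proof.
move=> mA H; exists (~` A); split => //; first exact: measurableC.
rewrite product_measure12; last exact: measurableC.
rewrite (ae_eq_integral (cst 0)) ?integral0//.
- by apply: measurable_fun_ysection; exact: measurableC.
- apply: ae_sub H => y [N [mN N0 AN]] _.
  apply/eqP; rewrite -measure_le0 -[X in _ <= X]N0 le_measure ?inE//.
    by apply: measurable_ysection; exact: measurableC.
  by move=> x; rewrite /ysection /= inE => nA; exact: AN.
Qed.

(** For solutions before clipping, which are bounded only almost everywhere; positive and negative
    parts are treated separately by Tonelli. *)
Lemma measurable_int (F : X1 * X2 -> R) (A : set X2) : measurable A ->
  measurable_fun setT F ->
  measurable_fun setT (fun x => (\int[m2]_(y in A) F (x, y))%R).
Proof.
move=> mA mF.
pose g (p : X1 * X2) := (F p * \1_A p.2)%R.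
have mg : measurable_fun setT (EFin \o g).
  by apply/measurable_EFinP; apply: measurable_funM => //; exact: measurableT_comp.
have h1 := @measurable_fun_fubini_tonelli_F _ _ _ _ _ m2 _ (measurable_funepos mg) (fun x => funepos_ge0 _ x).
have h2 := @measurable_fun_fubini_tonelli_F _ _ _ _ _ m2 _ (measurable_funeneg mg) (fun x => funeneg_ge0 _ x).
have := measurableT_comp (fine_measurable measurableT) (emeasurable_funB h1 h2).
apply: eq_measurable_fun => x _ /=; rewrite /Rintegral integral_mkcond integralE.
rewrite /fubini_F; congr fine; congr (_ - _); apply: eq_integral => y _.
  by rewrite !funeposE patchE /g /= indicE; case: ifP => _; rewrite ?mulr1 ?mulr0//.
by rewrite !funenegE patchE /g /= indicE; case: ifP => _; rewrite ?mulr1 ?mulr0//.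
Qed.

End product_ae.

Section normalization.
Context {R : realType}.
Local Notation mu := (@lebesgue_measure R).

Lemma measurable_intR (F : R * R -> R) (A : set R) : measurable A ->
  measurable_fun setT F -> measurable_fun setT (fun x => \int[mu]_(y in A) F (x, y)).
Proof. exact: (@measurable_int _ _ (measurableTypeR R) (measurableTypeR R) R mu F A). Qed.

Lemma bmeas_intR (F : R * R -> R) (A : set R) : measurable A -> (mu A < +oo)%E ->
  bmeas F -> bmeas (fun x => \int[mu]_(y in A) F (x, y)).
Proof. exact: (@bmeas_int _ _ (measurableTypeR R) (measurableTypeR R) R mu F A). Qed.

Lemma bmeas_pair1R (F : R * R -> R) (x : R) : bmeas F -> bmeas (fun y => F (x, y)).
Proof. exact: (@bmeas_pair1 _ _ (measurableTypeR R) (measurableTypeR R) R F x). Qed.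

Lemma bmeas_pair2R (F : R * R -> R) (y : R) : bmeas F -> bmeas (fun x => F (x, y)).
Proof. exact: (@bmeas_pair2 _ _ (measurableTypeR R) (measurableTypeR R) R F y). Qed.

Lemma bfubiniR (F : R * R -> R) (A B : set R) :
  measurable A -> (mu A < +oo)%E -> measurable B -> (mu B < +oo)%E -> bmeas F ->
  \int[lebesgue2 R]_(p in A `*` B) F p = \int[mu]_(x in A) \int[mu]_(y in B) F (x, y) /\
  \int[lebesgue2 R]_(p in A `*` B) F p = \int[mu]_(y in B) \int[mu]_(x in A) F (x, y).
Proof. exact: (@bfubini _ _ (measurableTypeR R) (measurableTypeR R) R mu mu F A B). Qed.

Lemma ae_fst (P : R -> Prop) : {ae mu, forall x, P x} ->
  {ae lebesgue2 R, forall p, P p.1}.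
Proof.
move=> [N [mN N0 PN]]; exists (N `*` setT); split; first exact: measurableX.
  transitivity (mu N * mu setT)%E; last by rewrite N0 mul0e.
  exact: (@product_measure1E _ _ (measurableTypeR R) (measurableTypeR R) R mu mu).
by move=> p /= np; split => //; exact: PN.
Qed.

Definition box (N : R) : set (R * R) := `]0, N]%classic `*` `[-1, 1]%classic.

Lemma measurable_Rpos : measurable (Rpos R).
Proof. exact: measurable_itv. Qed.

Lemma measurable_strip : measurable (strip R).
Proof. by apply: measurableX; exact: measurable_itv. Qed.

Lemma lebesgue_cc11 : (mu `[(-1)%R, 1%R] < +oo)%E.
Proof. by rewrite lebesgue_measure_itv; case: ifP => // _; rewrite ltry. Qed.

(** The weak formulation for representatives bounded at every point, with test functions f(x) z(m)
    and integrals over sets of finite measure only. *)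
Record weak_milne (C : R) (t : R -> R) (q : R * R -> R) : Prop := WeakMilne {
  wm_t : bmeas t ;
  wm_q : bmeas q ;
  wm_t_itv : forall x, 0 <= t x <= C ;
  wm_q_itv : forall p, 0 <= q p <= C ;
  wm_eq_t : forall f (a b N : R), 0 < a -> a <= b -> b <= N -> csupp a b f -> test_C2 f ->
    csupp a b (derive1 (derive1 f)) ->
    prim (fun x => t x * derive1 (derive1 f) x
                   + angular_mean (fun m => q (x, m) - t x ^+ 4) * f x) 0 N = 0 ;
  wm_eq_q : forall f f' z z' (a b N : R), 0 < a -> a <= b -> b <= N ->
    csupp a b f -> csupp a b f' ->
    (forall x : R, is_derive x 1 f (f' x)) -> continuous f' ->
    (forall x : R, is_derive x 1 z (z' x)) -> continuous z' ->
    \int[lebesgue2 R]_(p in box N)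
      (- (p.2 * q p * (f' p.1 * z p.2)) + (q p - t p.1 ^+ 4) * (f p.1 * z p.2)) = 0 }.

Definition clip (C y : R) : R := Num.max 0 (Num.min y C).

Lemma clip_itv C y : 0 <= C -> 0 <= clip C y <= C.
Proof. by move=> C0; rewrite /clip le_max lexx ge_max C0 ge_min lexx orbT. Qed.

Lemma clip_id C y : 0 <= y <= C -> clip C y = y.
Proof. by move=> /andP[y0 yC]; rewrite /clip min_l// max_r. Qed.

Lemma bmeas_clip {d} {X : measurableType d} (C : R) (f : X -> R) : 0 <= C ->
  measurable_fun setT f -> bmeas (fun x => clip C (f x)).
Proof.
move=> C0 mf; split.
  by apply: measurable_maxr => //; apply: measurable_minr.
by exists C => x; have /andP[? ?] := clip_itv (f x) C0; rewrite ger0_norm.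
Qed.

Lemma Rintegral_ae {d} {X : measurableType d} (m : {measure set X -> \bar R}) (D : set X) (f g : X -> R) :
  measurable D -> measurable_fun D f -> measurable_fun D g ->
  {ae m, forall x, D x -> f x = g x} -> \int[m]_(x in D) f x = \int[m]_(x in D) g x.
Proof.
move=> mD mf mg fg; congr fine; apply: ae_eq_integral => //; try exact/measurable_EFinP.
by apply: ae_sub fg => x /[apply] ->.
Qed.

Lemma Rintegral_sub0 {d} {X : measurableType d} (m : {measure set X -> \bar R}) (D E : set X) (f : X -> R) :
  D `<=` E -> (forall x, E x -> ~ D x -> f x = 0) ->
  \int[m]_(x in E) f x = \int[m]_(x in D) f x.
Proof.
move=> DE f0; rewrite [LHS]Rintegral_mkcond [RHS]Rintegral_mkcond.
apply: eq_Rintegral => x _; rewrite !patchE.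
have [xD|xD] := boolP (x \in D).
  by rewrite mem_set//; apply: DE; rewrite inE in xD.
by case: ifPn => // xE; apply: f0; rewrite ?inE// in xE *; move: xD; rewrite notin_setE.
Qed.

(** Extension by 0 and clipping to [0, C] change the solution inside the domain only on a null set,
    so all test integrals are kept. *)
Lemma weak_of_solution (Tb : R) (psib T : R -> R) (psi : R * R -> R) :
  milne_solution Tb psib T psi -> exists C t q,
  [/\ 0 <= C, weak_milne C t q, {ae mu, forall x, Rpos R x -> T x = t x} &
      {ae lebesgue2 R, forall p, strip R p -> psi p = q p}].
Proof.
move=> sol; have [C0 [TC psiC]] := milne_bounded sol.
pose C := Num.max 0 C0.
have C_ge0 : 0 <= C by rewrite le_max lexx.
have C0C : C0 <= C by rewrite le_max lexx orbT.
pose Tr := T \_ (Rpos R); pose pr := psi \_ (strip R).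
have mTr : measurable_fun setT Tr.
  by apply/(measurable_restrictT _ measurable_Rpos); case: (milne_L2loc_T sol).
have mpr : measurable_fun setT pr.
  by apply/(measurable_restrictT _ measurable_strip); case: (milne_L2loc_psi sol).
pose t x := clip C (Tr x); pose q p := clip C (pr p).
have bt : bmeas t by exact: bmeas_clip.
have bq : bmeas q by exact: bmeas_clip.
have Tt : {ae mu, forall x, Rpos R x -> T x = t x}.
  apply: ae_sub (ae_and (milne_ge0_T sol) TC) => x [T0 TCx] Px.
  rewrite /t /Tr patchE mem_set// clip_id// T0//= (le_trans _ C0C)//.
  by rewrite (le_trans _ (TCx Px))// ler_norm.
have pq : {ae lebesgue2 R, forall p, strip R p -> psi p = q p}.
  apply: ae_sub (ae_and (milne_ge0_psi sol) psiC) => x [T0 TCx] Px.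
  rewrite /q /pr patchE mem_set// clip_id// T0//= (le_trans _ C0C)//.
  by rewrite (le_trans _ (TCx Px))// ler_norm.
exists C, t, q; split => //; split => //.
- by move=> x; exact: clip_itv.
- by move=> x; exact: clip_itv.
- move=> f a b N a0 ab bN f0 tf f20.
  have [c1 c2 _] := tf.
  have cf : continuous f.
    by move=> x; have [d _] := c1 x I; apply: differentiable_continuous; exact/derivable1_diffP.
  have cf2 : continuous (derive1 (derive1 f)) by move=> x; have [_] := c2 x I.
  have mf := continuous_measurable_fun cf; have mf2 := continuous_measurable_fun cf2.
  rewrite -[RHS](milne_eq_T sol tf) /prim.
  rewrite -(@Rintegral_sub0 _ _ mu `]0, N]%classic (Rpos R)); first last.
  + move=> x /= xP /negP; rewrite in_itv/= negb_and -ltNge -leNgt => /orP[x0|Nx].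
      by move: xP; rewrite /Rpos /= in_itv/= andbT ltNge x0.
    have xb : ~~ (a < x < b) by rewrite negb_and -!leNgt (le_trans bN (ltW Nx)) orbT.
    by rewrite f20// f0// !mulr0 addr0.
  + by move=> x /=; rewrite /Rpos /= !in_itv/= andbT => /andP[].
  pose F (p : R * R) : R := pr p - Tr p.1 ^+ 4.
  pose G (p : R * R) : R := q p - t p.1 ^+ 4.
  have mT1 (h : R -> R) : measurable_fun setT h -> measurable_fun setT (fun p : R * R => h p.1 ^+ 4).
    by move=> mh; apply: measurable_funX; exact: measurableT_comp.
  have mF : measurable_fun setT F by apply: measurable_funB => //; exact: mT1.
  have bG : bmeas G.
    by apply: bmeasB => //; apply: bmeasX; exact: bmeas_comp.
  have mIF := measurable_intR (measurable_itv _) mF.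
  have bIG := bmeas_intR (measurable_itv _) lebesgue_cc11 bG.
  have E x m : Rpos R x -> `[(-1), 1]%classic m -> psi (x, m) - T x ^+ 4 = F (x, m).
    move=> Px Im; rewrite /F /pr /Tr !patchE mem_set//= mem_set//.
  have aeF : {ae mu, forall x, {ae mu, forall m, strip R (x, m) -> psi (x, m) = q (x, m)}}.
    by have := ae_prod1 pq; apply: ae_sub.
  have mrhs : measurable_fun (Rpos R) (fun x => T x * derive1 (derive1 f) x +
     angular_mean (fun m => psi (x, m) - T x ^+ 4) * f x).
    apply: (@eq_measurable_fun _ _ _ _ _ (fun x => Tr x * derive1 (derive1 f) x +
     (\int[mu]_(m in `[(-1)%R, 1%R]) F (x, m)) * f x)).
      move=> x; rewrite inE => Px; rewrite /Tr patchE mem_set//; congr (_ + _ * _).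
      by apply: eq_Rintegral => m; rewrite inE => Im; rewrite (E x m)// /F /= /Tr patchE mem_set.
    apply: measurable_funTS; apply: measurable_funD; first exact: measurable_funM.
    exact: measurable_funM.
  apply: Rintegral_ae => //.
  + exact: measurable_Rpos.
  + apply: measurable_funTS; apply: measurable_funD.
      by apply: measurable_funM => //; case: bt.
    by apply: measurable_funM => //; case: bIG.
  + apply: ae_sub (ae_and Tt aeF) => x [Tx Fx] Px.
    rewrite (Tx Px); congr (_ + _ * _); apply/esym/Rintegral_ae => //.
    * apply: (@eq_measurable_fun _ _ _ _ _ (fun m => F (x, m))).
        by move=> m; rewrite inE => Im; rewrite -E// Tx.
      by apply: measurable_funTS; exact: (measurableT_comp mF).
    * by apply: measurable_funTS; case: (bmeas_pair1R x bG).
    * apply: ae_sub Fx => m Fm Im; rewrite Fm//; split => //.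
- move=> f f' z z' a b N a0 ab bN f0 f'0 df cf' dz cz'.
  have [trho Dxrho] := test_C1_strip_prod a0 ab f0 df cf' dz cz'.
  rewrite -[RHS](milne_eq_psi sol trho) Dxrho.
  have cf : continuous f by move=> x; exact: der_cont (df x).
  have cz : continuous z by move=> x; exact: der_cont (dz x).
  have m1 (h : R -> R) : continuous h -> measurable_fun setT (fun p : R * R => h p.1).
    by move=> ch; apply: measurableT_comp => //; exact: continuous_measurable_fun.
  have m2 (h : R -> R) : continuous h -> measurable_fun setT (fun p : R * R => h p.2).
    by move=> ch; apply: measurableT_comp => //; exact: continuous_measurable_fun.
  have mG (h : R -> R) (g : R * R -> R) : measurable_fun setT h -> measurable_fun setT g ->
      measurable_fun setT (fun p : R * R => - (p.2 * g p * (f' p.1 * z p.2)) + (g p - h p.1 ^+ 4) * (f p.1 * z p.2)).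
    move=> mh mg; apply: measurable_funD.
      apply: measurableT_comp => //; apply: measurable_funM.
        by apply: measurable_funM => //.
      by apply: measurable_funM; [exact: m1|exact: m2].
    apply: measurable_funM; last by apply: measurable_funM; [exact: m1|exact: m2].
    apply: measurable_funB => //; apply: measurable_funX; exact: measurableT_comp.
  rewrite -(@Rintegral_sub0 _ _ (lebesgue2 R) (box N) (strip R)); first last.
  + move=> p [/= xP mP] np; have Nx : N < p.1.
      rewrite ltNge; apply/negP => pN; apply: np; split => //=.
      by move: xP; rewrite /Rpos /= !in_itv/= andbT pN andbT.
    have xb : ~~ (a < p.1 < b) by rewrite negb_and -!leNgt (le_trans bN (ltW Nx)) orbT.
    by rewrite f'0// f0// !(mul0r, mulr0) oppr0 addr0.
  + by move=> p [/= xP mP]; split => //; move: xP; rewrite /Rpos /= !in_itv/= andbT => /andP[].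
  apply: Rintegral_ae.
  + exact: measurable_strip.
  + by apply: measurable_funTS; apply: mG; [case: bt|case: bq].
  + apply: (@eq_measurable_fun _ _ _ _ _ (fun p : R * R => - (p.2 * pr p * (f' p.1 * z p.2)) + (pr p - Tr p.1 ^+ 4) * (f p.1 * z p.2))); last first.
      by apply: measurable_funTS; exact: mG.
    by move=> p; rewrite inE => sp; rewrite /pr /Tr !patchE !mem_set//; case: sp.
  + have Tt2 := ae_fst Tt.
    apply: ae_sub (ae_and Tt2 pq) => p [Tp pp] sp.
    by rewrite (Tp (proj1 sp)) (pp sp).
Qed.

End normalization.

(** * Primitives on the half-line and integration by parts *)

Section half_line_primitives.
Context {R : realType}.
Local Notation mu := (@lebesgue_measure R).

Lemma measurable_invr : measurable_fun setT (fun x : R => x^-1).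
Proof.
have E : (fun x : R => x^-1) = (fun x : R => x^-1) \_ (~` [set 0]).
  apply/funext => x; rewrite patchE; case: ifPn => //.
  by rewrite notin_setE /= => /contrapT ->; rewrite invr0.
rewrite E; have mD : measurable (~` [set 0 : R]) by apply: measurableC; exact: measurable_set1.
apply/(measurable_restrictT _ mD).
apply: open_continuous_measurable_fun.
  by apply: closed_openC; exact/accessible_closed_set1/hausdorff_accessible/Rhausdorff.
by move=> x; rewrite inE /= => /eqP x0; exact: inv_continuous.
Qed.

Lemma restr_pos (v : R -> R) (x : R) : 0 < x -> (v \_ (Rpos R)) x = v x.
Proof. by move=> x0; rewrite patchE mem_set// /Rpos /= in_itv/= x0. Qed.

Lemma bmeas_restr (v : R -> R) (B : R) : (forall x, 0 < x -> {for x, continuous v}) ->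
  (forall x, 0 < x -> `|v x| <= B) -> bmeas (v \_ (Rpos R)).
Proof.
move=> cv vB; split.
  apply/(measurable_restrictT _ (@measurable_Rpos R)).
  apply: open_continuous_measurable_fun; first exact: interval_open.
  by move=> y; rewrite inE /Rpos /= in_itv/= andbT => /cv.
exists `|B| => y; rewrite patchE; case: ifPn => [|_]; last by rewrite normr0.
by rewrite inE /Rpos /= in_itv/= andbT => /vB h; rewrite (le_trans h)// ler_norm.
Qed.

Lemma der_prim_restr (v : R -> R) (B x : R) : (forall x, 0 < x -> {for x, continuous v}) ->
  (forall x, 0 < x -> `|v x| <= B) -> 0 < x -> is_derive x 1 (prim (v \_ (Rpos R)) 0) (v x).
Proof.
move=> cv vB x0; rewrite -(restr_pos v x0).
apply: is_derive_prim => //; first exact: bmeas_restr cv vB.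
rewrite /prop_for /continuous_at restr_pos//; have := cv x x0; apply: cvg_trans; apply: near_eq_cvg.
by near=> y; rewrite restr_pos//; near: y; exact: lt_nbhsr.
Unshelve. all: by end_near. Qed.

Lemma is_derive_prim_ae (g v : R -> R) (B x : R) : bmeas g ->
  (forall y, 0 < y -> {for y, continuous v}) -> (forall y, 0 < y -> `|v y| <= B) ->
  {ae mu, forall y, 0 < y -> g y = v y} -> 0 < x -> is_derive x 1 (prim g 0) (v x).
Proof.
move=> bg cv vB gv x0; have bw := bmeas_restr cv vB.
have -> : prim g 0 = prim (v \_ (Rpos R)) 0; last exact: der_prim_restr cv vB x0.
apply/funext => y; apply: eq_bint_ae => //.
by apply: ae_sub gv => z gz /=; rewrite in_itv/= => /andP[z0 _]; rewrite restr_pos// gz.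
Qed.

Definition le_set : set (R * R) := [set p | p.2 <= p.1].

Lemma bmeas_le_set : bmeas (\1_le_set : R * R -> R).
Proof.
apply: bmeas_indic; rewrite (_ : le_set = setT `&` [set p : R * R | p.2 <= p.1]); last by rewrite setTI.
exact: measurable_fun_le.
Qed.

Lemma le_setE (x y : R) : \1_le_set (x, y) = (y <= x)%R%:R :> R.
Proof.
by rewrite indicE; case: (boolP (y <= x)) => yx; [rewrite mem_set|rewrite memNset//=; exact/negP].
Qed.

(** For x <= N this is the primitive of [F] in its first variable; the truncation at N and the
    indicator of y <= x give it a form that is bounded and jointly measurable in (x, m). *)
Definition primN (N : R) (F : R * R -> R) (p : R * R) : R :=
  \int[mu]_(y in `]0, N]) (F (y, p.2) * \1_le_set (p.1, y)).

Lemma bmeas_primN N F : bmeas F -> bmeas (primN N F).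
Proof.
move=> bF; apply: (@bmeas_int _ _ (measurableTypeR R * measurableTypeR R)%type (measurableTypeR R) R mu
  (fun z => F (z.2, z.1.2) * \1_le_set (z.1.1, z.2))); [by []|exact: lebesgue_oc|].
apply: bmeasM.
  apply: (bmeas_comp (h := fun z : R * R * R => (z.2, z.1.2))) => //.
  by apply: measurable_fun_pair => //; exact: measurableT_comp.
apply: (bmeas_comp (h := fun z : R * R * R => (z.1.1, z.2))); last exact: bmeas_le_set.
by apply: measurable_fun_pair => //; exact: measurableT_comp.
Qed.

Lemma primNE N F x m : x <= N -> primN N F (x, m) = prim (fun y => F (y, m)) 0 x.
Proof.
move=> xN; rewrite /primN /prim [LHS]Rintegral_mkcond [RHS]Rintegral_mkcond.
apply: eq_Rintegral => y _; rewrite !patchE /= le_setE; have [|] := boolP (y \in `]0, x]%classic).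
  rewrite inE /= in_itv/= => /andP[y0 yx].
  by rewrite mem_set ?yx ?mulr1//= in_itv/= y0 (le_trans yx).
rewrite notin_setE /= in_itv/= => /negP; case: ifPn => // yN.
by move: yN; rewrite inE /= in_itv/= => /andP[-> _] /= /negbTE ->; rewrite mulr0.
Qed.

Lemma bmeas_prim g (N : R) : bmeas g -> exists2 G, bmeas G & forall x, x <= N -> G x = prim g 0 x.
Proof.
move=> bg; exists (fun x => primN N (g \o fst) (x, 0)); last by move=> x /primNE ->.
by apply: bmeas_pair2R; apply: bmeas_primN; exact: (bmeas_comp (h := fst)).
Qed.

(* By Fubini, since [g] and [s] are merely bounded. *)
Lemma prim_by_parts (g s : R -> R) (N : R) : 0 <= N -> bmeas g -> bmeas s -> prim s 0 N = 0 ->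
  prim (fun x => g x * prim s 0 x) 0 N = - prim (fun x => prim g 0 x * s x) 0 N.
Proof.
move=> N0 bg bs s0; have fN := lebesgue_oc 0 N.
pose F (p : R * R) := g p.1 * s p.2 * \1_le_set p.
have bF : bmeas F.
  by apply: bmeasM; [apply: bmeasM; [exact: (bmeas_comp (h := fst))|exact: (bmeas_comp (h := snd))]|exact: bmeas_le_set].
have [e1 e2] := bfubiniR (measurable_itv `]0, N]) fN (measurable_itv `]0, N]) fN bF.
have L1 x : x <= N -> \int[mu]_(y in `]0, N]) F (x, y) = g x * prim s 0 x.
  move=> xN; rewrite -(@primNE N (s \o fst) x 0 xN) /primN -bintZl//.
    by apply: eq_Rintegral => y _; rewrite /F mulrA.
  by apply: bmeasM bs _; exact: bmeas_pair1R bmeas_le_set.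
have L2 y : 0 < y <= N -> \int[mu]_(x in `]0, N]) F (x, y) = (prim g 0 N - prim g 0 y) * s y.
  move=> /andP[y0 yN]; rewrite primB ?(ltW y0)// Rintegral_itv_obnd_cbnd; last exact: bmeas_integrable_oc.
  under eq_Rintegral do rewrite /F /= mulrAC.
  rewrite bintZr//; [congr (_ * _)|exact: bmeasM bg (bmeas_pair2R y bmeas_le_set)].
  rewrite [LHS]Rintegral_mkcond [RHS]Rintegral_mkcond; apply: eq_Rintegral => x _.
  rewrite !patchE le_setE; have [|] := boolP (x \in `[y, N]%classic).
    rewrite inE /= in_itv/= => /andP[yx xN].
    by rewrite mem_set ?yx ?mulr1//= in_itv/= (lt_le_trans y0) ?xN.
  rewrite notin_setE /= in_itv/= => /negP; case: ifPn => // xN.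
  by move: xN; rewrite inE /= in_itv/= => /andP[_ ->]; rewrite andbT => /negbTE ->; rewrite mulr0.
have [G bG GE] := bmeas_prim N bg.
transitivity (\int[mu]_(x in `]0, N]) \int[mu]_(y in `]0, N]) F (x, y)).
  by apply: eq_Rintegral => x; rewrite inE /= in_itv/= => /andP[_ xN]; rewrite L1.
rewrite -e1 e2.
transitivity (\int[mu]_(y in `]0, N]) (prim g 0 N * s y - G y * s y)).
  apply: eq_Rintegral => y; rewrite inE /= in_itv/= => yN; rewrite L2// mulrBl GE//.
  by case/andP: yN.
rewrite bintB//; [|exact: bmeasM (bmeas_cst _) bs|exact: bmeasM].
rewrite bintZl// -/(prim s 0 N) s0 mulr0 sub0r; congr (- _).
by apply: eq_Rintegral => y; rewrite inE /= in_itv/= => /andP[_ yN]; rewrite GE.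
Qed.

End half_line_primitives.

(** * The transport equation along almost every direction *)

Section regularity.
Context {R : realType}.
Local Notation mu := (@lebesgue_measure R).
Local Notation I11 := `[(-1)%R, 1%R]%classic.

Lemma bmeas_int2R (F : R * R -> R) (A : set R) : measurable A -> (mu A < +oo)%E ->
  bmeas F -> bmeas (fun y => \int[mu]_(x in A) F (x, y)).
Proof.
move=> mA fA bF; apply: (bmeas_intR (F := fun p => F (p.2, p.1))) => //.
by apply: (bmeas_comp (h := fun p : R * R => (p.2, p.1))) => //; apply: measurable_fun_pair.
Qed.

Lemma bmeas_cont_itv (z : R -> R) (a b : R) : a <= b -> continuous z ->
  bmeas (fun m => z m * \1_(`[a, b]%classic) m).
Proof.
move=> ab cz; split.
  by apply: measurable_funM; [exact: continuous_measurable_fun|exact: measurable_indic].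
have cn : {within `[a, b], continuous (fun x => `|z x|)}.
  by apply: continuous_subspaceT => x; apply: cvg_norm; exact: cz.
have [c cab cmax] := EVT_max ab cn.
exists `|z c| => x; rewrite indicE; case: (boolP (x \in _)) => [xI|_].
  by rewrite mulr1; apply: cmax; rewrite inE in xI.
by rewrite mulr0 normr0.
Qed.

Lemma le_m11 : -1 <= 1 :> R. Proof. by lra. Qed.

(** The velocity m, cut off outside [-1, 1] so as to be bounded on the whole line, as [bmeas]
    demands. *)
Definition mI (m : R) : R := m * \1_I11 m.

Lemma bmeas_mI : bmeas mI.
Proof. by apply: (@bmeas_cont_itv id _ _ le_m11) => x; exact: cvg_id. Qed.

Lemma mIE m : I11 m -> mI m = m.
Proof. by move=> mI11; rewrite /mI indicE mem_set// mulr1. Qed.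

Context (C : R) (t : R -> R) (q : R * R -> R) (W : weak_milne C t q).

Definition src (p : R * R) : R := q p - t p.1 ^+ 4.

Lemma bmeas_src : bmeas src.
Proof.
apply: bmeasB (wm_q W) _; apply: bmeasX; apply: (bmeas_comp (h := fst)) => //.
exact: wm_t W.
Qed.

Definition weak_int (f f' : R -> R) (p : R * R) : R := - (mI p.2 * q p * f' p.1) + src p * f p.1.

Lemma bmeas_weak_int a b f f' : (forall x : R, is_derive x 1 f (f' x)) -> continuous f' ->
  csupp a b f -> csupp a b f' -> bmeas (weak_int f f').
Proof.
move=> df cf' f0 f'0; have cf : continuous f by move=> x; exact: der_cont (df x).
apply: bmeasD.
  apply: bmeasN; apply: bmeasM.
    by apply: bmeasM (wm_q W); apply: (bmeas_comp (h := snd)) => //; exact: bmeas_mI.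
  by apply: (bmeas_comp (h := fst)) => //; exact: bmeas_csupp cf' f'0.
apply: bmeasM bmeas_src _; apply: (bmeas_comp (h := fst)) => //; exact: bmeas_csupp cf f0.
Qed.

Lemma weak_int_z (f f' z z' : R -> R) (a b N : R) : 0 < a -> a <= b -> b <= N ->
    csupp a b f -> csupp a b f' ->
    (forall x : R, is_derive x 1 f (f' x)) -> continuous f' ->
    (forall x : R, is_derive x 1 z (z' x)) -> continuous z' ->
  \int[mu]_(m in I11) (z m * \int[mu]_(x in `]0, N]) weak_int f f' (x, m)) = 0 /\
  \int[mu]_(x in `]0, N]) \int[mu]_(m in I11) (z m * weak_int f f' (x, m)) = 0.
Proof.
move=> a0 ab bN f0 f'0 df cf' dz cz'.
have cz : continuous z by move=> x; exact: der_cont (dz x).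
have bw := bmeas_weak_int df cf' f0 f'0.
have bz := bmeas_cont_itv le_m11 cz.
pose F (p : R * R) := weak_int f f' p * (z p.2 * \1_I11 p.2).
have bF : bmeas F by apply: bmeasM bw _; exact: (bmeas_comp measurable_snd bz).
have [e1 e2] := bfubiniR (measurable_itv `]0, N]) (lebesgue_oc 0 N) (measurable_itv `[(-1)%R, 1%R]) lebesgue_cc11 bF.
have F0 : \int[lebesgue2 R]_(p in box N) F p = 0.
  rewrite -[RHS](wm_eq_q W a0 ab bN f0 f'0 df cf' dz cz'); apply: eq_Rintegral => -[x m].
  rewrite inE /= => -[_ /= mI11]; rewrite /F /weak_int /= mIE// indicE mem_set// mulr1 /src.
  by rewrite mulrDl mulNr -!mulrA.
split; rewrite -[RHS]F0.
  rewrite e2; apply: eq_Rintegral => m; rewrite inE => mI11.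
  rewrite -bintZl//; [|exact: lebesgue_oc|exact: bmeas_pair2R].
  by apply: eq_Rintegral => x _; rewrite /F indicE mem_set// mulr1 mulrC.
rewrite e1; apply: eq_Rintegral => x _; apply: eq_Rintegral => m; rewrite inE => mI11.
by rewrite /F indicE mem_set// mulr1 mulrC.
Qed.

(** Localization in m: the factor z of the test function runs through the bumps inside ]-1, 1[. *)
Lemma weak_int_ae f f' (a b N : R) : 0 < a -> a <= b -> b <= N ->
    csupp a b f -> csupp a b f' ->
    (forall x : R, is_derive x 1 f (f' x)) -> continuous f' ->
  {ae mu, forall m, -1 < m < 1 -> \int[mu]_(x in `]0, N]) weak_int f f' (x, m) = 0}.
Proof.
move=> a0 ab bN f0 f'0 df cf'.
have bw := bmeas_weak_int df cf' f0 f'0.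
have bI := bmeas_int2R (measurable_itv `]0, N]) (lebesgue_oc 0 N) bw.
apply: bump_eq0_ae => //.
move=> u v n u0 uv v1.
have [h _] := weak_int_z a0 ab bN f0 f'0 df cf' (is_derive_bump (ratr u) (ratr v) n) (@continuous_bump' _ _ _ n).
rewrite -[RHS]h Rintegral_itv_obnd_cbnd; last first.
  by apply: bmeas_integrable_oc; apply: bmeasM bI (bmeas_bump _ _ _).
by apply: eq_Rintegral => m _; rewrite mulrC.
Qed.

(** Formally the derivative in x is m q' + (q - t^4), so the transport equation says that this
    quantity is constant in x. *)
Definition Vm (m x : R) : R := m * q (x, m) + prim (fun y => src (y, m)) 0 x.

Lemma bmeas_src2 m : bmeas (fun x => src (x, m)).
Proof. exact: bmeas_pair2R bmeas_src. Qed.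

Lemma bmeas_Vm m (N : R) : bmeas (fun x => Vm m x * \1_(`]0, N]%classic) x).
Proof.
have [G bG GE] := bmeas_prim N (bmeas_src2 m).
rewrite (_ : (fun x => _) = (fun x => (m * q (x, m) + G x) * \1_(`]0, N]%classic) x)).
  apply: bmeasM; last exact: bmeas_indic.
  by apply: bmeasD bG; apply: bmeasM (bmeas_cst _) (bmeas_pair2R m (wm_q W)).
apply/funext => x; rewrite indicE; case: (boolP (x \in _)) => [|_]; last by rewrite !mulr0.
by rewrite inE /= in_itv/= => /andP[_ xN]; rewrite GE.
Qed.

Lemma Vm_mean_zero_bump : {ae mu, forall m, -1 < m < 1 ->
  forall (u v : rat) n (N : nat), 0 < ratr u :> R -> ratr u < ratr v :> R ->
     ratr v < N%:R :> R -> 2 < N%:R :> R ->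
     prim (fun x => Vm m x * mean_zero_bump (ratr u) (ratr v) n x) 0 N%:R = 0}.
Proof.
(* The parameters are packed into one countable index, and tests violating the side conditions hold
   vacuously. *)
pose P (i : rat * rat * nat * nat) (m : R) : Prop := let: (u, v, n, N) := i in
  -1 < m < 1 -> 0 < ratr u :> R -> ratr u < ratr v :> R -> ratr v < N%:R :> R -> 2 < N%:R :> R ->
  prim (fun x => Vm m x * mean_zero_bump (ratr u) (ratr v) n x) 0 N%:R = 0.
have : {ae mu, forall m, forall i, P i m}; last first.
  by apply: ae_sub => m H m1 u v n N; exact: (H (u, v, n, N)).
apply: ae_all => -[[[u v] n] N]; rewrite /P.
have [u0|?] := boolP (0 < ratr u :> R); last exact: aeW.
have [uv|?] := boolP (ratr u < ratr v :> R); last exact: aeW.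
have [vN|?] := boolP (ratr v < N%:R :> R); last exact: aeW.
have [N2|?] := boolP (2 < N%:R :> R); last exact: aeW.
set s := mean_zero_bump _ _ n; set a := Num.min (ratr u) (1 : R); set b := Num.max (ratr v) (2 : R).
have a0 : 0 < a by rewrite lt_min u0 ltr01.
have ab : a <= b by rewrite ge_min le_max (ltW uv).
have bN : b <= N%:R by rewrite ge_max (ltW vN) (ltW N2).
have cs : continuous s by exact: continuous_mean_zero_bump.
have s0 : csupp a b s by exact: csupp_mean_zero_bump (ltW uv).
have bs : bmeas s by exact: bmeas_csupp cs s0.
have sb : prim s 0 b = 0 by exact: prim_mean_zero_bump (ltW uv).
have sN : prim s 0 N%:R = 0 by rewrite (prim_csupp_gt a0 ab bs s0 bN).
have ds x := is_derive_prim_csupp x a0 cs s0.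
have := weak_int_ae a0 ab bN (csupp_prim a0 ab cs s0 sb) s0 ds cs.
apply: ae_sub => m Hm m1 _ _ _ _; have := Hm m1; rewrite /weak_int /=.
have N0 : 0 <= N%:R :> R by [].
have bq := bmeas_pair2R m (wm_q W).
have be : bmeas (prim s 0) by apply: bmeas_csupp (continuous_prim a0 cs s0) (csupp_prim a0 ab cs s0 sb).
rewrite bintD//; [|exact: lebesgue_oc| |]; last 2 first.
- by apply: bmeasN; apply: bmeasM bs; apply: bmeasM bq; exact: bmeas_cst.
- exact: bmeasM (bmeas_src2 m) be.
rewrite -/(prim (fun x => src (x, m) * prim s 0 x) 0 N%:R) (prim_by_parts N0 (bmeas_src2 m) bs sN).
have [G bG GE] := bmeas_prim N%:R (bmeas_src2 m).
move=> /eqP; rewrite subr_eq0 => /eqP E.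
have mE : mI m = m by apply: mIE; rewrite /= in_itv/=; move/andP: m1 => [/ltW -> /ltW ->].
have bmq : bmeas (fun x => m * q (x, m) * s x).
  by apply: bmeasM bs; apply: bmeasM bq; exact: bmeas_cst.
have -> : prim (fun x => Vm m x * s x) 0 N%:R =
    \int[mu]_(x in `]0, N%:R]) (m * q (x, m) * s x) + \int[mu]_(x in `]0, N%:R]) (G x * s x).
  rewrite -bintD//; [|exact: lebesgue_oc|exact: bmeasM].
  apply: eq_Rintegral => x; rewrite inE /= in_itv/= => /andP[_ xN].
  by rewrite /Vm -GE// mulrDl.
rewrite mE bintN// in E; last exact: lebesgue_oc.
have -> : \int[mu]_(x in `]0, N%:R]) (G x * s x) =
    prim (fun x => prim (fun y => src (y, m)) 0 x * s x) 0 N%:R.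
  by apply: eq_Rintegral => x; rewrite inE /= in_itv/= => /andP[_ xN]; rewrite GE.
by rewrite -E subrr.
Qed.

Definition cm (m : R) : R := prim (fun x => Vm m x * cutoff x) 0 2.

Lemma Vm_cst : {ae mu, forall m, -1 < m < 1 -> {ae mu, forall x, 0 < x -> Vm m x = cm m}}.
Proof.
by apply: ae_sub Vm_mean_zero_bump => m Hm m1; apply: du_Bois_Reymond (bmeas_Vm m) (Hm m1).
Qed.

End regularity.

(** * Lipschitz representatives and their boundary values *)

Section lipschitz_representatives.
Context {R : realType}.
Local Notation mu := (@lebesgue_measure R).

Lemma ae_ex (P : R -> Prop) (a b : R) : a < b -> {ae mu, forall x, P x} ->
  exists x, a < x < b /\ P x.
Proof.
move=> ab [N [mN N0 PN]]; apply: contrapT => nex.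
have sub : `]a, b[%classic `<=` N.
  by move=> x /=; rewrite in_itv/= => xab; apply: PN => Px; apply: nex; exists x.
have : (mu `]a, b[ <= mu N)%E by rewrite le_measure ?inE.
by rewrite N0 lebesgue_measure_itv /= lte_fin ab -EFinB lee_fin leNgt subr_gt0 ab.
Qed.

Definition lip_pos (L : R) (v : R -> R) :=
  forall x y, 0 < x -> 0 < y -> `|v x - v y| <= L * `|x - y|.

Lemma lip_pos_cont L v x : lip_pos L v -> 0 < x -> {for x, continuous v}.
Proof.
move=> vL x0; apply/cvgrPdist_le => e e0; near=> y.
have y0 : 0 < y by near: y; exact: lt_nbhsr.
have L1 : 0 < `|L| + 1 by rewrite ltr_wpDl.
rewrite (le_trans (vL x y x0 y0))//.
have : `|x - y| <= e / (`|L| + 1).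
  by near: y; apply: cvgr_dist_le; [exact: cvg_id|rewrite divr_gt0].
rewrite ler_pdivlMr// mulrC; apply: le_trans.
by rewrite ler_wpM2r// (le_trans (ler_norm L))// lerDl.
Unshelve. all: by end_near. Qed.

Lemma lip_pos_itv L v (C : R) : lip_pos L v -> {ae mu, forall x, 0 < x -> 0 <= v x <= C} ->
  forall x, 0 < x -> 0 <= v x <= C.
Proof.
move=> vL vC x x0.
have key (e : R) : 0 < e -> exists y, [/\ 0 < y, `|v x - v y| <= e & 0 <= v y <= C].
  move=> e0; have L1 : 0 < `|L| + 1 by rewrite ltr_wpDl.
  have d0 : x < x + e / (`|L| + 1) by rewrite ltrDl divr_gt0.
  have [y [/andP[xy yd] Hy]] := ae_ex d0 vC.
  have y0 := lt_trans x0 xy; exists y; split => //; last exact: Hy.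
  rewrite (le_trans (vL x y x0 y0))// ltr0_norm ?subr_lt0// opprB.
  have : y - x <= e / (`|L| + 1) by rewrite lerBlDl ltW.
  rewrite ler_pdivlMr// mulrC; apply: le_trans.
  by rewrite ler_wpM2r ?subr_ge0 ?(ltW xy)// (le_trans (ler_norm L))// lerDl.
apply/andP; split; apply/ler_addgt0Pr => e /key[y [_]]; rewrite ler_norml => /andP[h1 h2] /andP[h3 h4]; lra.
Qed.

(** If the bound failed at x, then |v - a| would be at least |v x - a| - L x > 0 on all of ]0, x[,
    and its averages could not tend to 0. *)
Lemma trace_lip L (u v : R -> R) (a : R) : measurable_fun (Rpos R) u -> lip_pos L v ->
  {ae mu, forall x, 0 < x -> u x = v x} -> trace0 u a ->
  forall x : R, 0 < x -> `|v x - a| <= L * x.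
Proof.
move=> mu_ vL uv tr x x0; rewrite leNgt; apply/negP => Lx.
pose c : R := `|v x - a| - L * x; have c0 : 0 < c by rewrite subr_gt0.
have L0 : 0 <= L.
  by have := vL x (x + 1) x0 (ltr_wpDl (ltW x0) ltr01); rewrite opprD addNKr normrN normr1 mulr1; apply: le_trans.
have lb (d : R) : 0 < d -> d < x -> (c%:E <= (d^-1)%:E * \int[mu]_(y in `]0%R, d[) (`|u y - a|)%:E)%E.
  move=> d0 dx; have fd : (0 < d^-1)%R by rewrite invr_gt0.
  have -> : (c%:E = (d^-1)%:E * (c%:E * d%:E))%E.
    by rewrite -!EFinM; congr (_%:E); field; exact: lt0r_neq0.
  rewrite lee_pmul2l//.
  have -> : d%:E = mu `]0%R, d[%classic by rewrite lebesgue_measure_itv /= lte_fin d0 -EFinB subr0.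
  rewrite -integral_cst//; apply: ae_ge0_le_integral => //.
  - by move=> y _; rewrite lee_fin ltW.
  - apply/measurable_EFinP; apply: measurableT_comp => //; apply: measurable_funB => //.
    apply: (measurable_funS (@measurable_Rpos R) _ mu_) => y; by rewrite /Rpos /= !in_itv/= andbT => /andP[->].
  - apply: ae_sub uv => y uy /=; rewrite in_itv/= => /andP[y0 yd].
    rewrite lee_fin uy// /c lerBlDr.
    have := ler_normD (v x - v y) (v y - a); rewrite addrA subrK => h.
    rewrite (le_trans h)// addrC lerD2l (le_trans (vL x y x0 y0))// ler_wpM2l//.
    by rewrite ger0_norm ?subr_ge0 ?(ltW (lt_trans yd dx))// gerBl ltW.
have /fine_cvgP[fin /cvgrPdist_lt /(_ _ c0) cv] := tr.
near (0 : R)^'+ => d.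
have d0 : 0 < d by near: d; exact: nbhs_right_gt.
have dx : d < x by near: d; exact: nbhs_right_lt.
have h1 : ((d^-1)%:E * \int[mu]_(y in `]0%R, d[) (`|u y - a|)%:E)%E \is a fin_num by near: d.
have : `|0 - fine ((d^-1)%:E * \int[mu]_(y in `]0%R, d[) (`|u y - a|)%:E)%E| < c by near: d.
have := lb d d0 dx; rewrite -[X in (_ <= X)%E]fineK// lee_fin sub0r normrN => h2.
by move=> /(le_lt_trans (ler_norm _)); rewrite ltNge h2.
Unshelve. all: by end_near. Qed.

Lemma FTC2_Rint (f F : R -> R) (a b : R) : a < b -> (forall x : R, is_derive x 1 F (f x)) ->
  continuous f -> \int[mu]_(x in `[a, b]) f x = F b - F a.
Proof.
move=> ab dF cf; rewrite /Rintegral (@continuous_FTC2 _ f F)//.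
- exact: continuous_subspaceT.
- split.
  + by move=> x _; case: (dF x).
  + by apply: cvg_at_right_filter; exact: der_cont (dF a).
  + by apply: cvg_at_left_filter; exact: der_cont (dF b).
- by move=> x _; exact: der_derive1.
Qed.

Lemma mean_id : \int[mu]_(m in `[(-1)%R, 1%R]) m = 0.
Proof.
have d (x : R) : is_derive x 1 (fun x => x ^+ 2 * 2^-1) x.
  by eapply der_eq; [der|rewrite /=; lra].
have l : -1 < 1 :> R by lra.
by rewrite (FTC2_Rint l d (fun x => cvg_id)); lra.
Qed.

Lemma mean_sqr : \int[mu]_(m in `[(-1)%R, 1%R]) m ^+ 2 = 2 / 3.
Proof.
have d (x : R) : is_derive x 1 (fun x => x ^+ 3 * 3^-1) (x ^+ 2).
  by eapply der_eq; [der|rewrite /=; lra].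
have l : -1 < 1 :> R by lra.
by rewrite (FTC2_Rint l d (@exprn_continuous R 2)); lra.
Qed.

End lipschitz_representatives.

(** * Classical solutions on a set of good directions *)

Section classical_solutions.
Context {R : realType}.
Local Notation mu := (@lebesgue_measure R).
Local Notation I11 := `[(-1)%R, 1%R]%classic.

(** The directions for which all pointwise statements hold. Zero is left out since the transport
    equation degenerates there; the integral over such a set equals the one over [-1, 1]. *)
Definition fullset (D : set R) := [/\ measurable D,
  forall m, D m -> -1 <= m <= 1 /\ m != 0 & mu (I11 `\` D) = 0%E].

Lemma fullset_sub D : fullset D -> D `<=` I11.
Proof. by move=> [_ DI _] m /DI[mI11 _]; rewrite /= in_itv. Qed.

Lemma fullset_fin D : fullset D -> (mu D < +oo)%E.
Proof.
move=> fD; apply: le_lt_trans (@lebesgue_cc11 R); apply: le_measure; rewrite ?inE.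
- by case: fD.
- exact: measurable_itv.
- exact: fullset_sub.
Qed.

Lemma fullset_int D (f g : R -> R) : fullset D -> bmeas f -> bmeas g ->
  (forall m, D m -> f m = g m) -> \int[mu]_(m in D) f m = \int[mu]_(m in I11) g m.
Proof.
move=> fD bf bg fg; have [mD _ D0] := fD.
have -> : \int[mu]_(m in D) f m = \int[mu]_(m in D) (g m * \1_D m).
  by apply: eq_Rintegral => m mD'; rewrite indicE mD' mulr1 fg//; rewrite inE in mD'.
rewrite -(@Rintegral_sub0 _ _ _ mu D I11); first last.
- by move=> m _ nD; rewrite indicE memNset// mulr0.
- exact: fullset_sub.
apply: eq_bint_ae => //; first exact: bmeasM bg (bmeas_indic mD).
exists (I11 `\` D); split => //; first exact: measurableD.
move=> m /= /not_implyP[mI11 ne]; split => // mD'; apply: ne.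
by rewrite indicE mem_set// mulr1.
Qed.

Lemma fullset_int_eq D (f : R -> R) : fullset D -> bmeas f ->
  \int[mu]_(m in D) f m = \int[mu]_(m in I11) f m.
Proof. by move=> fD bf; exact: fullset_int. Qed.

Lemma fullsetI D1 D2 : fullset D1 -> fullset D2 -> fullset (D1 `&` D2).
Proof.
move=> [mD1 h1 z1] [mD2 h2 z2]; split; first exact: measurableI.
  by move=> m [/h1].
rewrite setDIr; apply/eqP; rewrite -measure_le0; apply: le_trans (measureU2 _ _ _) _; try exact: measurableD.
by rewrite [X in (X + _)%E]z1 [X in (_ + X)%E]z2 adde0.
Qed.

Lemma ae_fullset (P : R -> Prop) : {ae mu, forall m, -1 < m < 1 -> P m} ->
  exists2 D, fullset D & forall m, D m -> P m.
Proof.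
move=> aeP; have aen (c : R) : {ae mu, forall m, m != c}.
  exists [set c]; split => //; first exact: lebesgue_measure_set1.
  by move=> m /= /negP; rewrite negbK => /eqP.
have [N [mN N0 PN]] := ae_and aeP (ae_and (aen 0) (ae_and (aen (-1)) (aen 1))).
have H m : (I11 `\` N) m -> [/\ -1 <= m <= 1, m != 0 & P m].
  move=> [/= mI11 nN]; rewrite in_itv/= in mI11; have /andP[m1 m2] := mI11.
  have [HP [m0 [n1 n2]]] : (-1 < m < 1 -> P m) /\ m != 0 /\ m != -1 /\ m != 1.
    by apply: contrapT => nP; apply: nN; apply: PN.
  split => //; apply: HP.
  by rewrite !lt_neqAle m1 m2 n2 eq_sym n1.
exists (I11 `\` N); last by move=> m /H[].
split; first exact: measurableD.
  by move=> m /H[].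
apply/eqP; rewrite -measure_le0 -[X in (_ <= X)%E]N0 le_measure ?inE//.
  by apply: measurableD => //; exact: measurableD.
by move=> m [mI11 nD]; apply: contrapT => nN; exact: nD.
Qed.

(** The field [cl_t] is the integrated form of t' = <m p>. Boundary values are expressed by linear
    bounds at 0, for m > 0 only in the case of [p], with a constant depending on m. The set [D] is a
    parameter so that two solutions can share the intersection of their sets. *)
Record classical (D : set R) (C Tb : R) (psib : R -> R) (t : R -> R) (p : R -> R -> R) : Prop :=
  Classical {
  cl_bmeas : forall x : R, 0 < x -> bmeas (p x) ;
  cl_t_itv : forall x : R, 0 < x -> 0 <= t x <= C ;
  cl_p_itv : forall x m : R, 0 < x -> D m -> 0 <= p x m <= C ;
  cl_der_p : forall x m : R, 0 < x -> D m ->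
    is_derive x 1 (fun y : R => p y m) ((t x ^+ 4 - p x m) / m) ;
  cl_t : exists d : R, forall x : R, 0 < x -> t x = d - \int[mu]_(m in D) (m ^+ 2 * p x m) ;
  cl_t0 : exists L : R, forall x : R, 0 < x -> `|t x - Tb| <= L * x ;
  cl_p0 : forall m : R, D m -> 0 < m ->
    exists L : R, forall x : R, 0 < x -> `|p x m - psib m| <= L * x }.

Lemma measurable_eq_set (f g : R * R -> R) : measurable_fun setT f -> measurable_fun setT g ->
  measurable [set p | f p = g p].
Proof.
move=> mf mg; have m := measurable_funB mf mg.
have := m measurableT [set 0] (measurable_set1 _); rewrite setTI.
by congr measurable; apply/seteqP; split => p /= /eqP; [rewrite subr_eq0 => /eqP|move=> /eqP ->; rewrite subrr].
Qed.

End classical_solutions.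

Section second_moment.
Context {R : realType}.
Local Notation mu := (@lebesgue_measure R).
Local Notation I11 := `[(-1)%R, 1%R]%classic.
Context (C : R) (t : R -> R) (q : R * R -> R) (W : weak_milne C t q).

Definition moment2 (x : R) : R := \int[mu]_(m in I11) (mI m ^+ 2 * q (x, m)).

Lemma bmeas_mom k : bmeas (fun p : R * R => mI p.2 ^+ k * q p).
Proof.
by apply: bmeasM (wm_q W); apply: bmeasX; exact: bmeas_comp measurable_snd (@bmeas_mI R).
Qed.

Lemma bmeas_moment2 : bmeas moment2.
Proof. exact: bmeas_intR (measurable_itv _) (@lebesgue_cc11 R) (bmeas_mom 2). Qed.

(** With A = <q - t^4> and M1 = <m q>, the equations give t'' = - A, M1' = - A (z = 1), and <m^2 q>'
    = - M1 (z = m), hence (t + <m^2 q>)'' = 0; boundedness rules out a linear part. *)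
Lemma t_moment2_cst : exists d, {ae mu, forall x, 0 < x -> t x + moment2 x = d}.
Proof.
pose u x := t x + moment2 x.
have bu : bmeas u by apply: bmeasD (wm_t W) bmeas_moment2.
exists (prim (fun x => u x * cutoff x) 0 2); apply: (@du_Bois_Reymond2 _ u bu).
move=> f a b N a0 ab bN f0 f10 f20 tf.
have fN := lebesgue_oc 0 N.
have cc (c : R) : continuous (fun _ : R => c) by move=> x; exact: cvg_cst.
have [c1 c2 _] := tf.
set f1 := derive1 f in f10 f20 c2 *; set f2 := derive1 f1 in f20 *.
have df (x : R) : is_derive x 1 f (f1 x).
  by have [d _] := c1 x I; exact: derivable_der.
have df1 (x : R) : is_derive x 1 f1 (f2 x).
  by have [d _] := c2 x I; exact: derivable_der.
have cf1 : continuous f1 by move=> x; exact: der_cont (df1 x).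
have cf2 : continuous f2 by move=> x; have [_] := c2 x I.
have cf : continuous f by move=> x; exact: der_cont (df x).
have bf := bmeas_csupp cf f0; have bf1 := bmeas_csupp cf1 f10; have bf2 := bmeas_csupp cf2 f20.
pose A x := \int[mu]_(m in I11) src t q (x, m).
pose M1 x := \int[mu]_(m in I11) (mI m ^+ 1 * q (x, m)).
have bA : bmeas A := bmeas_intR (measurable_itv _) (@lebesgue_cc11 R) (bmeas_src W).
have bM1 : bmeas M1 := bmeas_intR (measurable_itv _) (@lebesgue_cc11 R) (bmeas_mom 1).
have bs x : bmeas (fun m => src t q (x, m)) := bmeas_pair1R x (bmeas_src W).
have bmk x k : bmeas (fun m => mI m ^+ k * q (x, m)) := bmeas_pair1R x (bmeas_mom k).
have E0 : prim (fun x => t x * f2 x + A x * f x) 0 N = 0 := wm_eq_t W a0 ab bN f0 tf f20.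
have E1 : prim (fun x => - (M1 x * f1 x) + A x * f x) 0 N = 0.
  have [_ e] := weak_int_z W a0 ab bN f0 f10 df cf1 (der_cst 1) (cc 0); rewrite -[RHS]e.
  apply: eq_Rintegral => x _.
  transitivity (\int[mu]_(m in I11) (- (mI m ^+ 1 * q (x, m)) * f1 x + src t q (x, m) * f x)).
    rewrite bintD//; [|exact: lebesgue_cc11| |]; last 2 first.
    - by have h1 := bmk x 1; bm.
    - by have h1 := bs x; bm.
    have h1 := bmk x 1; have h2 := bs x.
    rewrite !bintZr//; try exact: lebesgue_cc11; try by bm.
    by rewrite bintN ?mulNr//; exact: lebesgue_cc11.
  by apply: eq_Rintegral => m _; rewrite /weak_int mul1r mulNr expr1.
have E2 : prim (fun x => - (moment2 x * f2 x) + M1 x * f1 x) 0 N = 0.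
  have [_ e] := weak_int_z W a0 ab bN f10 f20 df1 cf2 (@der_id R) (cc 1); rewrite -[RHS]e.
  apply: eq_Rintegral => x _.
  transitivity (\int[mu]_(m in I11) (- (mI m ^+ 2 * q (x, m)) * f2 x + (mI m ^+ 1 * q (x, m) * f1 x - mI m * (t x ^+ 4 * f1 x)))).
    have h1 := bmk x 1; have h2 := bmk x 2; have h0 := @bmeas_mI R.
    have b1 : bmeas (fun m => mI m ^+ 1 * q (x, m) * f1 x) by apply: bmeasM _ (bmeas_cst _).
    have b2 : bmeas (fun m => mI m * (t x ^+ 4 * f1 x)) by bm.
    have b3 : bmeas (fun m => - (mI m ^+ 2 * q (x, m)) * f2 x) by apply: bmeasM _ (bmeas_cst _); exact: bmeasN.
    rewrite bintD//; [|exact: lebesgue_cc11|exact: bmeasB].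
    rewrite bintB//; last exact: lebesgue_cc11.
    rewrite !bintZr//; try exact: lebesgue_cc11; try by bm.
    rewrite bintN//; last exact: lebesgue_cc11.
    (* The term with t^4 drops out because <m> = 0. *)
    have -> : \int[mu]_(m in I11) mI m = 0.
      by rewrite -[RHS](@mean_id R); apply: eq_Rintegral => m; rewrite inE => mI11; rewrite mIE.
    by rewrite mul0r subr0 mulNr.
  apply: eq_Rintegral => m; rewrite inE => mI11; rewrite /weak_int /src /= mIE// expr2 expr1.
  by ring.
have -> : prim (fun x => u x * f2 x) 0 N = prim (fun x => t x * f2 x + A x * f x) 0 N
   - prim (fun x => - (M1 x * f1 x) + A x * f x) 0 N - prim (fun x => - (moment2 x * f2 x) + M1 x * f1 x) 0 N.
  have b0 : bmeas (fun x => t x * f2 x + A x * f x).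
    by apply: bmeasD; [exact: bmeasM (wm_t W) bf2|exact: bmeasM].
  have b1 : bmeas (fun x => - (M1 x * f1 x) + A x * f x).
    by apply: bmeasD; [apply: bmeasN; exact: bmeasM|exact: bmeasM].
  have b2 : bmeas (fun x => - (moment2 x * f2 x) + M1 x * f1 x).
    by apply: bmeasD; [apply: bmeasN; exact: bmeasM bmeas_moment2 bf2|exact: bmeasM].
  rewrite /prim -bintB// -bintB//; last exact: bmeasB.
  by apply: eq_Rintegral => x _; rewrite /u; ring.
by rewrite E0 E1 E2 !subr0.
Qed.

End second_moment.
Section transport_representative.
Context {R : realType}.
Local Notation mu := (@lebesgue_measure R).
Local Notation I11 := `[(-1)%R, 1%R]%classic.

Lemma prim_lip0 (f : R -> R) (B x y : R) : bmeas f -> (forall t, `|f t| <= B) -> 0 < x -> 0 < y ->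
  `|prim f 0 x - prim f 0 y| <= B * `|x - y|.
Proof.
move=> bf fB x0 y0; have lip := @prim_lip R f 0 B bf (fun t _ => fB t).
have [xy|/ltW yx] := leP x y.
  by rewrite distrC (distrC x) (ger0_norm (_ : 0 <= y - x)) ?subr_ge0// lip// ltW.
by rewrite (ger0_norm (_ : 0 <= x - y)) ?subr_ge0// lip// ltW.
Qed.

(** A bootstrap: constancy of [Vm] gives for each good m a representative [P m] Lipschitz in x; the
    moment identity then defines a Lipschitz [t]; so the source agrees almost everywhere with a
    continuous function, and [P m] is differentiable everywhere. *)
Lemma classical_of_solution (Tb : R) (psib T : R -> R) (psi : R * R -> R) :
  milne_solution Tb psib T psi -> exists C t p D,
  [/\ fullset D, forall D', fullset D' -> D' `<=` D -> classical D' C Tb psib t p,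
      {ae mu, forall x, 0 < x -> T x = t x} &
      forall m, D m -> {ae mu, forall x, 0 < x -> psi (x, m) = p x m}].
Proof.
move=> sol; have [C [t0 [q [C0 W Tt0 psiq]]]] := weak_of_solution sol.
have [d td] := t_moment2_cst W.
have psiq2 : {ae mu, forall m, {ae mu, forall x, strip R (x, m) -> psi (x, m) = q (x, m)}}.
  exact: (@ae_prod2 _ _ (measurableTypeR R) (measurableTypeR R) R mu mu _ psiq).
pose good m := [/\ {ae mu, forall x, 0 < x -> Vm t0 q m x = cm t0 q m},
  {ae mu, forall x, strip R (x, m) -> psi (x, m) = q (x, m)} &
  0 < m -> trace0 (fun x => psi (x, m)) (psib m)].
have [D fD Dg] : exists2 D, fullset D & forall m, D m -> good m.
  apply: ae_fullset; apply: ae_sub (ae_and (Vm_cst W) (ae_and psiq2 (milne_bc_psi sol))) => m [H1 [H2 H3]] m1.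
  split => //; first exact: H1.
  by move=> m0; apply: H3; rewrite /= in_itv/= m0; case/andP: m1 => _ /ltW.
have [mD DI D0] := fD.
have [B0 srcB] := (bmeas_src W).2.
pose K m x := prim (fun y => src t0 q (y, m)) 0 x.
pose P m x := (cm t0 q m - K m x) / m.
pose p x m := P m x * \1_D m.
have pD x m : D m -> p x m = P m x by move=> mD'; rewrite /p indicE mem_set// mulr1.
have KL m : lip_pos B0 (K m).
  by move=> x y x0 y0; apply: prim_lip0 => //; exact: bmeas_src2 W m.
have PL m : D m -> lip_pos (B0 / `|m|) (P m).
  move=> mD' x y x0 y0; rewrite /P -mulrBl opprB addrC addrA subrK normrM normfV.
  by rewrite mulrAC ler_wpM2r ?invr_ge0// distrC KL.
have qP m : D m -> {ae mu, forall x, 0 < x -> q (x, m) = P m x}.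
  move=> mD'; have [V _ _] := Dg m mD'; have [_ m0] := DI m mD'.
  apply: ae_sub V => x Hx x0; rewrite /P -(Hx x0) /Vm /K addrK mulrAC divff ?mul1r//.
have P_itv x m : 0 < x -> D m -> 0 <= P m x <= C.
  move=> x0 mD'; apply: (lip_pos_itv (PL m mD')) x0.
  by apply: ae_sub (qP m mD') => y Hy y0; rewrite -Hy//; exact: wm_q_itv W _.
(* A bounded measurable function of m that agrees with the constant of [Vm] on [D]; [primN] may
   replace the primitive since [cutoff] is integrated up to 2 only. *)
pose c' m := \int[mu]_(x in `]0, 2]) ((mI m * q (x, m) + primN 2 (src t0 q) (x, m)) * cutoff x).
have bc' : bmeas c'.
  apply: (bmeas_int2R (F := fun p => (mI p.2 * q p + primN 2 (src t0 q) p) * cutoff p.1) (measurable_itv _) (lebesgue_oc 0 2)).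
  have b1 : bmeas (fun p : R * R => mI p.2) := bmeas_comp measurable_snd (@bmeas_mI R).
  have b2 := bmeas_primN 2 (bmeas_src W).
  have b3 : bmeas (fun p : R * R => cutoff p.1) := bmeas_comp measurable_fst (@bmeas_cutoff R).
  have b4 := wm_q W.
  apply: bmeasM b3; apply: bmeasD => //; exact: bmeasM.
have c'E m : D m -> c' m = cm t0 q m.
  move=> mD'; apply: eq_Rintegral => x; rewrite inE /= in_itv/= => /andP[_ x2].
  by rewrite primNE// mIE//; exact: fullset_sub mD'.
pose J (N : R) (z : R * R) := (c' z.2 - primN N (src t0 q) z) * (z.2)^-1 * \1_D z.2.
have mJ N : measurable_fun setT (J N).
  apply: measurable_funM; last exact: measurableT_comp (measurable_indic mD) measurable_snd.
  apply: measurable_funM; last exact: measurableT_comp (@measurable_invr R) measurable_snd.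
  apply: measurable_funB; last by case: (bmeas_primN N (bmeas_src W)).
  by apply: (measurableT_comp bc'.1).
have JE N x m : x <= N -> J N (x, m) = p x m.
  move=> xN; rewrite /J /p /P /= indicE; case: (boolP (m \in D)) => [|_]; last by rewrite !mulr0.
  by rewrite inE => mD'; rewrite c'E// primNE.
have bp x : 0 < x -> bmeas (p x).
  move=> x0; split.
    rewrite (_ : p x = (fun m => J x (x, m))); last by apply/funext => m; rewrite JE.
    exact: (measurableT_comp (mJ x)).
  exists C => m; rewrite /p indicE; case: (boolP (m \in D)) => [|_].
    by rewrite inE mulr1 => /(P_itv x m x0)/andP[? ?]; rewrite ger0_norm.
  by rewrite mulr0 normr0.
have bm2p x : 0 < x -> bmeas (fun m => mI m ^+ 2 * p x m).
  by move=> x0; have h := bp x x0; have h' := @bmeas_mI R; bm.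
have qp : {ae mu, forall x, 0 < x -> {ae mu, forall m, D m -> q (x, m) = p x m}}.
  have H (N : nat) : {ae mu, forall x, 0 < x < N%:R -> {ae mu, forall m, D m -> q (x, m) = p x m}}.
    (* Exchanging almost every m, almost every x for the reverse order requires a measurable set,
       hence the globally measurable [J] and the indicators restricting to [D] and to x < N. *)
    pose A : set (R * R) := [set z | q z * \1_D z.2 * \1_(`]0, N%:R[%classic) z.1 = J N%:R z * \1_(`]0, N%:R[%classic) z.1].
    have bI : bmeas (fun z : R * R => \1_(`]0, N%:R[%classic) z.1 : R).
      by apply: (bmeas_comp measurable_fst); exact: bmeas_indic.
    have bD : bmeas (fun z : R * R => \1_D z.2 : R).
      by apply: (bmeas_comp measurable_snd); exact: bmeas_indic.
    have mA : measurable A.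
      apply: measurable_eq_set.
        suff [] : bmeas (fun z => q z * \1_D z.2 * \1_(`]0, N%:R[%classic) z.1) by [].
        by have h := wm_q W; bm.
      by apply: measurable_funM => //; case: bI.
    have : {ae mu, forall m, {ae mu, forall x, A (x, m)}}.
      have mDc : {ae mu, forall m, True} by exact: aeW.
      apply: ae_sub mDc => m _; have [mD'|nD] := pselect (D m).
        apply: ae_sub (qP m mD') => x Hx; rewrite /A /=.
        rewrite [\1_(`]0, N%:R[%classic) x]indicE; case: (boolP (x \in _)) => [|_]; last by rewrite !mulr0.
        rewrite inE /= in_itv/= => /andP[x0 xN]; rewrite JE ?(ltW xN)// !mulr1.
        by rewrite indicE mem_set// mulr1 Hx// pD.
      apply: aeW => x; rewrite /A /J /= (_ : \1_D m = 0) ?mulr0//.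
      by rewrite indicE memNset.
    move=> /(@ae_prod_converse _ _ (measurableTypeR R) (measurableTypeR R) R mu mu A mA).
    move=> /(@ae_prod1 _ _ (measurableTypeR R) (measurableTypeR R) R mu mu A).
    apply: ae_sub => x aeA /andP[x0 xN]; apply: ae_sub aeA => m; rewrite /A /= => + mD'.
    rewrite ![\1_(`]0, N%:R[%classic) x]indicE mem_set ?mulr1; last by rewrite /= in_itv/= x0.
    by rewrite indicE mem_set// !mulr1 JE// ltW.
  have := ae_foralln H; apply: ae_sub => x Hx x0.
  apply: (Hx (Num.truncn x).+1); rewrite x0; exact: truncnS_gt.
pose t x := d - \int[mu]_(m in I11) (mI m ^+ 2 * p x m).
have t0t : {ae mu, forall x, 0 < x -> t0 x = t x}.
  apply: ae_sub (ae_and td qp) => x [tx qx] x0; rewrite /t -(tx x0) /moment2.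
  apply/eqP; rewrite eq_sym -addrA addrC -subr_eq0 addrK subr_eq0; apply/eqP.
  rewrite -(fullset_int_eq fD (bm2p x x0)); apply/esym.
  have bq : bmeas (fun m => mI m ^+ 2 * q (x, m)).
    by have h1 := bmeas_pair1R x (wm_q W); have h2 := @bmeas_mI R; bm.
  rewrite -(fullset_int_eq fD bq); apply: eq_bint_ae => //; first exact: bm2p.
  by apply: ae_sub (qx x0) => m Hm mD'; rewrite Hm.
(* The Lipschitz constant of [P m] is of order 1 / |m|, and the factor m^2 in the moment compensates
   it. *)
have tL : lip_pos (B0 * fine (mu I11)) t.
  move=> x y x0 y0; rewrite /t opprB addrC addrA subrK -bintB//; [|exact: lebesgue_cc11|exact: bm2p|exact: bm2p].
  rewrite mulrAC; apply: bint_norm => //; first exact: lebesgue_cc11.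
    by apply: bmeasB; exact: bm2p.
  move=> m mI11; rewrite mIE// -mulrBr.
  have B00 : 0 <= B0 by rewrite (le_trans _ (srcB (0, 0))).
  have [mD'|nD] := pselect (D m); last first.
    by rewrite /p indicE memNset// !mulr0 subrr mulr0 normr0 mulr_ge0.
  have [m1 m0] := DI m mD'; rewrite !pD// normrM normrX distrC.
  have mn : 0 < `|m| by rewrite normr_gt0.
  have mn1 : `|m| <= 1 by rewrite ler_norml.
  apply: le_trans (ler_wpM2l _ (PL m mD' _ _ x0 y0)) _; first by rewrite exprn_ge0.
  have -> : `|m| ^+ 2 * (B0 / `|m| * `|x - y|) = `|m| * (B0 * `|x - y|).
    by field; exact: lt0r_neq0.
  by rewrite -[leRHS]mul1r ler_wpM2r// mulr_ge0.
have t_itv x : 0 < x -> 0 <= t x <= C.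
  move=> x0; apply: (lip_pos_itv tL) x0.
  by apply: ae_sub t0t => y Hy y0; rewrite -Hy//; exact: wm_t_itv W _.
exists C, t, p, D; split => //; first last.
- move=> m mD'; have [_ pq _] := Dg m mD'; apply: ae_sub (ae_and pq (qP m mD')) => x [h1 h2] x0.
  rewrite h1 ?h2 ?pD//; split; first by rewrite /Rpos /= in_itv/= x0.
  exact: fullset_sub fD _ mD'.
- by apply: ae_sub (ae_and Tt0 t0t) => x [h1 h2] x0; rewrite h1 ?h2// /Rpos /= in_itv/= x0.
move=> D' fD' D'D; split => //.
- by move=> x m x0 /D'D mD'; rewrite pD//; exact: P_itv.
- move=> x m x0 /D'D mD'; have [_ m0] := DI m mD'.
  have E : (fun y => p y m) = (fun y => (cm t0 q m - K m y) / m) by apply/funext => y; rewrite pD.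
  (* The source equals the continuous [v] only almost everywhere, but its primitive is
     differentiable at every point. *)
  pose v y := P m y - t y ^+ 4.
  have dK : is_derive x 1 (K m) (v x).
    apply: (@is_derive_prim_ae _ _ v (C + C ^+ 4)) => //.
    + exact: bmeas_src2 W m.
    + move=> y y0; apply: cvgB; first exact: lip_pos_cont (PL m mD') y0.
      by apply: cvg_exprn; exact: lip_pos_cont tL y0.
    + move=> y y0; have /andP[h1 h2] := P_itv y m y0 mD'; have /andP[h3 h4] := t_itv y y0.
      rewrite (le_trans (ler_normB _ _))// lerD ?ger0_norm ?exprn_ge0//.
      by rewrite lerXn2r ?nnegrE.
    + apply: ae_sub (ae_and (qP m mD') t0t) => y [h1 h2] y0.
      by rewrite /src /v /= h1// h2.
  rewrite E; eapply der_eq; first by der.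
  by rewrite pD// /v /=; field.
- exists d => x x0; rewrite /t; congr (_ - _); rewrite -(fullset_int_eq fD' (bm2p x x0)).
  by apply: eq_Rintegral => m; rewrite inE => mD'; rewrite mIE//; exact: fullset_sub fD' _ mD'.
- exists (B0 * fine (mu I11)); apply: (@trace_lip _ _ T) => //.
  + by case: (milne_L2loc_T sol).
  + by apply: ae_sub (ae_and Tt0 t0t) => x [h1 h2] x0; rewrite h1 ?h2// /Rpos /= in_itv/= x0.
  + exact: milne_bc_T sol.
- move=> m /D'D mD' m0; have [_ pq tr] := Dg m mD'.
  exists (B0 / `|m|); have := @trace_lip _ (B0 / `|m|) (fun x => psi (x, m)) (P m) (psib m).
  have mI11 := fullset_sub fD mD'.
  move=> H x x0; rewrite pD//; apply: H => //.
  + apply: (@eq_measurable_fun _ _ _ _ _ (fun x => (psi \_ (strip R)) (x, m))).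
      by move=> y; rewrite inE => yP; rewrite patchE mem_set.
    apply: measurable_funTS; apply: (measurableT_comp (f := psi \_ (strip R))) => //.
    by apply/(measurable_restrictT _ (@measurable_strip R)); case: (milne_L2loc_psi sol).
  + exact: PL.
  + apply: ae_sub (ae_and pq (qP m mD')) => y [h1 h2] y0; rewrite h1 ?h2//.
    by split => //; rewrite /Rpos /= in_itv/= y0.
  + exact: tr.
Qed.

End transport_representative.
(** * Energy identities for the transport equation *)

Section transport_identities.
Context {R : realType}.
Local Notation mu := (@lebesgue_measure R).
Context (D : set R) (fD : fullset D).

Let mD : measurable D. Proof. by case: fD. Qed.
Let finD : (mu D < +oo)%E. Proof. exact: fullset_fin. Qed.
Let DI m : D m -> `[(-1)%R, 1%R]%classic m. Proof. exact: fullset_sub. Qed.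

Lemma mI_le1 m : `|mI m| <= 1 :> R.
Proof.
rewrite /mI indicE; case: (boolP (m \in _)) => [|_]; last by rewrite mulr0 normr0.
by rewrite inE /= in_itv/= mulr1 ler_norml.
Qed.

Lemma int_mI : \int[mu]_(m in D) mI m = 0.
Proof.
rewrite -[RHS](@mean_id R) fullset_int_eq//; last exact: bmeas_mI.
by apply: eq_Rintegral => m; rewrite inE => mI11; rewrite mIE.
Qed.

Lemma int_mI2 : \int[mu]_(m in D) (mI m ^+ 2) = 2 / 3.
Proof.
rewrite -(@mean_sqr R) fullset_int_eq//; last exact: bmeasX (@bmeas_mI R).
by apply: eq_Rintegral => m; rewrite inE => mI11; rewrite mIE.
Qed.

Lemma int_cst (c : R) : \int[mu]_(m in D) c = 2 * c.
Proof.
rewrite fullset_int_eq//; last exact: bmeas_cst.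
have E : mu `[(-1)%R, 1%R] = 2%:E.
  have l : -1 < 1 :> R by lra.
  by rewrite lebesgue_measure_itv /= lte_fin l -EFinB opprK.
by rewrite Rintegral_cst//= E mulrC.
Qed.

Lemma der_int (f f' : R -> R -> R) (b x B : R) : 0 < x -> x < b ->
  (forall y : R, 0 < y -> bmeas (f y)) ->
  (forall y m : R, 0 < y -> D m -> is_derive y 1 (fun z : R => f z m) (f' y m)) ->
  (forall y m : R, 0 < y -> y < b -> D m -> `|f' y m| <= B) ->
  is_derive x 1 (fun y => \int[mu]_(m in D) f y m) (\int[mu]_(m in D) f' x m).
Proof.
move=> x0 xb bf df f'B.
have Ix : `]0, b[%classic x by rewrite /= in_itv/= x0.
have H1 y : `]0, b[%classic y -> mu.-integrable D (EFin \o f y).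
  by rewrite /= in_itv/= => /andP[y0 _]; apply: bmeas_integrable => //; exact: bf.
have H2 y m : `]0, b[%classic y -> D m -> derivable (f ^~ m) y 1.
  by rewrite /= in_itv/= => /andP[y0 _] Dm; case: (df y m y0 Dm).
have iG : mu.-integrable D (EFin \o (fun=> `|B|)) by apply: bmeas_integrable => //; exact: bmeas_cst.
have E y m : 0 < y -> D m -> partial1of2 f y m = f' y m.
  by move=> y0 Dm; apply: der_derive1; exact: df.
have H3 y m : `]0, b[%classic y -> D m -> `|partial1of2 f y m| <= `|B|.
  rewrite /= in_itv/= => /andP[y0 yb] Dm; rewrite E//.
  by rewrite (le_trans (f'B y m y0 yb Dm))// ler_norm.
have d := @derivable_under_integral R _ (measurableTypeR R) mu f D mD x 0 b Ix H1 H2 (fun=> `|B|) (fun=> normr_ge0 B) iG H3.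
have v := @differentiation_under_integral R _ (measurableTypeR R) mu f D mD x 0 b Ix H1 H2 (fun=> `|B|) (fun=> normr_ge0 B) iG H3.
apply: DeriveDef; first exact: d.
by rewrite -derive1E v; apply: eq_Rintegral => m; rewrite inE => Dm; rewrite E.
Qed.

(* [h] is [T^4] for one solution and the difference of the fourth powers for two. *)
Record transport (f : R -> R -> R) (h h' : R -> R) (B : R) : Prop := Transport {
  tr_bmeas : forall x : R, 0 < x -> bmeas (f x) ;
  tr_f : forall x m : R, 0 < x -> D m -> `|f x m| <= B ;
  tr_h : forall x : R, 0 < x -> `|h x| <= B ;
  tr_h' : forall x : R, 0 < x -> `|h' x| <= B ;
  tr_der_f : forall x m : R, 0 < x -> D m -> is_derive x 1 (fun y : R => f y m) ((h x - f x m) / m) ;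
  tr_der_h : forall x : R, 0 < x -> is_derive x 1 h (h' x) }.

Context (f : R -> R -> R) (h h' : R -> R) (B : R) (tr : transport f h h' B).

(** In the notation of the overview [resid] is r, [flux] is k, [quad] is F and [energy] is <r^2>. *)
Definition resid x m := f x m - h x.
Definition flux x := \int[mu]_(m in D) (mI m * f x m).
Definition quad x := \int[mu]_(m in D) (mI m * resid x m ^+ 2).
Definition energy x := \int[mu]_(m in D) (resid x m ^+ 2).

Lemma bmeas_resid x : 0 < x -> bmeas (resid x).
Proof. by move=> x0; have b := tr_bmeas tr x0; rewrite /resid; bm. Qed.

Lemma energy_ge0 x : 0 <= energy x.
Proof. by apply: Rintegral_ge0 => m _; exact: sqr_ge0. Qed.

Lemma resid_le x m : 0 < x -> D m -> `|resid x m| <= 2 * B.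
Proof.
move=> x0 Dm; rewrite (le_trans (ler_normB _ _))// mulr_natl mulr2n lerD//.
  exact: tr_f tr _ _ x0 Dm.
exact: tr_h tr _ x0.
Qed.

Lemma flux_resid x : 0 < x -> flux x = \int[mu]_(m in D) (mI m * resid x m).
Proof.
move=> x0; have b := tr_bmeas tr x0; have b' := @bmeas_mI R.
have -> : (fun m => mI m * resid x m) = (fun m => mI m * f x m - mI m * h x).
  by apply/funext => m; rewrite /resid mulrBr.
rewrite bintB//; [|by bm|by bm].
by rewrite bintZr// int_mI mul0r subr0.
Qed.

Lemma quad_le x : 0 < x -> `|quad x| <= energy x.
Proof.
move=> x0; have b := bmeas_resid x0; have b' := @bmeas_mI R.
have key m : `|mI m * resid x m ^+ 2| <= resid x m ^+ 2.
  rewrite normrM (ger0_norm (sqr_ge0 (resid x m))) -[leRHS]mul1r.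
  by rewrite ler_wpM2r ?sqr_ge0// mI_le1.
rewrite ler_norml; apply/andP; split.
  rewrite -bintN//; last by bm.
  by apply: ble_int => //; try (by bm); move=> m _; have := key m; rewrite ler_norml => /andP[].
by apply: ble_int => //; try (by bm); move=> m _; have := key m; rewrite ler_norml => /andP[].
Qed.

(* Cauchy-Schwarz, from the nonnegativity of <(s m + r)^2> for all s. *)
Lemma flux_sqr x : 0 < x -> flux x ^+ 2 <= 2 / 3 * energy x.
Proof.
move=> x0; have b := bmeas_resid x0; have b' := @bmeas_mI R.
have key s : 0 <= s ^+ 2 * (2 / 3) + 2 * s * flux x + energy x.
  rewrite flux_resid// -int_mI2 -!bintZl//; [|by bm|by bm].
  rewrite -bintD//; [|by bm|by bm].
  rewrite -bintD//; [|by bm|by bm].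
  by apply: Rintegral_ge0 => m _; have := sqr_ge0 (s * mI m + resid x m); nra.
have := key (- (3 / 2 * flux x)); nra.
Qed.

(** Young's inequality with a free parameter: the bound is linear in [energy], which is what the
    derivative of [quad] controls. *)
Lemma int_resid_le x l : 0 < x -> 0 < l ->
  `|\int[mu]_(m in D) resid x m| <= energy x / (2 * l) + l.
Proof.
move=> x0 l0; have b := bmeas_resid x0.
have E : energy x / (2 * l) + l = \int[mu]_(m in D) ((2 * l)^-1 * resid x m ^+ 2 + l / 2).
  rewrite bintD//; [|by bm|by bm]; rewrite bintZl//; last by bm.
  by rewrite int_cst mulrC; congr (_ + _); lra.
have key m : `|resid x m| <= (2 * l)^-1 * resid x m ^+ 2 + l / 2.
  rewrite -[resid x m ^+ 2]real_normK ?num_real//; set y := `|_|.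
  have -> : (2 * l)^-1 * y ^+ 2 + l / 2 = y + (2 * l)^-1 * (y - l) ^+ 2 by field; exact: lt0r_neq0.
  by rewrite lerDl mulr_ge0 ?sqr_ge0// invr_ge0 mulr_ge0// ltW.
rewrite E ler_norml; apply/andP; split.
  rewrite -bintN//; last by bm.
  by apply: ble_int => //; try (by bm); move=> m _; have := key m; rewrite ler_norml => /andP[].
by apply: ble_int => //; try (by bm); move=> m _; have := key m; rewrite ler_norml => /andP[].
Qed.

Lemma der_flux (x : R) : 0 < x -> is_derive x 1 flux (- \int[mu]_(m in D) resid x m).
Proof.
move=> x0; have b' := @bmeas_mI R.
have -> : - (\int[mu]_(m in D) resid x m) = \int[mu]_(m in D) (- resid x m).
  by rewrite bintN//; exact: bmeas_resid.
refine (@der_int (fun y m => mI m * f y m) (fun y m => - resid y m) (x + 1) x (2 * B) x0 _ _ _ _).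
- by rewrite ltrDl.
- by move=> y y0; have b := tr_bmeas tr y0; bm.
- move=> y m y0 Dm; have d := tr_der_f tr y0 Dm; have [_ hm _] := fD; have [_ m0] := hm m Dm.
  eapply der_eq; first by der.
  by rewrite (mIE (DI Dm)) /resid; field.
- by move=> y m y0 _ Dm; rewrite normrN resid_le.
Qed.

Lemma der_quad (x : R) : 0 < x -> is_derive x 1 quad (- (2 * energy x) - 2 * h' x * flux x).
Proof.
move=> x0; have b' := @bmeas_mI R; have b := bmeas_resid x0.
have -> : - (2 * energy x) - 2 * h' x * flux x =
    \int[mu]_(m in D) (- (2 * resid x m ^+ 2) - 2 * h' x * (mI m * resid x m)).
  rewrite bintB//; [|by bm|by bm].
  rewrite bintN//; last by bm.
  by rewrite !bintZl//; [rewrite -flux_resid|by bm|by bm].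
refine (@der_int (fun y m => mI m * resid y m ^+ 2)
  (fun y m => - (2 * resid y m ^+ 2) - 2 * h' y * (mI m * resid y m)) (x + 1) x
  (2 * (2 * B) ^+ 2 + 2 * B * (1 * (2 * B))) x0 _ _ _ _).
- by rewrite ltrDl.
- by move=> y y0; have b2 := bmeas_resid y0; bm.
- move=> y m y0 Dm; have d := tr_der_f tr y0 Dm; have dh := tr_der_h tr y0.
  have [_ hm _] := fD; have [_ m0] := hm m Dm.
  eapply der_eq; first by rewrite /resid; der.
  by rewrite (mIE (DI Dm)) /resid /=; field.
- move=> y m y0 _ Dm; have r := resid_le y0 Dm; have hh := tr_h' tr y0.
  have r2 : `|resid y m| ^+ 2 <= (2 * B) ^+ 2 by rewrite lerXn2r ?nnegrE// (le_trans _ r).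
  rewrite (le_trans (ler_normB _ _))// lerD//.
    by rewrite normrN normrM normrX ger0_norm// ler_wpM2l.
  rewrite normrM (normrM 2) (ger0_norm (ler0n _ 2)) (normrM (mI m)).
  by rewrite ler_pM ?mulr_ge0// ?ler_wpM2l// ler_pM// mI_le1.
Qed.

End transport_identities.
Section calculus.
Context {R : realType}.
Implicit Types (f : R -> R) (x y : R).

Lemma MVT_pos f (f' : R -> R) x y : (forall z : R, 0 < z -> is_derive z 1 f (f' z)) -> 0 < x -> x < y ->
  exists2 c, x < c < y & f y - f x = f' c * (y - x).
Proof.
move=> df x0 xy; have [||c] := @MVT _ f f' x y xy.
- by move=> z; rewrite in_itv/= => /andP[xz _]; apply: df; exact: lt_trans xz.
- apply: continuous_in_subspaceT => z; rewrite inE /= in_itv/= => /andP[xz _].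
  exact: der_cont (df z (lt_le_trans x0 xz)).
- by rewrite in_itv/= => cxy E; exists c.
Qed.

Lemma der_nonincr f (f' : R -> R) : (forall z : R, 0 < z -> is_derive z 1 f (f' z)) ->
  (forall z : R, 0 < z -> f' z <= 0) -> forall x y, 0 < x -> x <= y -> f y <= f x.
Proof.
move=> df f'0 x y x0; rewrite le_eqVlt => /predU1P[->//|xy].
have [c /andP[xc _] E] := MVT_pos df x0 xy.
rewrite -subr_le0 E mulr_le0_ge0 ?subr_ge0 ?(ltW xy)//.
by apply: f'0; exact: lt_trans xc.
Qed.

Lemma der_expRM (a x : R) : is_derive x 1 (fun y : R => expR (a * y)) (expR (a * x) * a).
Proof.
have dl : is_derive x 1 (fun y : R => a * y) a.
  by eapply der_eq; first (by der); rewrite mul0r mulr1 add0r.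
exact: (@der_comp _ expR (fun y : R => a * y) x a _ (is_derive_expR _) dl).
Qed.

End calculus.

(** * Monotonicity and exponential decay *)

Section decay.
Context {R : realType}.
Local Notation mu := (@lebesgue_measure R).
Context (D : set R) (fD : fullset D).
Context (f : R -> R -> R) (h h' : R -> R) (B : R) (tr : transport D f h h' B).
Local Notation G := (quad D f h).
Local Notation S := (energy D f h).
Local Notation k := (flux D f).

Definition mpos (m : R) : R := mI m * \1_(`]0, 1]%classic) m.

Lemma bmeas_mpos : bmeas mpos.
Proof. by apply: bmeasM (@bmeas_mI R) _; exact: bmeas_indic. Qed.

Lemma mI_le_mpos m : D m -> mI m <= mpos m.
Proof.
move=> Dm; have mI11 := fullset_sub fD Dm; rewrite /mpos mIE//.
rewrite indicE; case: (boolP (m \in _)) => [_|]; first by rewrite mulr1.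
rewrite notin_setE /= in_itv/= mulr0; move: mI11; rewrite /= in_itv/= => /andP[_ m1].
by move/negP; rewrite m1 andbT -leNgt.
Qed.

Lemma cvg_near0 (g : R -> R) (l L : R) : (forall x : R, 0 < x -> `|g x - l| <= L * x) ->
  g n.+1%:R^-1 @[n --> \oo] --> l.
Proof.
move=> gl; apply/subr_cvg0; apply: norm_cvg0.
have c1 : L * n.+1%:R^-1 @[n --> \oo] --> 0.
  by rewrite -[X in _ --> X](mulr0 L); apply: cvgM; [exact: cvg_cst|exact: cvg_harmonic].
have c2 : (fun _ : nat => 0 : R) n @[n --> \oo] --> (0 : R) by exact: cvg_cst.
apply: (squeeze_cvgr _ c2 c1).
by apply: nearW => n; rewrite normr_ge0 /= gl// invr_gt0.
Qed.

Lemma int_near0 (u : R -> R -> R) (u0 : R -> R) (b e d : R) :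
  (forall x, 0 < x -> bmeas (u x)) -> bmeas u0 ->
  (forall x m, 0 < x -> D m -> `|u x m| <= b) ->
  (forall m, D m -> u n.+1%:R^-1 m @[n --> \oo] --> u0 m) -> 0 < e -> 0 < d ->
  exists2 x, 0 < x < d & `|\int[mu]_(m in D) u0 m - \int[mu]_(m in D) u x m| <= e.
Proof.
move=> bu bu0 ub uu0 e0 d0; have [mD _ _] := fD; have finD := fullset_fin fD.
have i0 (n : nat) : 0 < n.+1%:R^-1 :> R by rewrite invr_gt0.
have c1 : \int[mu]_(m in D) u n.+1%:R^-1 m @[n --> \oo] --> \int[mu]_(m in D) u0 m.
  by apply: (@cvg_bint _ _ _ _ _ _ _ _ _ b) => // n; [exact: bu|move=> m Dm; exact: ub].
near \oo => n; exists (n.+1%:R^-1).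
  rewrite i0 /=; near: n.
  have /cvgrPdist_lt/(_ _ d0) : n.+1%:R^-1 @[n --> \oo] --> (0 : R) by exact: cvg_harmonic.
  by apply: filterS => n; rewrite sub0r normrN gtr0_norm// i0.
by near: n; move/cvgrPdist_le : c1 => /(_ _ e0).
Unshelve. all: by end_near. Qed.

Lemma mpos_le1 m : `|mpos m| <= 1.
Proof.
rewrite /mpos normrM -[leRHS]mul1r ler_pM// ?mI_le1// indicE.
by case: (_ \in _); rewrite ?normr1 ?normr0.
Qed.

Lemma mpos_eq0 m : m <= 0 -> mpos m = 0.
Proof. by move=> m0; rewrite /mpos indicE memNset ?mulr0//= in_itv/= ltNge m0. Qed.

(** For m < 0 the integrand of [quad] is nonpositive and is discarded, so only the incoming
    directions, whose boundary values are known, enter; there dominated convergence applies. *)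
Lemma quad_near0 (f0 : R -> R) (h0 e d : R) : bmeas f0 ->
  (forall m, D m -> 0 < m -> exists L : R, forall x : R, 0 < x -> `|f x m - f0 m| <= L * x) ->
  (exists L : R, forall x : R, 0 < x -> `|h x - h0| <= L * x) -> 0 < e -> 0 < d ->
  exists2 x, 0 < x < d & G x <= \int[mu]_(m in D) (mpos m * (f0 m - h0) ^+ 2) + e.
Proof.
move=> bf0 ff0 [Lh hh0] e0 d0; have [mD _ _] := fD; have finD := fullset_fin fD.
have bm1 := bmeas_mpos; have bm2 := @bmeas_mI R.
have B0 : 0 <= B by rewrite (le_trans _ (tr_h tr ltr01)).
have := @int_near0 (fun x m => mpos m * resid f h x m ^+ 2) (fun m => mpos m * (f0 m - h0) ^+ 2)
  ((2 * B) ^+ 2) e d.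
case=> //.
- by move=> x x0; have b := bmeas_resid tr x0; bm.
- by bm.
- move=> x m x0 Dm; rewrite normrM normrX -[leRHS]mul1r ler_pM ?mpos_le1//.
  by rewrite lerXn2r ?nnegrE ?mulr_ge0// (resid_le tr x0 Dm).
- move=> m Dm; have [m0|m0] := leP m 0.
    by rewrite mpos_eq0//; under eq_fun do rewrite mul0r; rewrite mul0r; exact: cvg_cst.
  have [L fl] := ff0 m Dm m0.
  apply: cvgM; first exact: cvg_cst.
  by apply: cvg_exprn; apply: cvgB;
    [exact: (@cvg_near0 (fun x => f x m) _ L)|exact: (@cvg_near0 h _ Lh)].
move=> x /andP[x0 xd]; rewrite ler_norml => /andP[h1 _]; exists x; first by rewrite x0.
have h2 : G x <= \int[mu]_(m in D) (mpos m * resid f h x m ^+ 2).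
  have b := bmeas_resid tr x0.
  apply: ble_int => //; try by bm.
  by move=> m Dm; rewrite ler_wpM2r ?sqr_ge0// mI_le_mpos.
by rewrite (le_trans h2)// -lerBlDl -lerN2 opprB.
Qed.

(* In the following [h' k >= 0]: for a single solution, [h = T^4] and [k = T']. *)
Hypothesis dissip : forall x : R, 0 < x -> 0 <= h' x * k x.

Lemma quad_der_le x : 0 < x -> - (2 * S x) - 2 * h' x * k x <= - (2 * S x).
Proof. by move=> /dissip; lra. Qed.

Lemma quad_nonincr x y : 0 < x -> x <= y -> G y <= G x.
Proof.
apply: (der_nonincr (fun z z0 => der_quad fD tr z0)) => z z0.
by have := quad_der_le z0; have := energy_ge0 D f h z; lra.
Qed.

Lemma energy_le x : 0 < x -> S x <= 8 * B ^+ 2.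
Proof.
move=> x0; have [mD _ _] := fD; have b := bmeas_resid tr x0.
rewrite (_ : 8 * B ^+ 2 = \int[mu]_(m in D) (4 * B ^+ 2)); last by rewrite int_cst//; lra.
apply: ble_int => //; [exact: fullset_fin|by bm|by bm|move=> m Dm].
have := resid_le tr x0 Dm; rewrite ler_norml => /andP[h1 h2]; nra.
Qed.

(** If G x = - g < 0, then G <= - g from x on, so S >= |G| >= g and G decreases at rate at least 2
    g; at the point [y] it would lie below - 8 B^2, the lower bound given by |G| <= S <= 8 B^2. *)
Lemma quad_ge0 x : 0 < x -> 0 <= G x.
Proof.
move=> x0; rewrite leNgt; apply/negP => Gx.
pose g := - G x; have g0 : 0 < g by rewrite oppr_gt0.
pose y := x + (8 * B ^+ 2) / (2 * g) + 1.
have q0 : 0 <= (8 * B ^+ 2) / (2 * g).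
  by apply: divr_ge0; [rewrite mulr_ge0 ?sqr_ge0|rewrite mulr_ge0 ?ltW].
have xy : x < y by rewrite /y; lra.
have [c /andP[xc cy] E] := MVT_pos (fun z z0 => der_quad fD tr z0) x0 xy.
have c0 := lt_trans x0 xc.
have h1 := quad_der_le c0; have h2 := quad_nonincr x0 (ltW xc); have h3 := quad_le fD tr c0.
have h4 := quad_le fD tr (lt_trans x0 xy); have h5 := energy_le (lt_trans x0 xy).
have h6 : g <= S c by move: h3; rewrite ler_norml => /andP[h3 _]; rewrite /g; lra.
have h7 : G y - G x <= - (2 * g) * (y - x).
  rewrite E ler_wpM2r ?subr_ge0 ?(ltW xy)//; lra.
have h8 : (2 * g) * (y - x) = 8 * B ^+ 2 + 2 * g by rewrite /y; field; exact: lt0r_neq0.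
by move: h4; rewrite ler_norml => /andP[h4 _]; lra.
Qed.

(** From G' <= - 2 S and G <= S. *)
Lemma quad_decay x y : 0 < x -> x <= y -> expR (2 * y) * G y <= expR (2 * x) * G x.
Proof.
apply: (@der_nonincr _ (fun x => expR (2 * x) * G x)
  (fun z => expR (2 * z) * 2 * G z + expR (2 * z) * (- (2 * S z) - 2 * h' z * k z))) => z z0.
  exact: derM (der_expRM 2 z) (der_quad fD tr z0).
have h1 := quad_der_le z0; have h3 := quad_le fD tr z0; have e0 := expR_gt0 (2 * z).
move: h3; rewrite ler_norml => /andP[_ h3]; nra.
Qed.

Lemma quad_exp (E0 : R) : (forall e d : R, 0 < e -> 0 < d -> exists2 x, 0 < x < d & G x <= E0 + e) ->
  forall x, 0 < x -> G x <= E0 * expR (- (2 * x)).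
Proof.
move=> bd x x0; suff : expR (2 * x) * G x <= E0.
  by move=> ?; rewrite expRN ler_pdivlMr ?expR_gt0// mulrC.
set A := expR (2 * x) * G x; have A0 : 0 <= A by rewrite mulr_ge0 ?expR_ge0// quad_ge0.
apply/ler_addgt0Pr => e e0.
have A1 : 0 < 4 * (A + 1) by rewrite mulr_gt0// ltr_wpDl.
have e2 : 0 < e / 2 by lra.
have d0 : 0 < Num.min x (e / (4 * (A + 1))) by rewrite lt_min x0 divr_gt0.
have [y /andP[y0 yd] Gy] := bd _ _ e2 d0.
move: yd; rewrite lt_min => /andP[yx]; rewrite ltr_pdivlMr// => yA.
have h1 : A <= expR (2 * y) * G y by apply: quad_decay => //; exact: ltW.
have h2 : 1 + - (2 * y) <= expR (- (2 * y)) by exact: expR_ge1Dx.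
have h3 : expR (- (2 * y)) * expR (2 * y) = 1 by rewrite -expRD addNr expR0.
have h4 : A * (1 + - (2 * y)) <= G y.
  apply: le_trans (ler_wpM2l A0 h2) _; rewrite mulrC.
  apply: le_trans (ler_wpM2l (expR_ge0 _) h1) _.
  by rewrite mulrA h3 mul1r.
nra.
Qed.

(** With l = e exp(-x) one has G x <= 2 l^2. The mean value theorem on [x, x + 1/2] gives a point c
    with S c <= 2 l^2, where Cauchy-Schwarz yields |k c| <= 29/25 l. From x to c the flux changes by
    at most G x / (4 l) + l (c - x) <= l, and 1 + 29/25 <= 9/4. *)
Lemma flux_decay (e : R) : 0 < e ->
  (forall x, 0 < x -> G x <= 2 * e ^+ 2 * expR (- (2 * x))) ->
  forall x, 0 < x -> `|k x| <= 9 / 4 * e * expR (- x).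
Proof.
move=> e0 Gexp x x0; pose l := e * expR (- x).
have l0 : 0 < l by rewrite mulr_gt0 ?expR_gt0.
have Gx : G x <= 2 * l ^+ 2.
  have E2 : expR (- (2 * x)) = expR (- x) ^+ 2 by rewrite expr2 -expRD; congr expR; lra.
  by rewrite (le_trans (Gexp x x0))// /l E2 -mulrA -exprMn.
have xy : x < x + 1 / 2 by lra.
have [c /andP[xc cy] E] := MVT_pos (fun z z0 => der_quad fD tr z0) x0 xy.
have c0 := lt_trans x0 xc.
have h1 := quad_der_le c0; have h2 := quad_ge0 (lt_trans x0 xy).
have Sc : S c <= 2 * l ^+ 2 by lra.
have kc2 : k c ^+ 2 <= (29 / 25 * l) ^+ 2 by have := flux_sqr fD tr c0; nra.
have kc : `|k c| <= 29 / 25 * l.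
  by rewrite ler_norml; apply/andP; split; nra.
have Gc : 0 <= G c by exact: quad_ge0.
have key (s : R) : s ^+ 2 = 1 -> s * (k c - k x) <= l.
  move=> s2.
  (* The term in G absorbs the part S / (2 l) of the bound on |k'|, and - l z absorbs the part l, so
     [P] is nonincreasing for both signs s. *)
  pose P z := s * k z + ((4 * l)^-1 * G z + (- l) * z).
  have P1 : P c <= P x.
    apply: (@der_nonincr _ P (fun z => s * - (\int[mu]_(m in D) resid f h z m)
        + ((4 * l)^-1 * (- (2 * S z) - 2 * h' z * k z) + - l))) => //; last exact: ltW.
    - move=> z z0; have d1 := der_flux fD tr z0; have d2 := der_quad fD tr z0.
      by eapply der_eq; first (by rewrite /P; der); ring.
    - move=> z z0; have h3 := quad_der_le z0.
      have := int_resid_le fD tr z0 l0; set J := \int[mu]_(m in D) _.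
      rewrite ler_norml => /andP[j1 j2].
      have h4 : (4 * l)^-1 * (- (2 * S z) - 2 * h' z * k z) <= - (S z / (2 * l)).
        rewrite (_ : - (S z / (2 * l)) = (4 * l)^-1 * (- (2 * S z))); last first.
          by field; exact: lt0r_neq0.
        by rewrite ler_wpM2l// invr_ge0; lra.
      nra.
  have h3 : (4 * l)^-1 * G x <= l / 2 by rewrite mulrC ler_pdivrMr; nra.
  have h4 : 0 <= (4 * l)^-1 * G c by rewrite mulr_ge0// invr_ge0; lra.
  by move: P1; rewrite /P; nra.
have k1 := key 1 (expr1n _ 2); have k2 := key (- 1) (etrans (sqrrN 1) (expr1n _ 2)).
rewrite ler_norml; move: kc; rewrite ler_norml => /andP[kc1 kc3].
by rewrite -mulrA -/l; apply/andP; split; lra.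
Qed.

End decay.

(** * Bounds for a single solution *)

Section single_solution.
Context {R : realType}.
Local Notation mu := (@lebesgue_measure R).
Context (D : set R) (fD : fullset D) (C Tb : R) (psib t : R -> R) (p : R -> R -> R).
Context (cl : classical D C Tb psib t p) (mpsib : measurable_fun (`]0, 1]%classic : set R) psib).
Local Notation k := (flux D p).

Lemma classical_C_ge0 : 0 <= C.
Proof. by have /andP[h1 h2] := cl_t_itv cl ltr01; exact: le_trans h1 h2. Qed.

Lemma flux_le x : 0 < x -> `|k x| <= 2 * C.
Proof.
move=> x0; have [mD _ _] := fD; have b := cl_bmeas cl x0; have b' := @bmeas_mI R.
have finD := fullset_fin fD.
have key m : D m -> `|mI m * p x m| <= C.
  move=> Dm; have /andP[h1 h2] := cl_p_itv cl x0 Dm.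
  by rewrite normrM -[leRHS]mul1r ler_pM// ?mI_le1// ger0_norm.
rewrite ler_norml -mulrN -!(int_cst fD); apply/andP; split.
  apply: ble_int => //; try by bm.
  by move=> m Dm; have := key m Dm; rewrite ler_norml => /andP[].
apply: ble_int => //; try by bm.
by move=> m Dm; have := key m Dm; rewrite ler_norml => /andP[].
Qed.

Lemma der_t (x : R) : 0 < x -> is_derive x 1 t (k x).
Proof.
move=> x0; have [mD hm _] := fD; have [d td] := cl_t cl.
have b' := @bmeas_mI R; have finD := fullset_fin fD.
pose M y := \int[mu]_(m in D) (mI m ^+ 2 * p y m).
have tM y : 0 < y -> t y = d - M y.
  move=> y0; rewrite td//; congr (_ - _); apply: eq_Rintegral => m; rewrite inE => Dm.
  by rewrite mIE//; exact: fullset_sub fD _ Dm.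
have C0 := classical_C_ge0.
have dM : is_derive x 1 M (\int[mu]_(m in D) (mI m * (t x ^+ 4 - p x m))).
  refine (@der_int _ _ fD (fun y m => mI m ^+ 2 * p y m) (fun y m => mI m * (t y ^+ 4 - p y m)) (x + 1) x (1 * (C ^+ 4 + C)) x0 _ _ _ _).
  - by rewrite ltrDl.
  - by move=> y y0; have b := cl_bmeas cl y0; bm.
  - move=> y m y0 Dm; have dp := cl_der_p cl y0 Dm; have [_ m0] := hm m Dm.
    eapply der_eq; first by der.
    by rewrite (mIE (fullset_sub fD Dm)) /=; field.
  - move=> y m y0 _ Dm; have /andP[h1 h2] := cl_p_itv cl y0 Dm; have /andP[h3 h4] := cl_t_itv cl y0.
    rewrite normrM ler_pM// ?mI_le1// (le_trans (ler_normB _ _))// lerD// ger0_norm ?exprn_ge0//.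
    by rewrite lerXn2r ?nnegrE.
have bp := cl_bmeas cl x0.
have E : \int[mu]_(m in D) (mI m * (t x ^+ 4 - p x m)) = - k x.
  have -> : (fun m => mI m * (t x ^+ 4 - p x m)) = (fun m => mI m * t x ^+ 4 - mI m * p x m).
    by apply/funext => m; rewrite mulrBr.
  by rewrite bintB//; [rewrite bintZr// int_mI// mul0r sub0r|by bm|by bm].
have near_t : \forall y \near x, d - M y = t y.
  by near=> y; rewrite tM//; near: y; exact: lt_nbhsr.
apply: near_eq_is_derive near_t _.
by eapply der_eq; first (by der); rewrite E; ring.
Unshelve. all: by end_near. Qed.

(** One constant for p <= C, t^4 <= C^4 and |4 t^3 k| <= 8 C^4. *)
Definition cl_bound : R := C + C ^+ 4 + 8 * C ^+ 4.

Lemma cl_transport : transport D p (fun x => t x ^+ 4) (fun x => 4 * t x ^+ 3 * k x) cl_bound.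
Proof.
have C0 := classical_C_ge0; have C4 : 0 <= C ^+ 4 by exact: exprn_ge0.
split.
- by move=> x; exact: cl_bmeas cl x.
- move=> x m x0 Dm; have /andP[h1 h2] := cl_p_itv cl x0 Dm.
  by rewrite ger0_norm// /cl_bound; lra.
- move=> x x0; have /andP[h3 h4] := cl_t_itv cl x0.
  have h : t x ^+ 4 <= C ^+ 4 by rewrite lerXn2r ?nnegrE.
  by rewrite ger0_norm ?exprn_ge0// /cl_bound; lra.
- move=> x x0; have /andP[h3 h4] := cl_t_itv cl x0.
  have h : t x ^+ 3 <= C ^+ 3 by rewrite lerXn2r ?nnegrE.
  have h' := flux_le x0; rewrite normrM ger0_norm ?mulr_ge0 ?exprn_ge0//.
  have : 4 * t x ^+ 3 * `|k x| <= 4 * C ^+ 3 * (2 * C).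
    by rewrite ler_pM ?mulr_ge0 ?exprn_ge0// ler_wpM2l.
  by rewrite /cl_bound; rewrite (exprS C 3); lra.
- by move=> x m x0 Dm; exact: cl_der_p cl x m x0 Dm.
- by move=> x x0; exact: derX (der_t x0).
Qed.

Lemma cl_dissip x : 0 < x -> 0 <= 4 * t x ^+ 3 * k x * k x.
Proof.
move=> x0; have /andP[h3 _] := cl_t_itv cl x0.
rewrite -mulrA -expr2; apply: mulr_ge0; last exact: sqr_ge0.
by apply: mulr_ge0 => //; exact: exprn_ge0.
Qed.

(** The inflow data are bounded only at good incoming directions, as limits of [p]; extended by 0
    they become [bmeas]. *)
Definition psi0 m := (psib \_ `]0, 1]%classic) m * \1_D m.

Lemma psi0E m : D m -> 0 < m -> psi0 m = psib m.
Proof.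
move=> Dm m0; have := fullset_sub fD Dm; rewrite /= in_itv/= => /andP[_ m1].
by rewrite /psi0 patchE indicE !mem_set ?mulr1//= in_itv/= m0.
Qed.

Lemma psib_itv m : D m -> 0 < m -> 0 <= psib m <= C.
Proof.
move=> Dm m0; have [L HL] := cl_p0 cl Dm m0.
have key (e : R) : 0 < e -> exists y, 0 <= y <= C /\ `|y - psib m| <= e.
  move=> e0; have L1 : 0 < `|L| + 1 by rewrite ltr_wpDl.
  have y0 : 0 < e / (`|L| + 1) by rewrite divr_gt0.
  exists (p (e / (`|L| + 1)) m); split; first exact: cl_p_itv cl _ _ y0 Dm.
  rewrite (le_trans (HL _ y0))// mulrA ler_pdivrMr// mulrC ler_wpM2l ?(ltW e0)//.
  by rewrite (le_trans (ler_norm L))// lerDl.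
apply/andP; split; apply/ler_addgt0Pr => e /key[y [/andP[h1 h2]]]; rewrite ler_norml => /andP[h3 h4]; lra.
Qed.

Lemma bmeas_psi0 : bmeas psi0.
Proof.
have [mD _ _] := fD; split.
  apply: measurable_funM; last exact: measurable_indic.
  by apply/(measurable_restrictT _ (measurable_itv _)).
exists C => m; rewrite /psi0 patchE indicE; have C0 := classical_C_ge0.
case: ifPn => [|_]; last by rewrite mul0r normr0.
rewrite inE /= in_itv/= => /andP[m0 _]; case: (boolP (m \in D)) => [|_]; last by rewrite mulr0 normr0.
by rewrite inE mulr1 => Dm; have /andP[h1 h2] := psib_itv Dm m0; rewrite ger0_norm.
Qed.

(** Twice the energy of the data, see [data_energyE]. *)
Definition boundary_quad : R := \int[mu]_(m in D) (mpos m * (psi0 m - Tb ^+ 4) ^+ 2).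

Lemma cl_t4_near0 : exists L : R, forall x : R, 0 < x -> `|t x ^+ 4 - Tb ^+ 4| <= L * x.
Proof.
have [L tL] := cl_t0 cl; pose M := `|C| + `|Tb|.
exists (4 * M ^+ 3 * L) => x x0; have /andP[h1 h2] := cl_t_itv cl x0.
have tM : `|t x| <= M by rewrite /M ger0_norm// (le_trans h2)// (le_trans (ler_norm _))// lerDl.
have TM : `|Tb| <= M by rewrite /M lerDr.
have -> : t x ^+ 4 - Tb ^+ 4 = (t x ^+ 3 + t x ^+ 2 * Tb + t x * Tb ^+ 2 + Tb ^+ 3) * (t x - Tb) by ring.
rewrite normrM (_ : 4 * M ^+ 3 * L * x = 4 * M ^+ 3 * (L * x)); last by ring.
rewrite ler_pM ?tL//.
have M0 : 0 <= M by exact: le_trans tM.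
have p1 : `|t x ^+ 3| <= M ^+ 3 by rewrite normrX lerXn2r ?nnegrE.
have p2 : `|t x ^+ 2 * Tb| <= M ^+ 3.
  by rewrite normrM normrX (exprSr M 2) ler_pM// ?exprn_ge0// lerXn2r ?nnegrE.
have p3 : `|t x * Tb ^+ 2| <= M ^+ 3.
  by rewrite normrM normrX (exprS M 2) ler_pM// ?exprn_ge0// lerXn2r ?nnegrE.
have p4 : `|Tb ^+ 3| <= M ^+ 3 by rewrite normrX lerXn2r ?nnegrE.
move: p1 p2 p3 p4; rewrite !ler_norml => /andP[? ?] /andP[? ?] /andP[? ?] /andP[? ?].
by apply/andP; split; lra.
Qed.

Lemma cl_quad_exp x : 0 < x ->
  quad D p (fun x => t x ^+ 4) x <= boundary_quad * expR (- (2 * x)).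
Proof.
apply: (quad_exp fD cl_transport cl_dissip) => e d e0 d0.
apply: (quad_near0 fD cl_transport bmeas_psi0) => //; last exact: cl_t4_near0.
by move=> m Dm m0; have [L HL] := cl_p0 cl Dm m0; exists L => y y0; rewrite psi0E// HL.
Qed.

Lemma cl_flux_decay (e : R) : 0 < e -> boundary_quad <= 2 * e ^+ 2 ->
  forall x, 0 < x -> `|k x| <= 9 / 4 * e * expR (- x).
Proof.
move=> e0 Ee; apply: (flux_decay fD cl_transport cl_dissip e0) => x x0.
by rewrite (le_trans (cl_quad_exp x0))// ler_wpM2r// expR_ge0.
Qed.

(** The flux bound is integrated from 0: s t + 9/4 e exp(-x) is nonincreasing for s = 1 and s =
    -1. *)
Lemma cl_t_close (e : R) : 0 < e -> boundary_quad <= 2 * e ^+ 2 ->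
  forall x, 0 < x -> `|t x - Tb| <= 9 / 4 * e.
Proof.
move=> e0 Ee x x0; have kd := cl_flux_decay e0 Ee; have [L tL] := cl_t0 cl.
have key (s : R) : s ^+ 2 = 1 -> s * (t x - Tb) <= 9 / 4 * e.
  move=> s2; pose P y := s * t y + 9 / 4 * e * expR ((-1) * y).
  have Pn y z : 0 < y -> y <= z -> P z <= P y.
    apply: (@der_nonincr _ P (fun y => s * k y + 9 / 4 * e * (expR ((-1) * y) * -1))) => w w0.
      have d1 := der_t w0; have d2 := der_expRM (-1) w.
      by eapply der_eq; first (by rewrite /P; der); ring.
    have := kd w w0; rewrite mulN1r ler_norml => /andP[h1 h2]; set E := expR _ in h1 h2 *.
    have : s = 1 \/ s = -1 by move: s2 => /eqP; rewrite sqrf_eq1 => /orP[] /eqP; tauto.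
    by case=> ->; lra.
  apply/ler_addgt0Pr => d d0; have L1 : 0 < `|L| + 1 by rewrite ltr_wpDl.
  pose y := Num.min x (d / (`|L| + 1)).
  have y0 : 0 < y by rewrite lt_min x0 divr_gt0.
  have yx : y <= x by rewrite ge_min lexx.
  have Ly : L * y <= d.
    have h : y <= d / (`|L| + 1) by rewrite ge_min lexx orbT.
    rewrite ler_pdivlMr// in h; apply: le_trans h; rewrite mulrC ler_wpM2l ?(ltW y0)//.
    by rewrite (le_trans (ler_norm L))// lerDl.
  have h1 := Pn y x y0 yx; have h2 := tL y y0.
  have h3 : expR ((-1) * y) <= 1 by rewrite -[leRHS]expR0 ler_expR; lra.
  have h4 := expR_ge0 ((-1) * x).
  have h5 : s * (t y - Tb) <= d.
    rewrite (le_trans _ Ly)// (le_trans _ h2)// (le_trans (ler_norm _))// normrM.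
    have : s = 1 \/ s = -1 by move: s2 => /eqP; rewrite sqrf_eq1 => /orP[] /eqP; tauto.
    by case=> ->; rewrite ?normrN normr1 mul1r.
  rewrite /P in h1; have h6 : 9 / 4 * e * expR ((-1) * y) <= 9 / 4 * e.
    by rewrite -[leRHS]mulr1 ler_wpM2l//; lra.
  have h7 : 0 <= 9 / 4 * e * expR ((-1) * x) by rewrite mulr_ge0//; lra.
  lra.
have k1 := key 1 (expr1n _ 2); have k2 := key (- 1) (etrans (sqrrN 1) (expr1n _ 2)).
rewrite ler_norml; apply/andP; split; lra.
Qed.

End single_solution.
(** * Comparison of two solutions *)

Section two_solutions.
Context {R : realType}.
Local Notation mu := (@lebesgue_measure R).
Context (D : set R) (fD : fullset D) (C1 C2 Tb : R) (psib t1 t2 : R -> R) (p1 p2 : R -> R -> R).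
Context (cl1 : classical D C1 Tb psib t1 p1) (cl2 : classical D C2 Tb psib t2 p2).
Context (mpsib : measurable_fun (`]0, 1]%classic : set R) psib).
Local Notation k1 := (flux D p1).
Local Notation k2 := (flux D p2).

Definition pd x m := p1 x m - p2 x m.
Definition hd x := t1 x ^+ 4 - t2 x ^+ 4.
Definition hd' x := 4 * t1 x ^+ 3 * k1 x - 4 * t2 x ^+ 3 * k2 x.
Local Notation Gd := (quad D pd hd).
Local Notation Sd := (energy D pd hd).

Lemma flux_pd x : 0 < x -> flux D pd x = k1 x - k2 x.
Proof.
move=> x0; have [mD _ _] := fD; have b1 := cl_bmeas cl1 x0; have b2 := cl_bmeas cl2 x0.
have b' := @bmeas_mI R; have finD := fullset_fin fD.
rewrite /flux -bintB//; [|by bm|by bm].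
by apply: eq_Rintegral => m _; rewrite /pd mulrBr.
Qed.

Lemma pd_transport : transport D pd hd hd' (cl_bound C1 + cl_bound C2).
Proof.
have tr1 := cl_transport fD cl1; have tr2 := cl_transport fD cl2.
split.
- by move=> x x0; apply: bmeasB; [exact: tr_bmeas tr1 x x0|exact: tr_bmeas tr2 x x0].
- move=> x m x0 Dm; rewrite (le_trans (ler_normB _ _))// lerD//.
    exact: tr_f tr1 x m x0 Dm.
  exact: tr_f tr2 x m x0 Dm.
- move=> x x0; rewrite (le_trans (ler_normB _ _))// lerD//.
    exact: tr_h tr1 x x0.
  exact: tr_h tr2 x x0.
- move=> x x0; rewrite (le_trans (ler_normB _ _))// lerD//.
    exact: tr_h' tr1 x x0.
  exact: tr_h' tr2 x x0.
- move=> x m x0 Dm; have d1 := tr_der_f tr1 x0 Dm; have d2 := tr_der_f tr2 x0 Dm.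
  by eapply der_eq; first (by rewrite /pd; der); rewrite /hd /pd; ring.
- move=> x x0; have d1 := tr_der_h tr1 x0; have d2 := tr_der_h tr2 x0.
  exact: derD d1 (derN d2).
Qed.

Lemma der_quad_d (x : R) : 0 < x ->
  is_derive x 1 Gd (- (2 * Sd x) - 2 * hd' x * (k1 x - k2 x)).
Proof. by move=> x0; have := der_quad fD pd_transport x0; rewrite flux_pd. Qed.

(** Both solutions have the same incoming data, so the boundary term of the difference is 0. *)
Lemma quad_d_near0 (e d : R) : 0 < e -> 0 < d -> exists2 x, 0 < x < d & Gd x <= e.
Proof.
move=> e0 d0.
have E : \int[mu]_(m in D) (mpos m * ((fun=> 0 : R) m - 0) ^+ 2) = 0.
  by apply: Rintegral0_eq => m _; rewrite subrr expr0n mulr0.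
have := @quad_near0 _ D fD _ _ _ _ pd_transport (fun=> 0) 0 e d (bmeas_cst 0).
rewrite E add0r; apply => //.
- move=> m Dm m0; have [L1 h1] := cl_p0 cl1 Dm m0; have [L2 h2] := cl_p0 cl2 Dm m0.
  exists (L1 + L2) => x x0; rewrite subr0 mulrDl /pd.
  rewrite (_ : p1 x m - p2 x m = (p1 x m - psib m) - (p2 x m - psib m)); last by ring.
  by rewrite (le_trans (ler_normB _ _))// lerD ?h1 ?h2.
- have [L1 h1] := cl_t4_near0 cl1; have [L2 h2] := cl_t4_near0 cl2.
  exists (L1 + L2) => x x0; rewrite subr0 mulrDl /hd.
  rewrite (_ : t1 x ^+ 4 - t2 x ^+ 4 = (t1 x ^+ 4 - Tb ^+ 4) - (t2 x ^+ 4 - Tb ^+ 4)); last by ring.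
  by rewrite (le_trans (ler_normB _ _))// lerD ?h1 ?h2.
Qed.

Lemma energy_d_le x : 0 < x ->
  Sd x <= 2 * (energy D p1 (fun x => t1 x ^+ 4) x + energy D p2 (fun x => t2 x ^+ 4) x).
Proof.
move=> x0; have [mD _ _] := fD; have finD := fullset_fin fD.
have b1 := bmeas_resid (cl_transport fD cl1) x0; have b2 := bmeas_resid (cl_transport fD cl2) x0.
have b3 := bmeas_resid pd_transport x0.
rewrite mulrDr /energy -!bintZl//; [|by bm|by bm].
rewrite -bintD//; [|by bm|by bm].
apply: ble_int => //; [by bm|by bm|move=> m _].
rewrite /resid /pd /hd; set a := p1 x m; set b := p2 x m.
have := sqr_ge0 (a - t1 x ^+ 4 + (b - t2 x ^+ 4)); lra.
Qed.

(** Replaces a decay statement for the difference: the sum of the two single functionals decays and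
    its slope is at most - 2 (S1 + S2), so the mean value theorem provides points far out where S1 +
    S2 is small. *)
Lemma energy_d_small (X e : R) : 0 < X -> 0 < e -> exists2 y, X < y & Sd y <= e.
Proof.
move=> X0 e0; have tr1 := cl_transport fD cl1; have tr2 := cl_transport fD cl2.
have dis1 := cl_dissip cl1; have dis2 := cl_dissip cl2.
set G1 := quad D p1 (fun x => t1 x ^+ 4); set G2 := quad D p2 (fun x => t2 x ^+ 4).
set S1 := energy D p1 (fun x => t1 x ^+ 4); set S2 := energy D p2 (fun x => t2 x ^+ 4).
pose E := boundary_quad D Tb psib.
have E0 : 0 <= E.
  have := quad_ge0 fD tr1 dis1 ltr01; have := cl_quad_exp fD cl1 mpsib ltr01.
  move=> h1 h2; have := le_trans h2 h1; rewrite pmulr_lge0// expR_gt0.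
(* Chosen so that e exp(2 Y) >= e (1 + 2 Y) >= 2 E. *)
pose Y := X + E / e; have Y0 : 0 < Y by rewrite ltr_wpDr// divr_ge0// ltW.
have YX : X <= Y by rewrite lerDl divr_ge0// ltW.
have Y1 : Y < Y + 1 by rewrite ltrDl.
have dG (z : R) : 0 < z -> is_derive z 1 (fun z => G1 z + G2 z)
    ((- (2 * S1 z) - 2 * (4 * t1 z ^+ 3 * k1 z) * k1 z) + (- (2 * S2 z) - 2 * (4 * t2 z ^+ 3 * k2 z) * k2 z)).
  by move=> z0; exact: derD (der_quad fD tr1 z0) (der_quad fD tr2 z0).
have [c /andP[Yc cY] Ec] := MVT_pos dG Y0 Y1.
have c0 := lt_trans Y0 Yc; exists c; first exact: le_lt_trans Yc.
apply: le_trans (energy_d_le c0) _; rewrite -/S1 -/S2.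
have h1 := dis1 c c0; have h2 := dis2 c c0.
have h3 := quad_ge0 fD tr1 dis1 (lt_trans Y0 Y1); have h4 := quad_ge0 fD tr2 dis2 (lt_trans Y0 Y1).
have h5 := cl_quad_exp fD cl1 mpsib Y0; have h6 := cl_quad_exp fD cl2 mpsib Y0.
rewrite -/E -/G1 -/G2 -/S1 -/S2 in h1 h2 h3 h4 h5 h6.
suff h7 : 2 * E * expR (- (2 * Y)) <= e by lra.
rewrite expRN ler_pdivrMr ?expR_gt0//.
have h8 : 1 + 2 * Y <= expR (2 * Y) by exact: expR_ge1Dx.
have h9 : e * Y = e * X + E by rewrite /Y; field; exact: lt0r_neq0.
have h10 := ler_wpM2l (ltW e0) h8.
have := mulr_gt0 e0 X0; lra.
Qed.

Lemma der_g (x : R) : 0 < x -> is_derive x 1 (fun y => t1 y - t2 y) (k1 x - k2 x).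
Proof. by move=> x0; exact: derD (der_t fD cl1 x0) (derN (der_t fD cl2 x0)). Qed.

Lemma g_near0 : exists2 L : R, 0 < L & forall x : R, 0 < x -> `|t1 x - t2 x| <= L * x.
Proof.
have [L1 h1] := cl_t0 cl1; have [L2 h2] := cl_t0 cl2.
exists (`|L1| + `|L2| + 1) => [|x x0]; first by rewrite ltr_wpDl// addr_ge0.
have -> : t1 x - t2 x = (t1 x - Tb) - (t2 x - Tb) by ring.
rewrite (le_trans (ler_normB _ _))//; have := h1 x x0; have := h2 x x0.
have := ler_norm L1; have := ler_norm L2; nra.
Qed.

Lemma cst_near0_eq0 (v : R -> R) (L : R) : 0 < L ->
  (forall x : R, 0 < x -> is_derive x 1 v 0) -> (forall x : R, 0 < x -> `|v x| <= L * x) ->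
  forall x, 0 < x -> v x = 0.
Proof.
move=> L0 dv vL x x0; apply/eqP; rewrite -normr_le0; apply/ler_addgt0Pr => e e0; rewrite add0r.
pose y := Num.min x (e / L); have y0 : 0 < y by rewrite lt_min x0 divr_gt0.
have yx : y <= x by rewrite ge_min lexx.
have Ly : L * y <= e.
  by rewrite mulrC -ler_pdivlMr// ge_min lexx orbT.
have -> : v x = v y.
  move: yx; rewrite le_eqVlt => /predU1P[->//|yx].
  by have [c _] := MVT_pos dv y0 yx; rewrite mul0r => /eqP; rewrite subr_eq0 => /eqP.
exact: le_trans (vL y y0) Ly.
Qed.

Hypothesis k12 : forall x, 0 < x -> k1 x = k2 x.

Lemma classical_t_eq x : 0 < x -> t1 x = t2 x.
Proof.
move=> x0; apply/eqP; rewrite -subr_eq0; apply/eqP.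
have [L L0 gL] := g_near0.
apply: (@cst_near0_eq0 (fun x => t1 x - t2 x) L) => // y y0.
by have := der_g y0; rewrite k12// subrr.
Qed.

(* The difference solves [m v' = - v], so [v exp (x / m)] is constant; it vanishes
   at 0 for [m > 0], and at infinity for [m < 0]. *)
Lemma classical_p_eq x m : 0 < x -> D m -> p1 x m = p2 x m.
Proof.
move=> x0 Dm; have [_ hm _] := fD; have [_ m0] := hm m Dm.
pose v y := pd y m * expR (m^-1 * y).
have dv (y : R) : 0 < y -> is_derive y 1 v 0.
  move=> y0; have d1 := tr_der_f pd_transport y0 Dm; have d2 := der_expRM m^-1 y.
  eapply der_eq; first exact: derM d1 d2.
  by rewrite /hd classical_t_eq// subrr sub0r; field.
have v0 : v x = 0.
  have [mpos|mneg] := ltP 0 m.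
    have [L1 h1] := cl_p0 cl1 Dm mpos; have [L2 h2] := cl_p0 cl2 Dm mpos.
    pose L := (`|L1| + `|L2| + 1) * expR (m^-1 * x).
    have vL y : 0 < y -> y <= x -> `|v y| <= L * y.
      move=> y0 yx; rewrite /v /L normrM (ger0_norm (expR_ge0 _)) [leRHS]mulrAC ler_pM ?expR_ge0//.
        rewrite /pd (_ : p1 y m - p2 y m = (p1 y m - psib m) - (p2 y m - psib m)); last by ring.
        rewrite (le_trans (ler_normB _ _))//; have := h1 y y0; have := h2 y y0.
        have := ler_norm L1; have := ler_norm L2; nra.
      by rewrite ler_expR ler_wpM2l// invr_ge0 ltW.
    have L0 : 0 < L by rewrite mulr_gt0 ?expR_gt0// ltr_wpDl// addr_ge0.
    apply/eqP; rewrite -normr_le0; apply/ler_addgt0Pr => e e0; rewrite add0r.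
    pose y := Num.min x (e / L); have y0 : 0 < y by rewrite lt_min x0 divr_gt0.
    have yx : y <= x by rewrite ge_min lexx.
    have Ly : L * y <= e by rewrite mulrC -ler_pdivlMr// ge_min lexx orbT.
    have -> : v x = v y.
      move: (yx); rewrite le_eqVlt => /predU1P[->//|yx'].
      by have [c _] := MVT_pos dv y0 yx'; rewrite mul0r => /eqP; rewrite subr_eq0 => /eqP.
    exact: le_trans (vL y y0 yx) Ly.
  have mlt : m < 0 by rewrite lt_neqAle m0.
  apply/eqP; rewrite -normr_le0; apply/ler_addgt0Pr => e e0; rewrite add0r.
  pose B := cl_bound C1 + cl_bound C2.
  have B0 : 0 <= B by apply: le_trans (tr_h pd_transport x0); exact: normr_ge0.
  pose y := x + (- m) * (B / e) + 1.
  have q0 : 0 <= (- m) * (B / e) by rewrite mulr_ge0 ?oppr_ge0 ?(ltW mlt)// divr_ge0// ltW.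
  have xy : x < y by rewrite /y; lra.
  have y0 := lt_trans x0 xy.
  have -> : v x = v y.
    by have [c _] := MVT_pos dv x0 xy; rewrite mul0r => /eqP; rewrite subr_eq0 => /eqP.
  rewrite /v normrM (ger0_norm (expR_ge0 _)).
  have h1 := tr_f pd_transport y0 Dm.
  apply: le_trans (ler_wpM2r (expR_ge0 _) h1) _.
  have -> : m^-1 * y = - ((- m)^-1 * y) by field.
  rewrite expRN ler_pdivrMr ?expR_gt0//.
  have h2 : 1 + (- m)^-1 * y <= expR ((- m)^-1 * y) by exact: expR_ge1Dx.
  apply: le_trans (ler_wpM2l (ltW e0) h2); rewrite -/B.
  have mm : 0 < (- m)^-1 by rewrite invr_gt0 oppr_gt0.
  have -> : e * (1 + (- m)^-1 * y) = e + B + e * (- m)^-1 * (x + 1).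
    by rewrite /y; field; rewrite m0 lt0r_neq0.
  have := mulr_gt0 (mulr_gt0 e0 mm) (ltr_wpDl (ltW x0) ltr01); lra.
move/eqP: v0; rewrite mulf_eq0 expR_eq0 orbF /pd subr_eq0 => /eqP.
by [].
Qed.

End two_solutions.
(** * Small data *)

(* The Lyapunov function is [Gd + b exp (-2x) (t1 - t2)^2]; with |k_i| <= a exp (-x)
   and |t_i - Tb| <= a, a = 9/64 Tb, its derivative is a negative quadratic form in
   [k1 - k2] and [exp (-x) (t1 - t2)]. *)
Lemma small_quadratic_form {R : realType} (u E g z k2x t1x t2x S : R) : 0 < u -> 0 < E -> E <= 1 -> 0 <= S ->
  `|k2x| <= 9 / 64 * u * E -> `|t1x - u| <= 9 / 64 * u -> `|t2x - u| <= 9 / 64 * u ->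
  t1x - t2x = g ->
  - (2 * S) - 2 * (4 * t1x ^+ 3 * (k2x + z) - 4 * t2x ^+ 3 * k2x) * z
   + 11 / 5 * u ^+ 3 * (2 * E ^+ 2 * g * z - 2 * E ^+ 2 * g ^+ 2)
  <= - (u ^+ 3 / 2) * z ^+ 2.
Proof.
(* Here r and s stand for exp(-x) |g| and |z|. With t1 and t2 between 55/64 Tb and 73/64 Tb,
   634/1000 is below (55/64)^3 and 3904/1000 above 3 (73/64)^2; 22/5 is twice the weight 11/5 of the
   correction. The first square is centred at the maximum in r. *)
have key (r s : R) : - (8 * (634 / 1000)) * s ^+ 2 + (8 * (3904 / 1000) * (9 / 64) + 22 / 5) * (r * s)
   - 22 / 5 * r ^+ 2 <= - (1 / 2) * s ^+ 2.
  by have := sqr_ge0 (r - 1099 / 1100 * s); have := sqr_ge0 s; lra.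
move=> u0 E0 E1 S0 hk h1 h2 gE.
have [a1 a2] : 55 / 64 * u <= t1x /\ t1x <= 73 / 64 * u by move: h1; rewrite ler_norml => /andP[]; lra.
have [b1 b2] : 55 / 64 * u <= t2x /\ t2x <= 73 / 64 * u by move: h2; rewrite ler_norml => /andP[]; lra.
pose Q := t1x ^+ 2 + t1x * t2x + t2x ^+ 2.
have u2 : 0 < u ^+ 2 by exact: exprn_gt0.
have u3 : 0 < u ^+ 3 by exact: exprn_gt0.
have q1 : t1x ^+ 2 <= (73 / 64 * u) ^+ 2 by clear -u0 a1 a2; rewrite lerXn2r ?nnegrE; lra.
have q2 : t2x ^+ 2 <= (73 / 64 * u) ^+ 2 by clear -u0 b1 b2; rewrite lerXn2r ?nnegrE; lra.
have q3 : t1x * t2x <= (73 / 64 * u) ^+ 2 by clear -u0 a1 a2 b1 b2; rewrite expr2 ler_pM; lra.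
have Q1 : 0 <= Q by rewrite /Q; clear -u0 a1 b1; rewrite addr_ge0 ?sqr_ge0// addr_ge0 ?sqr_ge0// mulr_ge0; lra.
have Q2 : Q <= 3904 / 1000 * u ^+ 2 by rewrite /Q; clear -q1 q2 q3 u2; lra.
have c1 : 634 / 1000 * u ^+ 3 <= t1x ^+ 3.
  have : (55 / 64 * u) ^+ 3 <= t1x ^+ 3 by clear -u0 a1; rewrite lerXn2r ?nnegrE; lra.
  by clear -u3; lra.
pose y := E * g; pose ay := `|y|; pose az := `|z|.
have ay2 : E ^+ 2 * g ^+ 2 = ay ^+ 2 by rewrite /ay real_normK ?num_real// /y exprMn.
have az2 : z ^+ 2 = az ^+ 2 by rewrite /az real_normK ?num_real.
have ay0 : 0 <= ay := normr_ge0 _; have az0 : 0 <= az := normr_ge0 _.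
have m1 : E ^+ 2 * g * z <= ay * az.
  have : E * (y * z) <= ay * az.
    apply: le_trans (ler_norm _) _; rewrite normrM (ger0_norm (ltW E0)) -[leRHS]mul1r ler_pM ?(ltW E0)//.
    by rewrite /ay /az -normrM lexx.
  by rewrite /y; apply: le_trans; rewrite le_eqVlt; apply/orP; left; apply/eqP; ring.
have m2 : - (4 * (t1x ^+ 3 - t2x ^+ 3) * k2x * z) <= 4 * (3904 / 1000 * u ^+ 2) * (9 / 64 * u) * (ay * az).
  have -> : - (4 * (t1x ^+ 3 - t2x ^+ 3) * k2x * z) = - (4 * Q * (k2x * (g * z))) by rewrite /Q -gE; ring.
  rewrite (le_trans (ler_norm _))// normrN normrM ger0_norm ?mulr_ge0//.
  rewrite -[leRHS]mulrA ler_pM ?mulr_ge0//; first by rewrite ler_wpM2l.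
  rewrite normrM normrM (le_trans (ler_wpM2r _ hk))// ?mulr_ge0//.
  rewrite le_eqVlt; apply/orP; left; apply/eqP.
  by rewrite /ay /y normrM (ger0_norm (ltW E0)) /az; ring.
have m3 : - (4 * t1x ^+ 3 * z ^+ 2) <= - (4 * (634 / 1000 * u ^+ 3) * az ^+ 2).
  by rewrite az2 lerN2 ler_wpM2r ?sqr_ge0// ler_wpM2l.
have keyu := ler_wpM2l (ltW u3) (key ay az).
have m1u := ler_wpM2l (ltW u3) m1.
have -> : - (2 * S) - 2 * (4 * t1x ^+ 3 * (k2x + z) - 4 * t2x ^+ 3 * k2x) * z
   + 11 / 5 * u ^+ 3 * (2 * E ^+ 2 * g * z - 2 * E ^+ 2 * g ^+ 2) =
   - (2 * S) + 2 * - (4 * t1x ^+ 3 * z ^+ 2) + 2 * - (4 * (t1x ^+ 3 - t2x ^+ 3) * k2x * z)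
   + 22 / 5 * (u ^+ 3 * (E ^+ 2 * g * z)) - 22 / 5 * (u ^+ 3 * (E ^+ 2 * g ^+ 2)) by ring.
rewrite ay2; clear -m1u m2 m3 keyu az2 S0.
set X1 := - (4 * t1x ^+ 3 * z ^+ 2) in m3 *.
set X2 := - (4 * _ * k2x * z) in m2 *.
set X3 := E ^+ 2 * g * z in m1u *.
rewrite az2; lra.
Qed.

Section small_data.
Context {R : realType}.
Local Notation mu := (@lebesgue_measure R).
Context (D : set R) (fD : fullset D) (C1 C2 Tb : R) (psib t1 t2 : R -> R) (p1 p2 : R -> R -> R).
Context (cl1 : classical D C1 Tb psib t1 p1) (cl2 : classical D C2 Tb psib t2 p2).
Context (mpsib : measurable_fun (`]0, 1]%classic : set R) psib).
Local Notation k1 := (flux D p1).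
Local Notation k2 := (flux D p2).
Local Notation Gd := (quad D (pd p1 p2) (hd t1 t2)).
Local Notation Sd := (energy D (pd p1 p2) (hd t1 t2)).

Lemma der_zero (v : R -> R) (x d : R) : 0 < x -> (forall y, 0 < y -> v y = 0) ->
  is_derive x 1 v d -> d = 0.
Proof.
move=> x0 v0 dv.
have E : \forall y \near x, v y = (fun=> 0 : R) y.
  by near=> y; rewrite v0//; near: y; exact: lt_nbhsr.
have := near_eq_is_derive E dv => d0; have := der_derive1 d0.
by rewrite (der_derive1 (der_cst 0 x)).
Unshelve. all: by end_near. Qed.

Lemma small_data_flux_eq : 0 <= Tb -> boundary_quad D Tb psib <= 2 * (Tb / 16) ^+ 2 ->
  forall x, 0 < x -> k1 x = k2 x.
Proof.
rewrite le_eqVlt => /predU1P[Tb0 bq x x0|u0 bq].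
  (* For Tb = 0 the energy of the data is 0, so the decay bound holds with every e > 0 and each flux
     vanishes. *)
  have key (C' : R) t' p' : classical D C' Tb psib t' p' -> flux D p' x = 0.
    move=> cl; apply/eqP; rewrite -normr_le0; apply/ler_addgt0Pr => e e0; rewrite add0r.
    have e4 : 0 < 4 / 9 * e by lra.
    have h : boundary_quad D Tb psib <= 2 * (4 / 9 * e) ^+ 2.
      by rewrite (le_trans bq)// -Tb0 mul0r expr0n mulr0 mulr_ge0// sqr_ge0.
    have := cl_flux_decay fD cl mpsib e4 h x0.
    have -> : 9 / 4 * (4 / 9 * e) = e by lra.
    move=> h1; rewrite (le_trans h1)// -[leRHS]mulr1 ler_wpM2l ?(ltW e0)//.
    by rewrite -[leRHS]expR0 ler_expR; lra.
  by rewrite (key _ _ _ cl1) (key _ _ _ cl2).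
have e0 : 0 < Tb / 16 by lra.
have kd2 := cl_flux_decay fD cl2 mpsib e0 bq.
have td1 := cl_t_close fD cl1 mpsib e0 bq; have td2 := cl_t_close fD cl2 mpsib e0 bq.
pose b := 11 / 5 * Tb ^+ 3; have b0 : 0 < b by rewrite /b mulr_gt0 ?exprn_gt0//; lra.
pose g x := t1 x - t2 x.
pose L x := Gd x + b * (expR (-2 * x) * g x ^+ 2).
pose L' x := (- (2 * Sd x) - 2 * hd' D t1 t2 p1 p2 x * (k1 x - k2 x))
  + b * (2 * expR (- x) ^+ 2 * g x * (k1 x - k2 x) - 2 * expR (- x) ^+ 2 * g x ^+ 2).
have E2 (x : R) : expR (-2 * x) = expR (- x) ^+ 2 by rewrite expr2 -expRD; congr expR; lra.
have dL (x : R) : 0 < x -> is_derive x 1 L (L' x).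
  move=> x0; have d1 := der_quad_d fD cl1 cl2 x0; have d2 := der_g fD cl1 cl2 x0.
  have d3 := der_expRM (-2) x.
  eapply der_eq; first by (rewrite /L; apply: derD d1 _; der).
  by rewrite /L' /g -E2 /GRing.scale /=; ring.
have L'le x : 0 < x -> L' x <= - (Tb ^+ 3 / 2) * (k1 x - k2 x) ^+ 2.
  move=> x0; rewrite /L' /hd'.
  have := @small_quadratic_form R Tb (expR (- x)) (g x) (k1 x - k2 x) (k2 x) (t1 x) (t2 x) (Sd x) u0 (expR_gt0 _).
  rewrite (addrC (k2 x)) subrK; apply.
  - by rewrite -[leRHS]expR0 ler_expR; lra.
  - exact: energy_ge0.
  - by have := kd2 x x0; rewrite (_ : 9 / 4 * (Tb / 16) = 9 / 64 * Tb)//; lra.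
  - by have := td1 x x0; rewrite (_ : 9 / 4 * (Tb / 16) = 9 / 64 * Tb)//; lra.
  - by have := td2 x x0; rewrite (_ : 9 / 4 * (Tb / 16) = 9 / 64 * Tb)//; lra.
  - by [].
have Tb3 : 0 < Tb ^+ 3 by exact: exprn_gt0.
have L'0 x : 0 < x -> L' x <= 0.
  by move=> /L'le h; rewrite (le_trans h)// mulNr oppr_le0 mulr_ge0 ?sqr_ge0//; lra.
have Ln := der_nonincr dL L'0.
have [Lg Lg0 gL] := g_near0 cl1 cl2.
(* Nonincreasing, at most small near 0 and at least - Sd at points far out, [L] vanishes
   identically; then so does its derivative, whose bound gives k1 = k2. *)
have L0 x : 0 < x -> L x = 0.
  move=> x0; apply/eqP; rewrite eq_le; apply/andP; split.
    apply/ler_addgt0Pr => e e0'; rewrite add0r.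
    have M0 : 0 < b * Lg ^+ 2 by rewrite mulr_gt0 ?exprn_gt0.
    have d0 : 0 < Num.min (Num.min x 1) (e / (2 * (b * Lg ^+ 2))).
      by rewrite !lt_min x0 ltr01 divr_gt0// mulr_gt0.
    have e2 : 0 < e / 2 by lra.
    have [y /andP[y0]] := quad_d_near0 fD cl1 cl2 e2 d0.
    rewrite !lt_min => /andP[/andP[yx y1]]; rewrite ltr_pdivlMr ?mulr_gt0// => yM Gy.
    apply: le_trans (Ln y x y0 (ltW yx)) _; rewrite /L.
    have h1 : g y ^+ 2 <= (Lg * y) ^+ 2.
      by rewrite -[g y ^+ 2]real_normK ?num_real// lerXn2r ?nnegrE// ?mulr_ge0 ?(ltW Lg0) ?(ltW y0)// gL.
    have h2 : expR (-2 * y) * g y ^+ 2 <= g y ^+ 2.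
      rewrite -[leRHS]mul1r ler_wpM2r ?sqr_ge0//.
      by rewrite -[leRHS]expR0 ler_expR; lra.
    have h3 : b * (expR (-2 * y) * g y ^+ 2) <= b * (Lg * y) ^+ 2.
      by rewrite ler_wpM2l ?(ltW b0)// (le_trans h2).
    have h4 : b * (Lg * y) ^+ 2 = b * Lg ^+ 2 * y ^+ 2 by ring.
    have h5 : b * Lg ^+ 2 * y ^+ 2 <= b * Lg ^+ 2 * y.
      by rewrite ler_wpM2l ?(ltW M0)// expr2 -[leRHS]mul1r ler_wpM2r ?(ltW y0)// ltW.
    lra.
  apply/ler_addgt0Pr => e e0'; have [y xy Sy] := energy_d_small fD cl1 cl2 mpsib x0 e0'.
  have y0 := lt_trans x0 xy; have h1 := Ln x y x0 (ltW xy).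
  have := quad_le fD (pd_transport fD cl1 cl2) y0; rewrite ler_norml => /andP[h2 _].
  have h3 : 0 <= b * (expR (-2 * y) * g y ^+ 2).
    by rewrite mulr_ge0 ?(ltW b0)// mulr_ge0 ?expR_ge0 ?sqr_ge0.
  have h4 : Gd y <= L y by rewrite /L lerDl.
  lra.
move=> x x0; have := L'le x x0; rewrite (der_zero x0 L0 (dL x x0)) mulNr oppr_ge0.
rewrite pmulr_rle0; last by lra.
by rewrite real_exprn_even_le0 ?num_real//= subr_eq0 => /eqP.
Qed.

End small_data.

(** * From equal fluxes to uniqueness, and small data *)

Section uniqueness_statements.
Context {R : realType}.
Local Notation mu := (@lebesgue_measure R).

Definition represented (Tb : R) (psib T : R -> R) (psi : R * R -> R) (D : set R)
    (C : R) (t : R -> R) (p : R -> R -> R) :=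
  [/\ classical D C Tb psib t p, {ae mu, forall x, 0 < x -> T x = t x} &
      forall m, D m -> {ae mu, forall x, 0 < x -> psi (x, m) = p x m}].

Lemma represented2 (Tb : R) (psib T1 T2 : R -> R) (psi1 psi2 : R * R -> R) :
  milne_solution Tb psib T1 psi1 -> milne_solution Tb psib T2 psi2 ->
  exists D C1 t1 p1 C2 t2 p2, [/\ fullset D,
    represented Tb psib T1 psi1 D C1 t1 p1 & represented Tb psib T2 psi2 D C2 t2 p2].
Proof.
move=> /classical_of_solution[C1 [t1 [p1 [D1 [fD1 cl1 T1t psi1p]]]]].
move=> /classical_of_solution[C2 [t2 [p2 [D2 [fD2 cl2 T2t psi2p]]]]].
have fD := fullsetI fD1 fD2.
exists (D1 `&` D2), C1, t1, p1, C2, t2, p2; split => //.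
  by split => //; [apply: cl1 => // m []|move=> m [Dm _]; exact: psi1p].
by split => //; [apply: cl2 => // m []|move=> m [_ Dm]; exact: psi2p].
Qed.

Lemma ae_equal_of_flux (Tb : R) (psib T1 T2 : R -> R) (psi1 psi2 : R * R -> R)
    (D : set R) (C1 C2 : R) (t1 t2 : R -> R) (p1 p2 : R -> R -> R) :
  milne_solution Tb psib T1 psi1 -> milne_solution Tb psib T2 psi2 -> fullset D ->
  represented Tb psib T1 psi1 D C1 t1 p1 -> represented Tb psib T2 psi2 D C2 t2 p2 ->
  (forall x, 0 < x -> flux D p1 x = flux D p2 x) -> ae_equal T1 psi1 T2 psi2.
Proof.
move=> sol1 sol2 fD [cl1 T1t psi1p] [cl2 T2t psi2p] k12.
have teq := classical_t_eq fD cl1 cl2 k12.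
have peq := classical_p_eq fD cl1 cl2 k12.
have TT : {ae lebesgue2 R, forall p, 0 < p.1 -> T1 p.1 = T2 p.1}.
  apply: (@ae_fst R (fun x => 0 < x -> T1 x = T2 x)).
  by apply: ae_sub (ae_and T1t T2t) => x [h1 h2] x0; rewrite h1// h2// teq.
pose A : set (R * R) := [set p | (psi1 \_ (strip R)) p = (psi2 \_ (strip R)) p].
have mA : measurable A.
  apply: measurable_eq_set; apply/(measurable_restrictT _ (@measurable_strip R)).
    by case: (milne_L2loc_psi sol1).
  by case: (milne_L2loc_psi sol2).
have aeA : {ae lebesgue2 R, forall p, A p}.
  apply: (@ae_prod_converse _ _ (measurableTypeR R) (measurableTypeR R) R mu mu A mA).
  have [mD _ D0] := fD.
  have aeD : {ae mu, forall m, `[(-1)%R, 1%R]%classic m -> D m}.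
    exists (`[(-1)%R, 1%R]%classic `\` D); split => //; first exact: measurableD.
    by move=> m /= /not_implyP.
  apply: ae_sub aeD => m aem; have [mI11|nI] := pselect (`[(-1)%R, 1%R]%classic m); last first.
    by apply: aeW => x; rewrite /A /= !patchE !memNset//; case.
  have Dm := aem mI11.
  apply: ae_sub (ae_and (psi1p m Dm) (psi2p m Dm)) => x [h1 h2].
  rewrite /A /= !patchE; case: ifPn => //; rewrite inE => -[/= x0 _].
  by move: x0; rewrite /Rpos /= in_itv/= andbT => x0; rewrite h1// h2// peq.
apply: ae_sub (ae_and TT aeA) => -[x m] [/= h1 h2] sp; split.
  by apply: h1; case: sp; rewrite /Rpos /= in_itv/= andbT.
by move: h2; rewrite /A /= !patchE !mem_set.
Qed.

Lemma data_energyE (Tb : R) (psib t : R -> R) (C : R) (D : set R) (p : R -> R -> R) :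
  fullset D -> classical D C Tb psib t p -> measurable_fun (`]0, 1]%classic : set R) psib ->
  data_energy Tb psib = (boundary_quad D Tb psib / 2)%:E.
Proof.
move=> fD cl mpsib; have [mD _ D0] := fD.
have b1 := bmeas_psi0 fD cl mpsib; have b2 := @bmeas_mpos R.
pose f m := mpos m * (psi0 D psib m - Tb ^+ 4) ^+ 2.
have bf : bmeas f by rewrite /f; bm.
have E : (\int[mu]_(m in `]0%R, 1%R]) (m * (psib m - Tb ^+ 4) ^+ 2)%:E =
          \int[mu]_(m in `]0%R, 1%R]) (f m)%:E)%E.
  apply: ae_eq_integral => //.
  - apply/measurable_EFinP; apply: measurable_funM => //.
    by apply: measurable_funX; apply: measurable_funB.
  - by apply/measurable_EFinP; apply: measurable_funTS; case: bf.
  - exists (`[(-1)%R, 1%R]%classic `\` D); split => //; first exact: measurableD.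
    move=> m /= /not_implyP[mI ne].
    have [m0 m1] : 0 < m /\ m <= 1 by move: mI; rewrite in_itv/= => /andP[].
    split; first by rewrite in_itv/= m1 andbT; lra.
    move=> Dm; apply: ne; rewrite /f /mpos indicE mem_set//= mulr1 mIE; last exact: fullset_sub fD _ Dm.
    by rewrite (psi0E fD)// mulr1.
rewrite /data_energy E.
have -> : (\int[mu]_(m in `]0%R, 1%R]) (f m)%:E)%E = (\int[mu]_(m in `]0%R, 1%R]) f m)%:E.
  by rewrite /Rintegral fineK//; apply: integrable_fin_num => //; exact: bmeas_integrable_oc.
rewrite -EFinM mulrC; congr (_ / _)%:E.
rewrite /boundary_quad (fullset_int_eq fD bf); apply/esym/Rintegral_sub0.
  by move=> m /=; rewrite !in_itv/= => /andP[m0 ->]; rewrite andbT; lra.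
by move=> m _ nm; rewrite /f /mpos indicE memNset// mulr0 mul0r.
Qed.

(** The threshold is (Tb / 16)^2: with e = Tb / 16 the closeness 9/4 e of t to Tb is the 9/64 Tb of
    the quadratic form. *)
Lemma small_data_unique (Tb : R) (psib T1 T2 : R -> R) (psi1 psi2 : R * R -> R) :
  milne_data Tb psib -> (data_energy Tb psib <= (Tb ^+ 2 / 256)%:E)%E ->
  milne_solution Tb psib T1 psi1 -> milne_solution Tb psib T2 psi2 ->
  ae_equal T1 psi1 T2 psi2.
Proof.
move=> [Tb0 mpsib _] hE sol1 sol2.
have [D [C1 [t1 [p1 [C2 [t2 [p2 [fD r1 r2]]]]]]]] := represented2 sol1 sol2.
apply: (ae_equal_of_flux sol1 sol2 fD r1 r2).
have [cl1 _ _] := r1; have [cl2 _ _] := r2.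
apply: (small_data_flux_eq fD cl1 cl2 mpsib Tb0).
by move: hE; rewrite (data_energyE fD cl1 mpsib) lee_fin; lra.
Qed.

(** The second entry of the minimum is at most Tb^2 / 288, because Tb / gamma <= 1, beta (alpha -
    beta) <= 1/4 and alpha < 1. *)
Lemma Cb_le (Tb alpha beta gamma : R) : 0 <= Tb -> 0 < beta -> beta < alpha -> alpha < 1 ->
  0 < gamma -> Tb <= gamma -> Cb Tb alpha beta gamma <= Tb ^+ 2 / 256.
Proof.
move=> Tb0 b0 ba a1 g0 Tg; rewrite /Cb ge_min; apply/orP; right.
have h1 : gamma^-1 * Tb <= 1 by rewrite mulrC ler_pdivrMr// mul1r.
have h1' : 0 <= gamma^-1 * Tb by rewrite mulr_ge0// invr_ge0 ltW.
have h2 : 0 <= beta * (alpha - beta) <= 1 / 4.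
  by apply/andP; split; [rewrite mulr_ge0//; lra|have := sqr_ge0 (alpha / 2 - beta); nra].
have h3 : 0 <= Num.sqrt alpha <= 1.
  by rewrite sqrtr_ge0/= -(@sqrtr1 R) ler_wsqrtr// ltW.
have [h2a h2b] := andP h2; have [h3a h3b] := andP h3.
have -> : 1 / 72 * gamma^-1 * Tb ^+ 3 * beta * (alpha - beta) * Num.sqrt alpha =
  1 / 72 * ((gamma^-1 * Tb) * ((beta * (alpha - beta)) * Num.sqrt alpha)) * Tb ^+ 2 by ring.
have h4 : (beta * (alpha - beta)) * Num.sqrt alpha <= 1 / 4 * 1 by rewrite ler_pM.
have h5 : (gamma^-1 * Tb) * ((beta * (alpha - beta)) * Num.sqrt alpha) <= 1 * (1 / 4 * 1).
  by rewrite ler_pM// mulr_ge0.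
have := sqr_ge0 Tb; nra.
Qed.

End uniqueness_statements.
(** * Uniqueness under the spectral assumption *)

Section positivity.
Context {R : realType}.
Local Notation mu := (@lebesgue_measure R).
Context (D : set R) (fD : fullset D) (C Tb : R) (psib t : R -> R) (p : R -> R -> R).
Context (cl : classical D C Tb psib t p).
Local Notation k := (flux D p).

(* [t'' = 2 t^4 - <p> <= 2 t^4 - <m^2 p> = 2 t^4 + t - d]. *)
Lemma der_flux_le (d x : R) : (forall x : R, 0 < x -> t x = d - \int[mu]_(m in D) (m ^+ 2 * p x m)) ->
  0 < x -> exists2 k', is_derive x 1 k k' & k' <= 2 * t x ^+ 4 + t x - d.
Proof.
move=> td x0; have [mD hm _] := fD; have finD := fullset_fin fD.
have b := cl_bmeas cl x0; have b' := @bmeas_mI R.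
exists (- (\int[mu]_(m in D) resid p (fun x => t x ^+ 4) x m)).
  by have := der_flux fD (cl_transport fD cl) x0.
have -> : \int[mu]_(m in D) resid p (fun x => t x ^+ 4) x m = \int[mu]_(m in D) p x m - 2 * t x ^+ 4.
  by rewrite /resid bintB//; [rewrite int_cst|by bm].
have h : \int[mu]_(m in D) (m ^+ 2 * p x m) <= \int[mu]_(m in D) p x m.
  have -> : \int[mu]_(m in D) (m ^+ 2 * p x m) = \int[mu]_(m in D) (mI m ^+ 2 * p x m).
    by apply: eq_Rintegral => m; rewrite inE => Dm; rewrite mIE//; exact: fullset_sub fD _ Dm.
  apply: ble_int => //; [by bm|move=> m Dm].
  have /andP[p0 _] := cl_p_itv cl x0 Dm.
  rewrite -[leRHS]mul1r ler_wpM2r//.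
  by have := mI_le1 (m : R); rewrite ler_norml => /andP[? ?]; nra.
rewrite (td x x0) opprB in h *; move: h.
set I1 := Rintegral _ _ _; set I2 := Rintegral _ _ _ => h; lra.
Qed.

(* Minimum principle for [t + h x], h -> 0: at an interior minimum below c the
   second derivative would be negative. *)
Lemma t_lower_bound : 0 < Tb -> exists2 c : R, 0 < c & forall x, 0 < x -> c <= t x.
Proof.
move=> Tb0; have [d td] := cl_t cl; have [L tL] := cl_t0 cl.
have [mD _ _] := fD; have finD := fullset_fin fD.
have L1 : 0 < `|L| + 1 by rewrite ltr_wpDl.
have tlow (e : R) : 0 < e -> exists2 y, 0 < y & forall x, 0 < x -> x <= y -> Tb - e <= t x.
  move=> e0; exists (e / (`|L| + 1)); first by rewrite divr_gt0.
  move=> x x0; rewrite ler_pdivlMr// => xe.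
  have := tL x x0; rewrite ler_norml => /andP[h _]; have := ler_norm L; nra.
have dTb : Tb <= d.
  apply/ler_addgt0Pr => e e0; have [y y0 Hy] := tlow e e0.
  have h1 := Hy y y0 (lexx y); have h2 := td y y0.
  have : 0 <= \int[mu]_(m in D) (m ^+ 2 * p y m).
    apply: Rintegral_ge0 => m Dm; rewrite mulr_ge0 ?sqr_ge0//.
    by have /andP[] := cl_p_itv cl y0 Dm.
  lra.
(* Below this level t'' <= 2 t^4 + t - d < 0, since 2 t^3 <= 1/32 and t < Tb / 4 <= d / 4. *)
pose c := Num.min 1 Tb / 4.
have c0 : 0 < c by rewrite divr_gt0// lt_min ltr01.
have c1 : c <= 1 / 4 by rewrite /c ler_pM2r// ge_min lexx.
have cTb : c <= Tb / 4 by rewrite /c ler_pM2r// ge_min lexx orbT.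
exists c => // x0 x00; rewrite leNgt; apply/negP => tx0.
(* The tilt is small enough that t + eta x stays below c at x0, while eta x exceeds c far out; so
   the minimum over [a, X] is interior. *)
pose eta := (c - t x0) / (2 * x0).
have eta0 : 0 < eta by rewrite divr_gt0 ?subr_gt0// mulr_gt0.
have etax : t x0 + eta * x0 < c.
  by rewrite (_ : eta * x0 = (c - t x0) / 2); [lra|rewrite /eta; field; exact: lt0r_neq0].
pose G x := t x + eta * x.
have dG (x : R) : 0 < x -> is_derive x 1 G (k x + eta).
  move=> xp; have dt := der_t fD cl xp.
  by eapply der_eq; first (by rewrite /G; der); ring.
have Tb2 : 0 < Tb / 2 by lra.
have [y1 y10 Hy1] := tlow _ Tb2.
pose a := Num.min y1 (x0 / 2); pose X := x0 + c / eta.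
have a0 : 0 < a by rewrite lt_min y10 divr_gt0.
have ax0 : a < x0 by rewrite gt_min; apply/orP; right; lra.
have x0X : x0 < X by rewrite ltrDl divr_gt0.
have aX : a < X by exact: lt_trans x0X.
have ta : c < t a.
  by have := Hy1 a a0; rewrite ge_min lexx => /(_ isT); lra.
have Ga : c < G a by rewrite /G; have := mulr_gt0 eta0 a0; lra.
have GX : c <= G X.
  have X0 : 0 < X by exact: lt_trans a0 aX.
  have /andP[tX _] := cl_t_itv cl X0.
  have : eta * X = eta * x0 + c by rewrite /X; field; exact: lt0r_neq0.
  rewrite /G; have := mulr_gt0 eta0 x00; lra.
have cG : {within `[a, X], continuous G}.
  apply: continuous_in_subspaceT => z; rewrite inE /= in_itv/= => /andP[az _].
  exact: der_cont (dG z (lt_le_trans a0 az)).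
have [y yaX ymin] := EVT_min (ltW aX) cG.
have Gy : G y <= G x0.
  by apply: ymin; rewrite in_itv/= (ltW ax0) ltW.
have Gyc : G y < c by apply: le_lt_trans Gy _.
have [ya yX] : a < y /\ y < X.
  move: yaX; rewrite in_itv/= !le_eqVlt => /andP[/predU1P[ay|->] /predU1P[yX|->]] //.
  - by move: Gyc; rewrite -ay; lra.
  - by move: Gyc; rewrite -ay; lra.
  - by move: Gyc; rewrite yX; lra.
have y0 := lt_trans a0 ya.
have ky : k y + eta = 0.
  have dd : forall x, x \in `]a, X[ -> derivable G x 1.
    move=> z; rewrite in_itv/= => /andP[az _].
    by case: (dG z (lt_trans a0 az)).
  have yI : y \in `]a, X[ by rewrite in_itv/= ya.
  have := @derive1_at_min _ G a X y (ltW aX) dd yI.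
  rewrite -(der_derive1 (dG y y0)) => H.
  have h := H (fun z zI => ymin z (subset_itv_oo_cc zI)).
  exact: der_derive1 h.
have C0 := classical_C_ge0 cl.
have tyc : t y < c by move: Gyc; rewrite /G; have := mulr_gt0 eta0 y0; clear -fD cl; lra.
(* By |t'| <= 2 C, t stays below c on [y, z[; there k decreases strictly from the critical value -
   eta, so [G] would decrease to the right of its minimum. *)
pose z := Num.min X (y + (c - t y) / (2 * C + 1)).
have C1 : 0 < 2 * C + 1 by clear -fD cl C0; lra.
have yz : y < z by rewrite lt_min yX ltrDl divr_gt0// subr_gt0.
have zX : z <= X by rewrite ge_min lexx.
have tlt w : y <= w -> w < z -> t w < c.
  rewrite le_eqVlt => /predU1P[<-//|yw] wz.
  have [xi /andP[yxi _] E] := MVT_pos (fun x x0 => der_t fD cl x0) y0 yw.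
  have h1 : k xi <= 2 * C.
    by rewrite (le_trans (ler_norm _))// (flux_le fD cl)// (lt_trans y0).
  have h2 : w < y + (c - t y) / (2 * C + 1) by rewrite (lt_le_trans wz)// ge_min lexx orbT.
  have h3 : (w - y) * (2 * C + 1) < c - t y by rewrite -ltr_pdivlMr// ltrBlDl.
  have h4 : t w - t y <= 2 * C * (w - y) by rewrite E ler_wpM2r// subr_ge0 ltW.
  by clear -fD cl h3 h4 yw; lra.
have kneg w : y <= w -> w < z -> exists2 k', is_derive w 1 k k' & k' < 0.
  move=> yw wz; have w0 := lt_le_trans y0 yw.
  have [k' dk hk] := der_flux_le td w0; exists k' => //.
  have tw := tlt w yw wz; have /andP[tw0 _] := cl_t_itv cl w0.
  have h1 : t w ^+ 4 <= (1 / 4) ^+ 3 * t w.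
    by clear -fD cl tw tw0 c1; rewrite exprSr ler_wpM2r// lerXn2r ?nnegrE//; lra.
  by clear -fD cl h1 tw tw0 c0 c1 cTb dTb hk; lra.
pose w := (y + z) / 2.
have yw : y < w by rewrite /w; clear -fD cl yz; lra.
have wz : w < z by rewrite /w; clear -fD cl yz; lra.
have [xi /andP[yxi xiw] E] := MVT_pos dG y0 yw.
have kxi : k xi < k y.
  have [||c' ] := @MVT _ k (fun v => derive1 k v) y xi yxi.
  - move=> v; rewrite in_itv/= => /andP[yv vxi].
    have [k' dk _] := kneg v (ltW yv) (lt_trans vxi (lt_trans xiw wz)).
    exact: (der_eq dk (esym (der_derive1 dk))).
  - apply: continuous_in_subspaceT => v; rewrite inE /= in_itv/= => /andP[yv vxi].
    have [k' dk _] := kneg v yv (le_lt_trans vxi (lt_trans xiw wz)).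
    exact: der_cont dk.
  - rewrite in_itv/= => /andP[yc' c'xi] Ek.
    have [k' dk kn] := kneg c' (ltW yc') (lt_trans c'xi (lt_trans xiw wz)).
    rewrite -subr_lt0 Ek (der_derive1 dk) nmulr_rlt0// subr_gt0//.
have Gw : G w < G y.
  by rewrite -subr_lt0 E nmulr_rlt0 ?subr_gt0//; clear -fD cl kxi ky; lra.
have : G y <= G w.
  by apply: ymin; rewrite in_itv/= (ltW (lt_trans ya yw)) (ltW (lt_le_trans wz zX)).
by rewrite leNgt Gw.
Qed.

End positivity.

(** * The spectral inequality in terms of the temperature *)

Section spectral_weight.
Context {R : realType}.
Local Notation mu := (@lebesgue_measure R).

Lemma sqr_weight (y : R) : 0 <= y -> (2 * y `^ (3 / 2)) ^+ 2 = 4 * y ^+ 3.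
Proof.
move=> y0; rewrite exprMn -[(y `^ _) ^+ 2]powR_mulrn ?powR_ge0// -powRrM.
by rewrite (_ : 3 / 2 * 2%:R = 3%:R); [rewrite powR_mulrn//; lra|lra].
Qed.

Lemma sqr_derive_weight (T : R -> R) (x k : R) : 0 < T x -> is_derive x 1 T k ->
  derive1 (fun x => 2 * T x `^ (3 / 2)) x ^+ 2 = 9 * T x * k ^+ 2.
Proof.
move=> Tx dT; have d1 := @is_derive1_powR R (3 / 2) (T x) Tx.
have d2 := der_comp d1 dT; have d3 := derM (der_cst 2 x) d2.
rewrite (der_derive1 d3) mul0r add0r (_ : 3 / 2 - 1 = 2^-1); last by lra.
rewrite powR12_sqrt ?ltW// !exprMn sqr_sqrtr ?ltW//; lra.
Qed.

(** With w = 2 T^(3/2) one has w^2 = 4 T^3 and, where T > 0, w'^2 = 9 T T'^2. Positivity is demanded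
    only on a set [X] off which f vanishes: the half-line if Tb > 0, a short interval at 0 for a
    cold wall. *)
Lemma spectral_estimate (T dT : R -> R) : spectral_assumption T ->
  (forall x : R, 0 < x -> is_derive x 1 T (dT x)) ->
  exists beta0 M : R, [/\ 0 < beta0, 0 < M < 1 &
  forall (X : set R) (f df : R -> R), X `<=` Rpos R -> (forall x, X x -> 0 < T x) ->
    (forall x : R, 0 < x -> is_derive x 1 f (df x)) ->
    (forall x : R, 0 < x -> {for x, continuous df}) -> f x @[x --> 0^'+] --> 0 ->
    (forall x, 0 < x -> ~ X x -> f x = 0 /\ df x = 0) ->
    (4%:E * \int[mu]_(x in X) (expR (2 * beta0 * x) * (9 * T x * dT x ^+ 2) * f x ^+ 2)%:E
     <= M%:E * \int[mu]_(x in X) (expR (2 * beta0 * x) * (4 * T x ^+ 3) * df x ^+ 2)%:E)%E].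
Proof.
move=> [_ _ [b [M [b0 M01 H]]]] hT; exists b, M; split => // X f df XR Tpos hf cf f0 fX.
have dfE x : 0 < x -> derive1 f x = df x by move=> x0; exact: der_derive1 (hf x x0).
have C1f : C1_on (Rpos R) f.
  move=> x; rewrite /Rpos /= in_itv/= andbT => x0; split; first by have [] := hf x x0.
  change (derive1 f y @[y --> x] --> derive1 f x); rewrite dfE//.
  have := cf x x0; apply: cvg_trans; apply: near_eq_cvg.
  by near=> y; rewrite dfE//; near: y; exact: lt_nbhsr.
have {H} := H f C1f f0.
have sub (F : R -> \bar R) : (forall x, 0 < x -> ~ X x -> F x = 0%E) ->
    (\int[mu]_(x in Rpos R) F x = \int[mu]_(x in X) F x)%E.
  move=> F0; rewrite [LHS]integral_mkcond [RHS]integral_mkcond.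
  apply: eq_integral => x _; rewrite !patchE.
  case: (boolP (x \in X)) => [|]; rewrite ?inE ?notin_setE => xX.
    by rewrite mem_set//; exact: XR.
  case: ifPn => //; rewrite inE /Rpos /= in_itv/= andbT => x0; exact: F0.
rewrite sub; last by move=> x x0 /(fX x x0)[-> _]; rewrite expr0n mulr0.
rewrite [X in (_ <= _ * X)%E -> _]sub; last first.
  by move=> x x0 /(fX x x0)[_ d0]; rewrite dfE// d0 expr0n mulr0.
have E1 : (\int[mu]_(x in X) (expR (2 * b * x) *
     derive1 (fun x => 2 * T x `^ (3 / 2)) x ^+ 2 * f x ^+ 2)%:E =
   \int[mu]_(x in X) (expR (2 * b * x) * (9 * T x * dT x ^+ 2) * f x ^+ 2)%:E)%E.
  apply: eq_integral => x; rewrite inE => xX; have := XR x xX.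
  rewrite /Rpos /= in_itv/= andbT => x0.
  by rewrite (sqr_derive_weight (Tpos x xX) (hT x x0)).
have E2 : (\int[mu]_(x in X) (expR (2 * b * x) *
     (2 * T x `^ (3 / 2)) ^+ 2 * derive1 f x ^+ 2)%:E =
   \int[mu]_(x in X) (expR (2 * b * x) * (4 * T x ^+ 3) * df x ^+ 2)%:E)%E.
  apply: eq_integral => x; rewrite inE => xX; have := XR x xX.
  rewrite /Rpos /= in_itv/= andbT => x0.
  by rewrite sqr_weight ?dfE// ltW// Tpos.
by rewrite E1 E2.
Unshelve. all: by end_near. Qed.

End spectral_weight.
Section half_line_integrals.
Context {R : realType}.
Local Notation mu := (@lebesgue_measure R).

Lemma prim_le_int (v : R -> R) (x : R) : bmeas v -> (forall x, 0 < x -> 0 <= v x) ->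
  ((prim v 0 x)%:E <= \int[mu]_(x in Rpos R) (v x)%:E)%E.
Proof.
move=> bv v0; rewrite /prim /Rintegral fineK; last first.
  by apply: integrable_fin_num => //; exact: bmeas_integrable_oc.
apply: ge0_subset_integral => //.
- exact: measurable_Rpos.
- by apply/measurable_EFinP; apply: measurable_funTS; case: bv.
- by move=> y; rewrite /Rpos /= in_itv/= andbT lee_fin => /v0.
- by move=> y; rewrite /Rpos /= !in_itv/= andbT => /andP[].
Qed.

Lemma int_le_prim (v : R -> R) (c : R) : bmeas v -> (forall x, 0 < x -> 0 <= v x) ->
  (forall x, 0 < x -> prim v 0 x <= c) -> (\int[mu]_(x in Rpos R) (v x)%:E <= c%:E)%E.
Proof.
move=> bv v0 vc; pose F (n : nat) : set R := `]0, n.+1%:R]%classic.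
have FE : \bigcup_n F n = Rpos R.
  apply/seteqP; split => y; rewrite /Rpos /= in_itv/= andbT.
    by move=> [n _]; rewrite /F /= in_itv/= => /andP[].
  move=> y0; exists (Num.trunc y) => //; rewrite /F /= in_itv/= y0/= ltW//.
  by have /andP[] := trunc_itv (ltW y0).
have h : (\int[mu]_(x in F n) (v x)%:E @[n --> \oo] --> \int[mu]_(x in \bigcup_n F n) (v x)%:E)%E.
  apply: ge0_nondecreasing_set_cvg_integral => //.
  - move=> m n mn; apply/subsetPset => y; rewrite /F /= !in_itv/= => /andP[->/= h].
    by rewrite (le_trans h)// ler_nat.
  - by move=> n; exact: measurable_itv.
  - by move=> n; apply/measurable_EFinP; apply: measurable_funTS; case: bv.
  - by move=> n y; rewrite /F /= in_itv/= => /andP[/v0].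
rewrite -FE; apply: (@cvge_le _ _ _ _ _ _ _ _ h).
apply: nearW => n; rewrite -[leLHS]fineK; first by rewrite lee_fin vc.
by apply: integrable_fin_num; [exact: measurable_itv|exact: bmeas_integrable_oc].
Qed.

End half_line_integrals.
(** Here u = t1, v = t2, k = k2 and y = k1 - k2. Cubes and sums of squares of u are compared with
    those of v up to d, and the mixed term is split by (N a - 3 b)^2 >= 0 with a = v |y| and b = |k|
    |u - v|. For d = 0 the coefficients are 8 - 4 N and 36 / N. *)
Lemma spectral_quadratic_form {R : realType} (d N u v k y : R) : 0 < d < 1 -> 0 < N -> 0 < v -> `|u - v| <= d * v ->
  - (2 * (4 * u ^+ 3 * (k + y) - 4 * v ^+ 3 * k) * y) <=
  - (8 * (1 - d) ^+ 3 - 4 * (3 + 3 * d + d ^+ 2) / 3 * N) * (v ^+ 3 * y ^+ 2)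
  + 12 * (3 + 3 * d + d ^+ 2) / N * (v * k ^+ 2 * (u - v) ^+ 2).
Proof.
move=> /andP[d0 d1] N0 v0 uv; have /andP[h1 h2] : (1 - d) * v <= u <= (1 + d) * v.
  by move: uv; rewrite ler_norml => /andP[]; lra.
have u0 : 0 <= u by rewrite (le_trans _ h1)// mulr_ge0 ?ltW// subr_gt0.
have u3 : (1 - d) ^+ 3 * v ^+ 3 <= u ^+ 3.
  by rewrite -exprMn lerXn2r ?nnegrE// mulr_ge0 ?ltW// subr_gt0.
pose q := 3 + 3 * d + d ^+ 2.
have q0 : 0 < q by rewrite /q; have := sqr_ge0 d; lra.
have e1 : u ^+ 3 - v ^+ 3 = (u - v) * (u ^+ 2 + u * v + v ^+ 2) by ring.
pose s := u ^+ 2 + u * v + v ^+ 2.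
have s0 : 0 <= s <= q * v ^+ 2.
  have a1 : u ^+ 2 <= ((1 + d) * v) ^+ 2 by rewrite lerXn2r ?nnegrE// mulr_ge0 ?ltW// addr_gt0.
  have a2 : u * v <= (1 + d) * v * v by rewrite ler_wpM2r// ltW.
  have a3 : 0 <= u * v by rewrite mulr_ge0// ltW.
  apply/andP; split; first by rewrite /s !addr_ge0// sqr_ge0.
  rewrite /s /q (le_trans (lerD (lerD a1 a2) (lexx _)))//.
  by rewrite le_eqVlt; apply/orP; left; apply/eqP; ring.
have [y1 y2] : `|(u - v) * k * y| * s <= `|(u - v) * k * y| * (q * v ^+ 2) /\
   `|(u - v) * k * y| * (q * v ^+ 2) <=
     q * (N / 6 * (v ^+ 3 * y ^+ 2) + 3 / 2 / N * (v * k ^+ 2 * (u - v) ^+ 2)).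
  split; first by rewrite ler_wpM2l//; case/andP: s0.
  rewrite mulrCA ler_pM2l//.
  have -> : `|(u - v) * k * y| * v ^+ 2 = (v * `|y|) * (`|k| * `|u - v|) * v by rewrite !normrM; ring.
  have -> : N / 6 * (v ^+ 3 * y ^+ 2) + 3 / 2 / N * (v * k ^+ 2 * (u - v) ^+ 2) =
     (N / 6 * (v * `|y|) ^+ 2 + 3 / 2 / N * (`|k| * `|u - v|) ^+ 2) * v.
    rewrite !exprMn !real_normK ?num_real//; ring.
  rewrite ler_pM2r//; set A := v * _; set B := _ * `|_|.
  rewrite -subr_ge0 (_ : _ - _ = (N * A - 3 * B) ^+ 2 / (6 * N)); last by field; lra.
  by rewrite divr_ge0 ?sqr_ge0// mulr_ge0 ?ltW.
have y3 : - ((u - v) * k * y * s) <= `|(u - v) * k * y| * s.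
  by rewrite -mulNr ler_wpM2r//; [case/andP: s0|rewrite -normrN ler_norm].
have y4 : - (u ^+ 3 * y ^+ 2) <= - ((1 - d) ^+ 3 * v ^+ 3 * y ^+ 2) by rewrite lerN2 ler_wpM2r// sqr_ge0.
have -> : - (2 * (4 * u ^+ 3 * (k + y) - 4 * v ^+ 3 * k) * y) =
   8 * - (u ^+ 3 * y ^+ 2) + 8 * - ((u - v) * k * y * s).
  rewrite (_ : (u - v) * k * y * s = (u ^+ 3 - v ^+ 3) * k * y); first by ring.
  by rewrite e1; rewrite /s; ring.
have -> : - (8 * (1 - d) ^+ 3 - 4 * (3 + 3 * d + d ^+ 2) / 3 * N) * (v ^+ 3 * y ^+ 2)
  + 12 * (3 + 3 * d + d ^+ 2) / N * (v * k ^+ 2 * (u - v) ^+ 2) =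
  8 * - ((1 - d) ^+ 3 * v ^+ 3 * y ^+ 2) +
  8 * (q * (N / 6 * (v ^+ 3 * y ^+ 2) + 3 / 2 / N * (v * k ^+ 2 * (u - v) ^+ 2))).
  by rewrite /q; field; lra.
by rewrite lerD// ler_pM2l ?(le_trans y3) ?(le_trans y1)//; lra.
Qed.

Section spectral_uniqueness.
Context {R : realType}.
Local Notation mu := (@lebesgue_measure R).
Context (D : set R) (fD : fullset D) (C1 C2 Tb : R) (psib t1 t2 : R -> R) (p1 p2 : R -> R -> R).
Context (cl1 : classical D C1 Tb psib t1 p1) (cl2 : classical D C2 Tb psib t2 p2).
Context (mpsib : measurable_fun (`]0, 1]%classic : set R) psib).
Local Notation k1 := (flux D p1).
Local Notation k2 := (flux D p2).
Local Notation Gd := (quad D (pd p1 p2) (hd t1 t2)).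
Local Notation Sd := (energy D (pd p1 p2) (hd t1 t2)).
Let g x := t1 x - t2 x.
Let z x := k1 x - k2 x.
Context (b M : R) (b0 : 0 < b) (M01 : 0 < M < 1).
Context (t2_gt0 : forall x, 0 < x -> 0 < t2 x).
Context (spec : forall f df : R -> R, (forall x : R, 0 < x -> is_derive x 1 f (df x)) ->
    (forall x : R, 0 < x -> {for x, continuous df}) -> f x @[x --> 0^'+] --> 0 ->
    (4%:E * \int[mu]_(x in Rpos R) (expR (2 * b * x) * (9 * t2 x * k2 x ^+ 2) * f x ^+ 2)%:E
     <= M%:E * \int[mu]_(x in Rpos R) (expR (2 * b * x) * (4 * t2 x ^+ 3) * df x ^+ 2)%:E)%E).
(** The arithmetic mean of 1 and M satisfies M <= N^2, so it can serve as Young's parameter. The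
    tolerance d, a tenth of 1 - N, leaves the coefficients in strict balance. *)
Let N := (1 + M) / 2.
Let d := (1 - N) / 10.
Context (small : forall x, 0 < x -> `|g x| <= d * t2 x).

(** The dissipated and the bad quantity of [spectral_quadratic_form]; their primitives are [A] and
    [B]. *)
Let vA x := t2 x ^+ 3 * z x ^+ 2.
Let vB x := t2 x * k2 x ^+ 2 * g x ^+ 2.

Let cont_k2 x : 0 < x -> {for x, continuous k2}.
Proof. by move=> x0; have := der_flux fD (cl_transport fD cl2) x0; exact: der_cont. Qed.

Let cont_z x : 0 < x -> {for x, continuous z}.
Proof.
move=> x0; apply: cvgB; last exact: cont_k2.
by have := der_flux fD (cl_transport fD cl1) x0; exact: der_cont.
Qed.

Let cont_t2 x : 0 < x -> {for x, continuous t2}.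
Proof. by move=> x0; exact: der_cont (der_t fD cl2 x0). Qed.

Let cont_g x : 0 < x -> {for x, continuous g}.
Proof. by move=> x0; exact: der_cont (der_g fD cl1 cl2 x0). Qed.

Let cont_vA x : 0 < x -> {for x, continuous vA}.
Proof.
move=> x0; apply: cvgM; apply: cvg_exprn; [exact: cont_t2|exact: cont_z].
Qed.

Let cont_vB x : 0 < x -> {for x, continuous vB}.
Proof.
move=> x0; apply: cvgM; last by apply: cvg_exprn; exact: cont_g.
by apply: cvgM; [exact: cont_t2|apply: cvg_exprn; exact: cont_k2].
Qed.

Let K := 2 * C1 + 2 * C2.

Let z_le x : 0 < x -> `|z x| <= K.
Proof.
move=> x0; rewrite (le_trans (ler_normB _ _))// lerD//.
  by have := flux_le fD cl1 x0.
by have := flux_le fD cl2 x0.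
Qed.

Let C2_ge0 : 0 <= C2. Proof. exact: classical_C_ge0 cl2. Qed.

Let t2_le x : 0 < x -> `|t2 x| <= C2.
Proof. by move=> x0; have /andP[h1 h2] := cl_t_itv cl2 x0; rewrite ger0_norm. Qed.

Let vA_le x : 0 < x -> `|vA x| <= C2 ^+ 3 * K ^+ 2.
Proof.
move=> x0; rewrite normrM !normrX ler_pM ?exprn_ge0//.
  by rewrite lerXn2r ?nnegrE// t2_le.
by rewrite lerXn2r ?nnegrE ?z_le// (le_trans _ (z_le x0)).
Qed.

Let vB_le x : 0 < x -> `|vB x| <= C2 * (2 * C2) ^+ 2 * (C1 + C2) ^+ 2.
Proof.
move=> x0; have h : `|g x| <= C1 + C2.
  rewrite (le_trans (ler_normB _ _))// lerD ?t2_le//.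
  by have /andP[h1 h2] := cl_t_itv cl1 x0; rewrite ger0_norm.
have h1 : `|k2 x| ^+ 2 <= (2 * C2) ^+ 2.
  by rewrite lerXn2r ?nnegrE ?mulr_ge0//; have := flux_le fD cl2 x0.
have h2 : `|g x| ^+ 2 <= (C1 + C2) ^+ 2 by rewrite lerXn2r ?nnegrE// (le_trans _ h).
rewrite 2!normrM !normrX; apply: ler_pM => //; rewrite ?mulr_ge0 ?exprn_ge0//.
by apply: ler_pM; rewrite ?exprn_ge0 ?t2_le.
Qed.

Let vA_ge0 x : 0 < x -> 0 <= vA x.
Proof. by move=> x0; rewrite mulr_ge0 ?sqr_ge0// exprn_ge0// ltW// t2_gt0. Qed.

Let vB_ge0 x : 0 < x -> 0 <= vB x.
Proof. by move=> x0; apply: mulr_ge0; [apply: mulr_ge0|]; rewrite ?sqr_ge0// ltW// t2_gt0. Qed.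

Let A := prim (vA \_ (Rpos R)) 0.
Let B := prim (vB \_ (Rpos R)) 0.

Let dA (x : R) : 0 < x -> is_derive x 1 A (vA x).
Proof. by apply: der_prim_restr; [exact: cont_vA|exact: vA_le]. Qed.

Let dB (x : R) : 0 < x -> is_derive x 1 B (vB x).
Proof. by apply: der_prim_restr; [exact: cont_vB|exact: vB_le]. Qed.

Let bA : bmeas (vA \_ (Rpos R)). Proof. by apply: bmeas_restr; [exact: cont_vA|exact: vA_le]. Qed.
Let bB : bmeas (vB \_ (Rpos R)). Proof. by apply: bmeas_restr; [exact: cont_vB|exact: vB_le]. Qed.

(* The test function is [f x = int_0^x exp (- b s) |z s| ds]; since [g' = z] and
   [g 0 = 0], one has [|g| <= exp (b x) f]. *)
Lemma spectral_flux_bound c : (forall x, 0 < x -> A x <= c) -> forall x, 0 < x -> 9 * B x <= M * c.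
Proof.
move=> Ac x x0.
pose v s := expR (- b * s) * `|z s|; pose f := prim (v \_ (Rpos R)) 0.
have cv y : 0 < y -> {for y, continuous v}.
  move=> y0; apply: cvgM; first by exact: der_cont (der_expRM (- b) y).
  by apply: cvg_norm; exact: cont_z.
have e1 y : 0 < y -> expR (- b * y) <= 1.
  by move=> y0; rewrite -expR0 ler_expR mulNr oppr_le0 mulr_ge0 ?ltW.
have vK y : 0 < y -> `|v y| <= K.
  move=> y0; rewrite normrM normr_id (ger0_norm (expR_ge0 _)) -[leRHS]mul1r.
  by rewrite ler_pM ?expR_ge0 ?e1 ?z_le.
have bv := bmeas_restr cv vK.
have df (y : R) : 0 < y -> is_derive y 1 f (v y) by move=> y0; exact: der_prim_restr cv vK y0.
have vR t : 0 < t -> `|(v \_ (Rpos R)) t| <= K by move=> t0; rewrite restr_pos ?vK.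
have fK y : 0 < y -> `|f y| <= K * y.
  by move=> y0; have := prim_lip bv vR (lexx 0) (ltW y0); rewrite prim0 !subr0.
have f0 : f y @[y --> 0^'+] --> 0.
  apply: norm_cvg0; apply: (@squeeze_cvgr _ _ _ _ (fun=> 0) (fun y => K * y)).
  - by near=> y; rewrite normr_ge0 fK//; near: y; exact: nbhs_right_gt.
  - exact: cvg_cst.
  - rewrite -[X in _ --> X](mulr0 K); apply: cvgM; first exact: cvg_cst.
    exact: (@cvg_within _ (nbhs (0 : R))).
have H := spec df cv f0.
have f_ge0 y : 0 <= f y.
  apply: Rintegral_ge0 => w _; rewrite patchE; case: ifP => // _.
  by rewrite mulr_ge0 ?expR_ge0.
have gf y : 0 < y -> `|g y| <= expR (b * y) * f y.
  move=> y0; have key (s : R) : `|s| = 1 -> s * g y <= expR (b * y) * f y.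
    move=> s1; pose P w := s * g w - expR (b * w) * f w.
    have Pn u w : 0 < u -> u <= w -> P w <= P u.
      apply: (@der_nonincr _ P (fun w => s * z w - (expR (b * w) * b * f w + expR (b * w) * v w))) => r r0.
        have d1 := der_g fD cl1 cl2 r0; have d2 := der_expRM b r; have d3 := df r r0.
        eapply der_eq; first exact: derD (derM (der_cst s r) d1) (derN (derM d2 d3)).
        by rewrite mul0r add0r.
      have -> : expR (b * r) * v r = `|z r|.
        by rewrite /v mulrA -expRD mulNr subrr expR0 mul1r.
      have h1 : s * z r <= `|z r| by rewrite (le_trans (ler_norm _))// normrM s1 mul1r.
      have h2 : 0 <= expR (b * r) * b * f r by rewrite !mulr_ge0 ?expR_ge0// ltW.
      lra.
    have [L L0 gL] := g_near0 cl1 cl2.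
    rewrite -subr_le0; apply/ler_addgt0Pr => e ep; rewrite add0r.
    pose u := Num.min y (e / L); have u0 : 0 < u by rewrite lt_min y0 divr_gt0.
    have uy : u <= y by rewrite ge_min lexx.
    have uq : u * L <= e by rewrite -ler_pdivlMr// ge_min lexx orbT.
    rewrite (le_trans (Pn u y u0 uy))// (le_trans _ uq)// /P.
    have h1 : s * g u <= L * u by rewrite (le_trans (ler_norm _))// normrM s1 mul1r gL.
    have h2 : 0 <= expR (b * u) * f u by rewrite mulr_ge0 ?expR_ge0.
    by rewrite mulrC; lra.
  have [h|h] := leP 0 (g y); first by rewrite ger0_norm// -[leLHS]mul1r key ?normr1.
  by rewrite ltr0_norm// -mulN1r key ?normrN ?normr1.
(* The weight exp(2 b x) cancels in f'^2, so the right side is 4 times the integral of [vA]. *)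
have E2 : (\int[mu]_(x in Rpos R) (expR (2 * b * x) * (4 * t2 x ^+ 3) * v x ^+ 2)%:E <= 4%:E * c%:E)%E.
  have -> : (\int[mu]_(x in Rpos R) (expR (2 * b * x) * (4 * t2 x ^+ 3) * v x ^+ 2)%:E =
      \int[mu]_(x in Rpos R) (4%:E * ((vA \_ (Rpos R)) x)%:E))%E.
    apply: eq_integral => y; rewrite inE /Rpos /= in_itv/= andbT => y0.
    rewrite restr_pos// -EFinM; congr EFin.
    have e2 : expR (2 * b * y) * expR (- b * y) ^+ 2 = 1.
      by rewrite -expRM_natl -expRD (_ : _ + _ = 0) ?expR0//; ring.
    rewrite -[RHS]mul1r -[X in _ = X * _]e2 /v exprMn real_normK ?num_real// /vA.
    by move: (z y) (t2 y) (expR _) (expR _) => zy ty e3 e4; ring.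
  have mA : measurable_fun (Rpos R) (fun x => ((vA \_ (Rpos R)) x)%:E).
    by apply/measurable_EFinP; apply: measurable_funTS; case: bA.
  rewrite ge0_integralZl_EFin//; [|exact: measurable_Rpos|].
    by rewrite lee_pmul2l// int_le_prim// => y y0; rewrite ?restr_pos ?vA_ge0 ?Ac.
  by move=> y; rewrite /Rpos /= in_itv/= andbT => y0; rewrite lee_fin restr_pos// vA_ge0.
have E1 : (9%:E * (B x)%:E <=
     \int[mu]_(x in Rpos R) (expR (2 * b * x) * (9 * t2 x * k2 x ^+ 2) * f x ^+ 2)%:E)%E.
  have b9 : bmeas (fun y => 9 * (vB \_ (Rpos R)) y) by bm.
  have -> : (9%:E * (B x)%:E = (prim (fun y => 9 * (vB \_ (Rpos R)) y) 0 x)%:E)%E.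
    rewrite -EFinM; congr EFin; rewrite /B /prim bintZl//.
    exact: lebesgue_oc.
  apply: le_trans (prim_le_int _ b9 _) _.
    by move=> y y0; rewrite restr_pos// mulr_ge0// vB_ge0.
  apply: ge0_le_integral => //.
  - exact: measurable_Rpos.
  - move=> y; rewrite /Rpos /= in_itv/= andbT => y0.
    by rewrite lee_fin restr_pos// mulr_ge0// vB_ge0.
  - by apply/measurable_EFinP; apply: measurable_funTS; case: b9.
  - apply/measurable_EFinP; apply: open_continuous_measurable_fun; first exact: interval_open.
    move=> y; rewrite inE /Rpos /= in_itv/= andbT => y0.
    apply: cvgM; last by apply: cvg_exprn; exact: der_cont (df y y0).
    apply: cvgM; first exact: der_cont (der_expRM (2 * b) y).
    by apply: cvgM; [apply: cvgM; [exact: cvg_cst|exact: cont_t2]|apply: cvg_exprn; exact: cont_k2].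
  - move=> y; rewrite /Rpos /= in_itv/= andbT => y0; rewrite lee_fin restr_pos//.
    have h : g y ^+ 2 <= expR (2 * b * y) * f y ^+ 2.
      rewrite -mulrA expRM_natl -exprMn -[leLHS]real_normK ?num_real//.
      by rewrite lerXn2r ?nnegrE ?gf// mulr_ge0 ?expR_ge0.
    have h2 : 0 <= 9 * (t2 y * k2 y ^+ 2) by rewrite mulr_ge0// mulr_ge0 ?sqr_ge0// ltW// t2_gt0.
    rewrite (_ : expR _ * _ * _ = (9 * (t2 y * k2 y ^+ 2)) * (expR (2 * b * y) * f y ^+ 2)); last by ring.
    by rewrite /vB mulrA ler_wpM2l.
have M0 : 0 < M by case/andP: M01.
have h : (4%:E * (9%:E * (B x)%:E) <= M%:E * (4%:E * c%:E))%E.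
  apply: le_trans (le_trans _ H) _; first by rewrite lee_pmul2l.
  by rewrite lee_pmul2l.
by move: h; rewrite -!EFinM lee_fin; lra.
Unshelve. all: by end_near. Qed.

Let A_near0 x : 0 < x -> 0 <= A x <= C2 ^+ 3 * K ^+ 2 * x.
Proof.
move=> x0; have vR t : 0 < t -> `|(vA \_ (Rpos R)) t| <= C2 ^+ 3 * K ^+ 2.
  by move=> t0; rewrite restr_pos ?vA_le.
have h := prim_lip bA vR (lexx 0) (ltW x0); rewrite prim0 !subr0 in h.
apply/andP; split; last by rewrite (le_trans (ler_norm _) h).
apply: Rintegral_ge0 => y _; rewrite patchE; case: ifPn => //.
by rewrite inE /Rpos /= in_itv/= andbT => /vA_ge0.
Qed.

Let B_ge0 x : 0 <= B x.
Proof.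
apply: Rintegral_ge0 => y _; rewrite patchE; case: ifPn => //.
by rewrite inE /Rpos /= in_itv/= andbT => /vB_ge0.
Qed.

Let A_incr x y : 0 < x -> x <= y -> A x <= A y.
Proof.
move=> x0 xy; rewrite -subr_ge0 /A primB//; last exact: ltW.
apply: Rintegral_ge0 => w _; rewrite patchE; case: ifPn => //.
by rewrite inE /Rpos /= in_itv/= andbT => /vA_ge0.
Qed.

(** The final argument compares the supremum of [A] with a multiple of itself, so it must be finite;
    this follows from the exponential decay of both fluxes. *)
Let A_bounded : exists c, forall x, 0 < x -> A x <= c.
Proof.
pose e := 1 + `|boundary_quad D Tb psib|.
have e0 : 0 < e by rewrite ltr_pwDl.
have be : boundary_quad D Tb psib <= 2 * e ^+ 2.
  have h := ler_norm (boundary_quad D Tb psib); have h2 := normr_ge0 (boundary_quad D Tb psib).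
  rewrite (le_trans h)// /e; set n := `|_| in h2 *; nra.
have kd1 := cl_flux_decay fD cl1 mpsib e0 be; have kd2 := cl_flux_decay fD cl2 mpsib e0 be.
pose H := 9 / 2 * e; pose c := C2 ^+ 3 * H ^+ 2.
have c0 : 0 <= c by rewrite mulr_ge0 ?sqr_ge0 ?exprn_ge0//.
have zH x : 0 < x -> vA x <= c * expR (-2 * x).
  move=> x0; have h : `|z x| <= H * expR (- x).
    by rewrite (le_trans (ler_normB _ _))//; have := kd1 x x0; have := kd2 x x0; rewrite /H; lra.
  have h3 : t2 x ^+ 3 <= C2 ^+ 3.
    by rewrite lerXn2r ?nnegrE ?(ltW (t2_gt0 x0))// (le_trans (ler_norm _) (t2_le x0)).
  have h2 : z x ^+ 2 <= H ^+ 2 * expR (-2 * x).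
    rewrite (_ : -2 * x = 2%:R * - x); last by ring.
    rewrite expRM_natl -exprMn -[leLHS]real_normK ?num_real// lerXn2r ?nnegrE//.
    by rewrite mulr_ge0 ?expR_ge0// mulr_ge0// ltW.
  rewrite /c -mulrA; apply: ler_pM => //; last exact: sqr_ge0.
  by rewrite exprn_ge0// ltW// t2_gt0.
pose Q x := A x + c / 2 * expR (-2 * x).
have Qn x y : 0 < x -> x <= y -> Q y <= Q x.
  apply: (@der_nonincr _ Q (fun x => vA x + c / 2 * (expR (-2 * x) * -2))) => r r0.
    have d1 := dA r0; have d2 := der_expRM (-2) r.
    by eapply der_eq; [exact: derD d1 (derM (der_cst (c / 2) r) d2)|rewrite mul0r add0r].
  by have := zH r r0; lra.
exists (C2 ^+ 3 * K ^+ 2 + c / 2) => x x0.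
pose y := Num.min x 1; have y0 : 0 < y by rewrite lt_min x0/=.
have yx : y <= x by rewrite ge_min lexx.
have y1 : y <= 1 by rewrite ge_min lexx orbT.
have h1 : A x <= Q x by rewrite /Q lerDl mulr_ge0 ?expR_ge0// divr_ge0.
rewrite (le_trans h1)// (le_trans (Qn y x y0 yx))// /Q lerD//.
  have /andP[_ h] := A_near0 y0; rewrite (le_trans h)// -[leRHS]mulr1 ler_wpM2l//.
  by rewrite mulr_ge0 ?sqr_ge0 ?exprn_ge0//.
rewrite -[leRHS]mulr1 ler_wpM2l ?divr_ge0// -expR0 ler_expR.
by rewrite mulNr oppr_le0 mulr_ge0// ltW.
Qed.

(* The Lyapunov function is [Gd + a1 A - a2 B]; the spectral inequality bounds [B] by
   [M / 9] times the supremum of [A], which therefore vanishes. *)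
Lemma spectral_flux_eq s : 0 < s -> k1 s = k2 s.
Proof.
have /andP[M0 M1] := M01.
have N1 : 1 / 2 < N < 1 by rewrite /N; apply/andP; split; lra.
have /andP[N2 N3] := N1; have N0 : 0 < N by lra.
have dN : d = (1 - N) / 10 by [].
have d01 : 0 < d < 1 by rewrite dN; apply/andP; split; lra.
have /andP[d0 d1] := d01.
pose q := 3 + 3 * d + d ^+ 2; have q0 : 0 < q by rewrite /q; have := sqr_ge0 d; lra.
pose a1 := 8 * (1 - d) ^+ 3 - 4 * q / 3 * N; pose a2 := 12 * q / N.
have a20 : 0 <= a2 by rewrite divr_ge0 ?(ltW N0)// mulr_ge0 ?(ltW q0).
have a1q : 4 / 3 * q * N < a1.
  (* Expressed in d, the claim 8 (1 - d)^3 > 8/3 q (1 - 10 d) is polynomial, with a margin of about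
     48 d for small d. *)
  rewrite /a1 /q (_ : N = 1 - 10 * d); last by rewrite dN; field.
  by have : d < 1 / 20 by [rewrite dN; lra]; nra.
have a10 : 0 < a1 by rewrite (le_lt_trans _ a1q)// !mulr_ge0 ?(ltW q0) ?(ltW N0)//; lra.
have a2M : a2 * M <= 9 * (4 / 3 * q * N).
  have MN : M <= N * N by rewrite /N; nra.
  rewrite /a2 mulrAC ler_pdivrMr//.
  rewrite (_ : 9 * _ * _ = 12 * q * (N * N)); last by field.
  by rewrite ler_wpM2l// mulr_ge0// ltW.
pose L w := Gd w + a1 * A w - a2 * B w.
have Ln u w : 0 < u -> u <= w -> L w <= L u.
  apply: (@der_nonincr _ L (fun w => (- (2 * Sd w) - 2 * hd' D t1 t2 p1 p2 w * (k1 w - k2 w)) + a1 * vA w - a2 * vB w)) => r r0.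
    have e1 := dA r0; have e2 := dB r0; have e3 := der_quad_d fD cl1 cl2 r0.
    eapply der_eq; first exact: derD (derD e3 (derM (der_cst a1 r) e1)) (derN (derM (der_cst a2 r) e2)).
    by rewrite !mul0r !add0r.
  have := spectral_quadratic_form (k2 r) (z r) d01 N0 (t2_gt0 r0) (small r0).
  have := energy_ge0 D (pd p1 p2) (hd t1 t2) r.
  rewrite /hd' (_ : k2 r + z r = k1 r); last by rewrite /z; ring.
  rewrite -/q -/a1 -/a2 -/(vA r) -/(vB r) -/(z r); set S := Sd r; lra.
have [c0 Ac0] := A_bounded.
pose E := [set A y | y in Rpos R]; have E1 : E (A 1) by exists 1; rewrite // /Rpos /= in_itv/= ltr01.
have hE : has_sup E.
  split; first by exists (A 1).
  by exists c0 => _ [y /= + <-]; rewrite /Rpos /= in_itv/= andbT => /Ac0.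
pose c := sup E.
have Ac y : 0 < y -> A y <= c.
  by move=> y0; apply: sup_upper_bound => //; exists y; rewrite // /Rpos /= in_itv/= y0.
have Bc := spectral_flux_bound Ac.
(* [L] is compared between a point near 0, where Gd and A are small, and a point Y > y where Gd >= -
   Sd is almost nonnegative. *)
have key y : 0 < y -> a1 * A y <= a2 * M * c / 9.
  move=> y0; apply/ler_addgt0Pr => e e0.
  have e3 : 0 < e / 3 by lra.
  pose CA := C2 ^+ 3 * K ^+ 2; have CA0 : 0 <= CA by rewrite mulr_ge0 ?sqr_ge0 ?exprn_ge0//.
  pose m := Num.min y (e / 3 / (a1 * CA + 1)).
  have aC : 0 < a1 * CA + 1 by rewrite ltr_wpDl// mulr_ge0// ltW.
  have m0 : 0 < m by rewrite lt_min y0 !divr_gt0.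
  have [x /andP[x0 xm] Gx] := quad_d_near0 fD cl1 cl2 e3 m0.
  have [Y yY SY] := energy_d_small fD cl1 cl2 mpsib y0 e3.
  have xy : x <= y by rewrite (le_trans (ltW xm))// ge_min lexx.
  have Y0 := lt_trans y0 yY.
  have LY := Ln x Y x0 (le_trans xy (ltW yY)).
  have GY := quad_le fD (pd_transport fD cl1 cl2) Y0.
  have xs : x * (a1 * CA + 1) <= e / 3.
    by rewrite -ler_pdivlMr// (le_trans (ltW xm))// ge_min lexx orbT.
  have /andP[_ Ax] := A_near0 x0.
  have a1x : a1 * A x <= a1 * (CA * x) by rewrite ler_pM2l.
  have a1y : a1 * A y <= a1 * A Y by rewrite ler_pM2l// A_incr// ltW.
  have a2x : 0 <= a2 * B x by rewrite mulr_ge0.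
  have a2Y : a2 * (9 * B Y) <= a2 * (M * c) by rewrite ler_wpM2l ?Bc.
  have G2 : - Sd Y <= Gd Y by move: GY; rewrite ler_norml => /andP[].
  move: LY Gx SY G2; rewrite /L.
  set gx := Gd x; set gY := Gd Y; set sY := Sd Y; lra.
(* The supremum satisfies a1 c <= (a2 M / 9) c with a2 M / 9 < a1. *)
have c_le0 : c <= 0.
  have h : c <= a2 * M * c / 9 / a1.
    apply: sup_le_ub; first by exists (A 1).
    move=> _ [y /= + <-]; rewrite /Rpos /= in_itv/= andbT => y0.
    by rewrite ler_pdivlMr// mulrC key.
  rewrite leNgt; apply/negP => cp.
  move: h; rewrite ler_pdivlMr// => h.
  have h2 : a2 * M * c <= 9 * (4 / 3 * q * N) * c by rewrite ler_pM2r.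
  have h3 : 4 / 3 * q * N * c < a1 * c by rewrite ltr_pM2r.
  lra.
have A0 y : 0 < y -> A y = 0.
  move=> y0; apply/eqP; rewrite eq_le (le_trans (Ac y y0) c_le0)/=.
  by have /andP[] := A_near0 y0.
move=> s0; have /eqP := der_zero s0 A0 (dA s0).
rewrite mulf_eq0 expf_eq0 sqrf_eq0 /= gt_eqF ?t2_gt0//= subr_eq0 => /eqP.
by [].
Qed.

End spectral_uniqueness.

(** * From smallness in L^2 to pointwise smallness *)

Section L2_smallness.
Context {R : realType}.
Local Notation mu := (@lebesgue_measure R).

Lemma calV_int (T T1 : R -> R) (psi1 : R * R -> R) (e : R) : calV e T (T1, psi1) ->
  (\int[mu]_(x in Rpos R) ((T1 x - T x) ^+ 2)%:E <= (e ^+ 2)%:E)%E.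
Proof.
move=> [_ _ /=]; set F := (X in Lnorm _ _ X) => Fe.
have two0 : 2 != 0 :> R by [].
have -> : (\int[mu]_(x in Rpos R) ((T1 x - T x) ^+ 2)%:E = \int[mu]_x (`|F x| `^ 2))%E.
  rewrite integral_mkcond; apply: eq_integral => x _; rewrite patchE /F indicE.
  case: (x \in Rpos R); last by rewrite mulr0 /= normr0 powR0.
  by rewrite mulr1 /= powR_mulrn// real_normK ?num_real.
rewrite -powR_Lnorm//.
have e0 : (0 <= e%:E)%E := le_trans (Lnorm_ge0 _ _ _) Fe.
have -> : (e ^+ 2)%:E = (e%:E `^ 2)%E by rewrite poweR_EFin powR_mulrn.
by apply: gt0_ler_poweR => //; rewrite in_itv /= ?Lnorm_ge0 ?e0 leey.
Qed.

(** If |v x| > s, then |v| >= s / 2 on an interval of length s / (2 K), which contributes s^3 / (8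
    K) to the integral. *)
Lemma lip_L2_small (v : R -> R) (K s e : R) : measurable_fun (Rpos R) v -> 0 < K -> 0 < s ->
  (forall x y, 0 < x -> x <= y -> `|v y - v x| <= K * (y - x)) ->
  (\int[mu]_(x in Rpos R) (v x ^+ 2)%:E <= e%:E)%E -> e < s ^+ 3 / (8 * K) ->
  forall x, 0 < x -> `|v x| <= s.
Proof.
move=> mv K0 s0 vK ve es x x0; rewrite leNgt; apply/negP => sv.
pose h := s / (2 * K); have h0 : 0 < h by rewrite divr_gt0// mulr_gt0.
pose I : set R := `]x, x + h]%classic.
have mI : measurable I by exact: measurable_itv.
have IR : I `<=` Rpos R.
  by move=> y; rewrite /I /Rpos /= !in_itv/= andbT => /andP[xy _]; exact: lt_trans xy.
have mv2 : measurable_fun (Rpos R) (fun y => (v y ^+ 2)%:E).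
  by apply/measurable_EFinP; exact: measurable_funX.
have h1 : (\int[mu]_(y in I) (v y ^+ 2)%:E <= e%:E)%E.
  apply: le_trans ve; apply: ge0_subset_integral => //; first exact: measurable_Rpos.
  by move=> y _; rewrite lee_fin sqr_ge0.
have h2 : (\int[mu]_(y in I) (cst ((s / 2) ^+ 2)%:E) y <= \int[mu]_(y in I) (v y ^+ 2)%:E)%E.
  apply: ge0_le_integral => //.
  - by move=> y _; rewrite lee_fin sqr_ge0.
  - exact: measurable_funS (@measurable_Rpos R) IR mv2.
  - move=> y; rewrite /I /= in_itv/= => /andP[xy yh]; rewrite lee_fin.
    rewrite -[leRHS]real_normK ?num_real// lerXn2r ?nnegrE//; first by rewrite divr_ge0// ltW.
    have d1 := vK x y x0 (ltW xy).
    have d2 : K * (y - x) <= s / 2.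
      rewrite (_ : s / 2 = K * h); first by rewrite ler_pM2l//; lra.
      by rewrite /h; field; lra.
    have := lerB_dist (v x) (v x - v y); rewrite opprB addrCA subrr addr0 => d3.
    by rewrite distrC in d1; lra.
have muI : mu I = h%:E.
  by rewrite /I lebesgue_measure_itv /= lte_fin ltrDl h0 -EFinB addrAC subrr add0r.
have h3 : (\int[mu]_(y in I) (cst ((s / 2) ^+ 2)%:E) y = ((s / 2) ^+ 2)%:E * mu I)%E.
  by rewrite integral_cst.
have := le_trans h2 h1; rewrite h3 muI -EFinM lee_fin.
apply/negP; rewrite -ltNge (lt_le_trans es)//.
by rewrite le_eqVlt; apply/orP; left; apply/eqP; rewrite /h; field; lra.
Qed.

Lemma eq_pos_ae (u v : R -> R) : (forall x, 0 < x -> {for x, continuous u}) ->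
  (forall x, 0 < x -> {for x, continuous v}) -> {ae mu, forall x, 0 < x -> u x = v x} ->
  forall x, 0 < x -> u x = v x.
Proof.
move=> cu cv uv x x0; apply/eqP; rewrite -subr_eq0 -normr_le0; apply/ler_addgt0Pr => e e0.
rewrite add0r; have cw : (fun y => u y - v y) y @[y --> x] --> u x - v x.
  by apply: cvgB; [exact: cu|exact: cv].
have /cvgrPdist_le /(_ e e0) := cw; move=> /nbhs_ballP[r /= r0 H].
have [y [/andP[xy yr] ey]] := ae_ex (ltr_pwDr r0 (lexx x)) uv.
have := H y; rewrite ey ?subrr ?subr0; first by apply; rewrite /ball /= ltr_distlC; apply/andP; split; lra.
exact: lt_trans xy.
Qed.

End L2_smallness.
Section near_uniqueness.
Context {R : realType}.
Local Notation mu := (@lebesgue_measure R).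
Implicit Types (D : set R) (C Tb : R) (psib T t : R -> R) (psi : R * R -> R) (p : R -> R -> R).

Lemma C1_on_derive T (x : R) : C1_on (Rpos R) T -> 0 < x -> is_derive x 1 T (derive1 T x).
Proof.
move=> cT x0; have [|d _] := cT x; first by rewrite /Rpos /= in_itv/= x0.
by rewrite derive1E; exact: derivableP.
Qed.

Lemma represented_eq D C Tb psib T psi t p : fullset D -> C1_on (Rpos R) T ->
  represented Tb psib T psi D C t p -> forall x, 0 < x -> T x = t x.
Proof.
move=> fD cT [cl Tt _]; apply: eq_pos_ae => // x x0.
  exact: der_cont (C1_on_derive cT x0).
exact: der_cont (der_t fD cl x0).
Qed.

Lemma represented_derive D C Tb psib T psi t p : fullset D -> C1_on (Rpos R) T ->
  represented Tb psib T psi D C t p -> forall x, 0 < x -> derive1 T x = flux D p x.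
Proof.
move=> fD cT r x x0; have [cl _ _] := r.
have E : \forall y \near x, t y = T y.
  near=> y; have y0 : 0 < y by near: y; exact: lt_nbhsr.
  by rewrite (represented_eq fD cT r).
exact: der_derive1 (near_eq_is_derive E (der_t fD cl x0)).
Unshelve. all: by end_near. Qed.

(** The radius must not depend on the second solution. It is built from the lower bound c of T, the
    constant M, and a Lipschitz constant K of t1 - t2 that the flux decay derives from the energy of
    the data alone. *)
Lemma near_unique Tb psib T psi : milne_data Tb psib -> 0 < Tb ->
  milne_solution Tb psib T psi -> spectral_assumption T ->
  exists2 e : R, 0 < e & forall T1 psi1, milne_solution Tb psib T1 psi1 ->
    (\int[mu]_(x in Rpos R) ((T1 x - T x) ^+ 2)%:E <= e%:E)%E -> ae_equal T1 psi1 T psi.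
Proof.
move=> [_ mpsib _] Tb0 sol sp; have [cT _ _] := sp.
have [D0 [C0 [t0 [p0 [_ [_ [_ [fD0 r0 _]]]]]]]] := represented2 sol sol.
have [cl0 _ _] := r0.
have [c cp tc] := t_lower_bound fD0 cl0 Tb0.
have [b [M [b0 M01 H]]] := spectral_estimate sp (fun x x0 => C1_on_derive cT x0).
have /andP[M0 M1] := M01.
pose d := (1 - (1 + M) / 2) / 10; have d0 : 0 < d by rewrite /d; lra.
pose e0 := 1 + `|boundary_quad D0 Tb psib|.
have e00 : 0 < e0 by rewrite ltr_pwDl.
have be : boundary_quad D0 Tb psib <= 2 * e0 ^+ 2.
  have h := ler_norm (boundary_quad D0 Tb psib); have h2 := normr_ge0 (boundary_quad D0 Tb psib).
  rewrite (le_trans h)// /e0; set n := `|_| in h2 *; nra.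
pose K := 9 / 2 * e0; have K0 : 0 < K by rewrite mulr_gt0.
pose s := d * c; have s0 : 0 < s by rewrite mulr_gt0.
have q0 : 0 < s ^+ 3 / (8 * K) by rewrite divr_gt0 ?exprn_gt0// mulr_gt0.
exists (s ^+ 3 / (8 * K) / 2) => [|T1 psi1 sol1 close]; first by rewrite divr_gt0.
have [D [C1 [t1 [p1 [C2 [t2 [p2 [fD r1 r2]]]]]]]] := represented2 sol1 sol.
have [cl1 T1t _] := r1; have [cl2 Tt _] := r2.
have Tt2 := represented_eq fD cT r2; have Tt0 := represented_eq fD0 cT r0.
have dTk := represented_derive fD cT r2.
have t2c x : 0 < x -> c <= t2 x by move=> x0; rewrite -Tt2// Tt0// tc.
have t2p x : 0 < x -> 0 < t2 x by move=> x0; rewrite (lt_le_trans cp)// t2c.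
(* The boundary functional has the same value for both sets of directions, as each is twice
   [data_energy]. *)
have be' : boundary_quad D Tb psib <= 2 * e0 ^+ 2.
  have : (boundary_quad D0 Tb psib / 2)%:E = (boundary_quad D Tb psib / 2)%:E.
    by rewrite -(data_energyE fD0 cl0 mpsib) -(data_energyE fD cl1 mpsib).
  by move=> [] E; lra.
have kd1 := cl_flux_decay fD cl1 mpsib e00 be'; have kd2 := cl_flux_decay fD cl2 mpsib e00 be'.
pose g x := t1 x - t2 x.
have gK x y : 0 < x -> x <= y -> `|g y - g x| <= K * (y - x).
  move=> x0; rewrite le_eqVlt => /predU1P[->|xy]; first by rewrite !subrr normr0 mulr0.
  have [xi /andP[xxi _] ->] := MVT_pos (fun x x0 => der_g fD cl1 cl2 x0) x0 xy.
  have xi0 := lt_trans x0 xxi.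
  rewrite normrM (ger0_norm (_ : 0 <= y - x)) ?subr_ge0 ?(ltW xy)// ler_wpM2r ?subr_ge0 ?(ltW xy)//.
  rewrite (le_trans (ler_normB _ _))//.
  have ex : expR (- xi) <= 1 by rewrite -expR0 ler_expR oppr_le0 ltW.
  have h1 := kd1 xi xi0; have h2 := kd2 xi xi0.
  have h3 : 9 / 4 * e0 * expR (- xi) <= 9 / 4 * e0 by rewrite -[leRHS]mulr1 ler_wpM2l// mulr_ge0// ltW.
  by rewrite /K; clear -h1 h2 h3; lra.
have mg : measurable_fun (Rpos R) g.
  apply: open_continuous_measurable_fun; first exact: interval_open.
  by move=> y; rewrite inE /Rpos /= in_itv/= andbT => y0; exact: der_cont (der_g fD cl1 cl2 y0).
have mT : measurable_fun (Rpos R) T by case: (milne_L2loc_T sol).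
have mT1 : measurable_fun (Rpos R) T1 by case: (milne_L2loc_T sol1).
have gint : (\int[mu]_(x in Rpos R) (g x ^+ 2)%:E <= (s ^+ 3 / (8 * K) / 2)%:E)%E.
  rewrite (_ : (\int[mu]_(x in Rpos R) (g x ^+ 2)%:E =
    \int[mu]_(x in Rpos R) ((T1 x - T x) ^+ 2)%:E)%E)//.
  apply: ae_eq_integral; first exact: measurable_Rpos.
  - by apply/measurable_EFinP; apply: measurable_funX.
  - by apply/measurable_EFinP; apply: measurable_funX; exact: measurable_funB.
  - apply: ae_sub (ae_and T1t Tt) => x [h1 h2]; rewrite /Rpos /= in_itv/= andbT => x0.
    by rewrite h1// h2.
have gs := lip_L2_small mg K0 s0 gK gint; have {}gs : forall x, 0 < x -> `|g x| <= s by apply: gs; lra.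
apply: (ae_equal_of_flux sol1 sol fD r1 r2).
apply: (spectral_flux_eq fD cl1 cl2 mpsib b0 M01 t2p) => [f df hf cdf f0|x x0]; last first.
  by rewrite (le_trans (gs x x0))// /s ler_wpM2l ?t2c// ltW.
have Tp x : Rpos R x -> 0 < T x by rewrite /Rpos /= in_itv/= andbT => x0; rewrite Tt2 ?t2p.
have := H (Rpos R) f df (fun x Rx => Rx) Tp hf cdf f0.
have E1 : (\int[mu]_(x in Rpos R) (expR (2 * b * x) * (9 * T x * derive1 T x ^+ 2) * f x ^+ 2)%:E =
   \int[mu]_(x in Rpos R) (expR (2 * b * x) * (9 * t2 x * flux D p2 x ^+ 2) * f x ^+ 2)%:E)%E.
  by apply: eq_integral => x; rewrite inE /Rpos /= in_itv/= andbT => x0; rewrite dTk ?Tt2.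
have E2 : (\int[mu]_(x in Rpos R) (expR (2 * b * x) * (4 * T x ^+ 3) * df x ^+ 2)%:E =
   \int[mu]_(x in Rpos R) (expR (2 * b * x) * (4 * t2 x ^+ 3) * df x ^+ 2)%:E)%E.
  by apply: eq_integral => x; rewrite inE /Rpos /= in_itv/= andbT => x0; rewrite Tt2.
rewrite E1 E2; apply => x x0 []; by rewrite /Rpos /= in_itv/= x0.
Qed.

End near_uniqueness.
(** * The case of a cold wall *)

Section cold_wall.
Context {R : realType}.
Local Notation mu := (@lebesgue_measure R).
Context (D : set R) (fD : fullset D) (C : R) (psib t : R -> R) (p : R -> R -> R).
Context (cl : classical D C 0 psib t p).
Context (mpsib : measurable_fun (`]0, 1]%classic : set R) psib).
Local Notation k := (flux D p).

Lemma mposE m : D m -> 0 < m -> mpos m = m :> R.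
Proof.
move=> Dm m0; have mI11 := fullset_sub fD Dm; rewrite /mpos mIE// indicE mem_set ?mulr1//=.
by move: mI11; rewrite /= in_itv/= in_itv/= m0 => /andP[].
Qed.

(* If d <= 0 then [t] and [<m^2 p>] vanish, which is incompatible with a nonzero inflow. *)
Lemma cold_moment_gt0 (d : R) :
  (forall x : R, 0 < x -> t x = d - \int[mu]_(m in D) (m ^+ 2 * p x m)) ->
  0 < boundary_quad D 0 psib -> 0 < d.
Proof.
move=> td bq; rewrite ltNge; apply/negP => d0; move: bq; apply/negP; rewrite -leNgt.
have [mD hm _] := fD; have finD := fullset_fin fD.
have b1 := @bmeas_mI R; have b2 := @bmeas_mpos R; have b0 := bmeas_psi0 fD cl mpsib.
have C0 := classical_C_ge0 cl.
have small (x : R) (e : R) : 0 < x -> 0 < e ->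
    \int[mu]_(m in D) (mpos m * p x m ^+ 2) <= 2 * (C ^+ 2 * e).
  move=> x0 e0; have bp := cl_bmeas cl x0.
  have M2 : \int[mu]_(m in D) (m ^+ 2 * p x m) = \int[mu]_(m in D) (mI m ^+ 2 * p x m).
    by apply: eq_Rintegral => m; rewrite inE => Dm; rewrite mIE//; exact: fullset_sub fD _ Dm.
  have m20 : \int[mu]_(m in D) (mI m ^+ 2 * p x m) <= 0.
    have := td x x0; rewrite M2; have /andP[] := cl_t_itv cl x0; lra.
  (* For m <= e the integrand is at most C^2 e; for m > e one uses m <= m^2 / e to reach the second
     moment, which is nonpositive here. *)
  apply: (@le_trans _ _ (\int[mu]_(m in D) (C / e * (mI m ^+ 2 * p x m) + C ^+ 2 * e))).
    apply: ble_int => //; [by bm|by bm|move=> m Dm].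
    have /andP[p0 pC] := cl_p_itv cl x0 Dm.
    have Ce : 0 <= C / e by rewrite divr_ge0// ltW.
    have e1 : 0 <= C / e * (mI m ^+ 2 * p x m) by rewrite mulr_ge0// mulr_ge0 ?sqr_ge0.
    have e2 : 0 <= C ^+ 2 * e by rewrite mulr_ge0 ?sqr_ge0// ltW.
    have [m0|m0] := leP m 0; first by rewrite mpos_eq0// mul0r addr_ge0.
    rewrite mposE// mIE; last exact: fullset_sub fD _ Dm.
    have p2 : p x m ^+ 2 <= C * p x m by rewrite expr2 ler_wpM2r.
    have p3 : p x m ^+ 2 <= C ^+ 2 by rewrite lerXn2r ?nnegrE.
    have [me|me] := leP m e.
      rewrite mIE in e1; last exact: fullset_sub fD _ Dm.
      have : m * p x m ^+ 2 <= e * C ^+ 2 by rewrite ler_pM ?sqr_ge0 ?(ltW m0).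
      lra.
    have h1 : m <= m ^+ 2 / e by rewrite ler_pdivlMr// expr2 ler_pM2l// ltW.
    have : m * p x m ^+ 2 <= m ^+ 2 / e * (C * p x m) by rewrite ler_pM ?sqr_ge0 ?(ltW m0).
    rewrite (_ : C / e * (m ^+ 2 * p x m) = m ^+ 2 / e * (C * p x m)); first by lra.
    by field; lra.
  rewrite bintD//; [|by bm|by bm]; rewrite bintZl//; last by bm.
  rewrite int_cst//; have : C / e * \int[mu]_(m in D) (mI m ^+ 2 * p x m) <= 0.
    by rewrite mulr_ge0_le0// divr_ge0// ltW.
  lra.
apply/ler_addgt0Pr => e e0; rewrite add0r.
have e2 : 0 < e / 2 by lra.
have E0 : boundary_quad D 0 psib = \int[mu]_(m in D) (mpos m * psi0 D psib m ^+ 2).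
  by apply: eq_Rintegral => m _; rewrite expr0n subr0.
have := @int_near0 _ D fD (fun x m => mpos m * p x m ^+ 2) (fun m => mpos m * psi0 D psib m ^+ 2)
  (C ^+ 2) (e / 2) 1.
rewrite -E0; case=> //.
- by move=> x x0; have b := cl_bmeas cl x0; bm.
- by bm.
- move=> x m x0 Dm; rewrite normrM normrX -[leRHS]mul1r ler_pM ?mpos_le1 ?exprn_ge0//.
  by have /andP[p0 pC] := cl_p_itv cl x0 Dm; rewrite lerXn2r ?nnegrE// ger0_norm.
- move=> m Dm; have [m0|m0] := leP m 0.
    by rewrite mpos_eq0//; under eq_fun do rewrite mul0r; rewrite mul0r; exact: cvg_cst.
  have [L pL] := cl_p0 cl Dm m0; rewrite psi0E//.
  apply: cvgM; first exact: cvg_cst.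
  by apply: cvg_exprn; apply: (@cvg_near0 _ (fun x => p x m) _ L) => x x0; exact: pL.
move=> x /andP[x0 _]; rewrite ler_norml => /andP[_ h].
have e4 : 0 < e / (4 * (C ^+ 2 + 1)) by rewrite divr_gt0// mulr_gt0// ltr_wpDl ?sqr_ge0.
have h2 := small x _ x0 e4.
have h3 : 2 * (C ^+ 2 * (e / (4 * (C ^+ 2 + 1)))) <= e / 2.
  have C1 : 0 < C ^+ 2 + 1 by rewrite ltr_wpDl ?sqr_ge0.
  rewrite (_ : 2 * _ = (e / 2) * (C ^+ 2 / (C ^+ 2 + 1))); last by field; lra.
  by rewrite -[leRHS]mulr1 ler_pM2l// ler_pdivrMr// mul1r lerDl.
move: h h2; set I1 := Rintegral _ _ _; lra.
Qed.

(** Near 0, t'' <= 2 t^4 + t - d < 0, so k decreases and its supremum a is its limit at 0. If a <=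
    0, t would decrease strictly while being nonnegative and tending to 0 at 0. The linear errors
    come from the Lipschitz bound on k. *)
Lemma cold_slope : 0 < boundary_quad D 0 psib -> exists a L x0 : R,
  [/\ 0 < a, 0 < L, 0 < x0 & forall x, 0 < x < x0 ->
    a - L * x <= k x <= a /\ (a - L * x) * x <= t x <= a * x].
Proof.
move=> bq; have [d td] := cl_t cl; have d0 := cold_moment_gt0 td bq.
have [L0 tL0] := cl_t0 cl.
have tr := cl_transport fD cl; pose B := cl_bound C.
have tL x : 0 < x -> t x <= (`|L0| + 1) * x.
  move=> x0; have := tL0 x x0; rewrite subr0 => h.
  have h1 := ler_norm (t x); have h2 : L0 * x <= `|L0| * x by rewrite ler_wpM2r ?ler_norm// ltW.
  lra.
pose L1 := `|L0| + 1; have L10 : 0 < L1 by rewrite ltr_wpDl.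
pose L := 4 * B ^+ 2 + 1; have L_gt0 : 0 < L by rewrite ltr_wpDl// mulr_ge0// sqr_ge0.
have dk (z : R) (z0 : 0 < z) : is_derive z 1 k (- \int[mu]_(m in D) resid p (fun x => t x ^+ 4) z m).
  by have := der_flux fD tr z0.
have klip x y : 0 < x -> x <= y -> `|k y - k x| <= L * (y - x).
  move=> x0; rewrite le_eqVlt => /predU1P[->|xy]; first by rewrite !subrr normr0 mulr0.
  have [xi /andP[xxi _] ->] := MVT_pos dk x0 xy.
  rewrite normrM normrN (ger0_norm (_ : 0 <= y - x)) ?subr_ge0 ?(ltW xy)//.
  rewrite ler_wpM2r ?subr_ge0 ?(ltW xy)//.
  have xi0 := lt_trans x0 xxi.
  have h1 := int_resid_le fD tr xi0 ltr01; have h2 := energy_le fD tr xi0.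
  rewrite (le_trans h1)// /L lerD2r mulr1 ler_pdivrMr//; rewrite -/B in h2; lra.
pose x1 := Num.min (1 / L1) (d / (4 * L1)).
have L14 : 0 < 4 * L1 by lra.
have x10 : 0 < x1 by rewrite lt_min !divr_gt0.
have kdec x y : 0 < x -> x < y -> y < x1 -> k y < k x.
  move=> x0 xy yx1; have [xi /andP[xxi xiy] E] := MVT_pos dk x0 xy.
  have xi0 := lt_trans x0 xxi; have xix1 := lt_trans xiy yx1.
  have h1 : xi * L1 <= 1 by rewrite -ler_pdivlMr// (le_trans (ltW xix1))// ge_min lexx.
  have h2 : xi * (4 * L1) <= d by rewrite -ler_pdivlMr// (le_trans (ltW xix1))// ge_min lexx orbT.
  have [k' dk' k'le] := der_flux_le fD cl td xi0.
  have k'0 : k' < 0.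
    have /andP[t0 _] := cl_t_itv cl xi0; have t1 := tL xi xi0; rewrite -/L1 in t1.
    have t4 : t xi ^+ 4 <= t xi by rewrite exprS ler_piMr// exprn_ile1//; lra.
    lra.
  rewrite -subr_lt0 E; rewrite -(der_derive1 (dk xi xi0)) (der_derive1 dk').
  by rewrite nmulr_rlt0// subr_gt0.
pose E := [set k x | x in `]0, x1[%classic].
have Ek x : 0 < x -> x < x1 -> E (k x) by move=> x0 xx1; exists x; rewrite //= in_itv/= x0.
have hE : has_sup E.
  split; first by exists (k (x1 / 2)); apply: Ek; lra.
  exists (2 * C) => _ [x /= + <-]; rewrite in_itv/= => /andP[x0 _].
  by rewrite (le_trans (ler_norm _))//; have := flux_le fD cl x0.
pose a := sup E.
have ka x : 0 < x -> x < x1 -> k x <= a.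
  by move=> x0 xx1; apply: sup_upper_bound => //; exact: Ek.
have dt (x : R) (x0 : 0 < x) : is_derive x 1 t (k x) := der_t fD cl x0.
have a0 : 0 < a.
  rewrite ltNge; apply/negP => a0.
  have kneg x : 0 < x -> x < x1 -> k x < 0.
    move=> x0 xx1; have x2 : 0 < x / 2 by lra.
    by rewrite (lt_le_trans (kdec (x / 2) x x2 _ _))//; [lra|rewrite (le_trans (ka _ x2 _))//; lra].
  have tdec x y : 0 < x -> x < y -> y < x1 -> t y < t x.
    move=> x0 xy yx1; have [xi /andP[xxi xiy] Et] := MVT_pos dt x0 xy.
    by rewrite -subr_lt0 Et nmulr_rlt0 ?subr_gt0// kneg ?(lt_trans x0)// (lt_trans xiy).
  have x4 : 0 < x1 / 4 by lra.
  have ty : 0 < t (x1 / 4).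
    have : t (x1 / 2) < t (x1 / 4) by apply: tdec; lra.
    have x2 : 0 < x1 / 2 by lra.
    by apply: le_lt_trans; have /andP[] := cl_t_itv cl x2.
  pose z := Num.min (x1 / 8) (t (x1 / 4) / (2 * L1)).
  have z0 : 0 < z by rewrite lt_min divr_gt0//= divr_gt0// mulr_gt0.
  have z8 : z <= x1 / 8 by rewrite ge_min lexx.
  have zL : z * (2 * L1) <= t (x1 / 4) by rewrite -ler_pdivlMr ?mulr_gt0// ge_min lexx orbT.
  have h1 : t (x1 / 4) < t z by apply: tdec; lra.
  have := tL z z0; rewrite -/L1; lra.
exists a, L, x1; split=> // x /andP[x0 xx1].
have kL : a - L * x <= k x.
  rewrite lerBlDr; apply: sup_le_ub; first by exists (k x); exact: Ek.
  move=> _ [y /= + <-]; rewrite in_itv/= => /andP[y0 yx1].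
  have [yx|xy] := leP y x.
    have := klip y x y0 yx; rewrite distrC => h.
    have := ler_norm (k y - k x); have : 0 <= L * y by rewrite mulr_ge0// ltW.
    by move: h; rewrite mulrBr; lra.
  have := kdec x y x0 xy yx1; have : 0 <= L * x by rewrite mulr_ge0// ltW.
  lra.
split; first by rewrite kL ka.
suff key e : 0 < e -> (a - L * x) * x - e <= t x <= a * x + e.
  apply/andP; split; apply/ler_addgt0Pr => e e0; have /andP[] := key e e0; lra.
move=> e0; pose w := L1 + `|a - L * x|; have w0 : 0 < w by rewrite ltr_pwDl.
pose y := Num.min (x / 2) (e / w); have y0 : 0 < y by rewrite lt_min !divr_gt0.
have yx : y < x by rewrite (@le_lt_trans _ _ (x / 2))//; [rewrite ge_min lexx|lra].
have yw : y * w <= e by rewrite -ler_pdivlMr// ge_min lexx orbT.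
have [xi /andP[yxi xix] Et] := MVT_pos dt y0 yx.
have xi0 := lt_trans y0 yxi; have k1 := ka xi xi0 (lt_trans xix xx1).
have k2 : a - L * x <= k xi by rewrite (le_trans kL)// ltW// kdec.
have ty := tL y y0; rewrite -/L1 in ty; have /andP[ty0 _] := cl_t_itv cl y0.
have xy : 0 <= x - y by rewrite subr_ge0 ltW.
have m1 : k xi * (x - y) <= a * (x - y) by rewrite ler_wpM2r.
have m2 : (a - L * x) * (x - y) <= k xi * (x - y) by rewrite ler_wpM2r.
have m3 : (a - L * x) * y <= `|a - L * x| * y by rewrite ler_wpM2r ?ler_norm// ltW.
have m4 : 0 <= `|a - L * x| * y by rewrite mulr_ge0// ltW.
have m5 : 0 <= a * y by rewrite mulr_ge0 ?ltW.
have m6 : 0 <= L1 * y by rewrite mulr_ge0 ?ltW.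
move: yw Et m1 m2 m3 m4; rewrite /w mulrDr !mulrBr.
by clear -fD cl mpsib ty ty0 m5 m6; move=> *; apply/andP; split; lra.
Qed.

End cold_wall.
Section cold_wall_spectral.
Context {R : realType}.
Local Notation mu := (@lebesgue_measure R).

Lemma int_poly_oc (P Q : R -> R) (h : R) : 0 < h -> (forall x : R, is_derive x 1 Q (P x)) ->
  continuous P -> (\int[mu]_(x in `]0%R, h]) (P x)%:E = (Q h - Q 0)%:E)%E.
Proof.
move=> h0 dQ cP; have cPw : {within `[0, h], continuous P} by exact: continuous_subspaceT.
have iP := continuous_compact_integrable (@segment_compact R 0 h) cPw.
rewrite integral_itv_obnd_cbnd; last first.
  by apply/measurable_EFinP; apply: measurable_funTS; exact: continuous_measurable_fun.
by rewrite -(FTC2_Rint h0 dQ cP) /Rintegral fineK// integrable_fin_num.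
Qed.

Lemma exp_le (y : R) : 0 <= y -> y <= 1 / 21 -> expR y <= 21 / 20.
Proof.
move=> y0 y1; have h := expR_ge1Dx (- y); have e0 := expR_gt0 y.
have E : expR y * expR (- y) = 1 by rewrite -expRD subrr expR0.
have : expR y * (20 / 21) <= expR y * expR (- y) by rewrite ler_pM2l//; lra.
rewrite E; lra.
Qed.

Let q (h x : R) := x ^+ 2 * sqpos (h - x).
Let dq (h x : R) := 2 * x * sqpos (h - x) - x ^+ 2 * (2 * Num.max (h - x) 0).

Let der_q (h x : R) : is_derive x 1 (q h) (dq h x).
Proof.
have d1 : is_derive x 1 (fun x : R => h - x) (-1).
  by eapply der_eq; first (by der); rewrite add0r.
have d2 := @der_comp R sqpos (fun x => h - x) x _ _ (is_derive_sqpos (h - x)) d1.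
eapply der_eq; first exact: derM (derX 2 (der_id x)) d2.
by rewrite /dq /= expr1; ring.
Qed.

Let cont_dq (h x : R) : {for x, continuous (dq h)}.
Proof.
have c1 : (fun y : R => h - y) y @[y --> x] --> h - x by apply: cvgB; [exact: cvg_cst|exact: cvg_id].
have c2 : Num.max (h - y) 0 @[y --> x] --> Num.max (h - x) 0.
  exact: (cvg_comp _ _ c1 (@continuous_max0 R (h - x))).
apply: cvgB; apply: cvgM.
- by apply: cvgM; [exact: cvg_cst|exact: cvg_id].
- exact: cvg_exprn.
- by apply: cvg_exprn; exact: cvg_id.
- by apply: cvgM; [exact: cvg_cst|exact: c2].
Qed.

(* Near 0, [T] is close to [a x] and [T'] to [a]; with [f x = x^2 (h - x)^2] on ]0, h]
   the two sides of the spectral inequality are then close to [36 / 1260 a^3 h^10] and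
   [M * 16 / 840 a^3 h^10]. *)
Lemma cold_not_spectral (D : set R) (C : R) (psib T t : R -> R) (psi : R * R -> R) (p : R -> R -> R) :
  fullset D -> measurable_fun (`]0, 1]%classic : set R) psib ->
  represented 0 psib T psi D C t p -> spectral_assumption T -> boundary_quad D 0 psib <= 0.
Proof.
move=> fD mpsib r sp; rewrite leNgt; apply/negP => bq.
have [cl _ _] := r; have [cT _ _] := sp.
have Tt := represented_eq fD cT r; have dTk := represented_derive fD cT r.
have [a [L [x1 [a0 L0 x10 slope]]]] := cold_slope fD cl mpsib bq.
have [b [M [b0 /andP[M0 M1] H]]] := spectral_estimate sp (fun x x0 => C1_on_derive cT x0).
(* On ]0, h] this gives L x <= a / 20 and 2 b x <= 1 / 21, whence the factors 19/20 and 21/20. *)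
pose h := Num.min (x1 / 2) (Num.min (a / (20 * L)) (1 / (42 * b))).
have h0 : 0 < h by rewrite !lt_min !divr_gt0// mulr_gt0.
have hx1 : h <= x1 / 2 by rewrite ge_min lexx.
have hL : h * (20 * L) <= a by rewrite -ler_pdivlMr ?mulr_gt0// !ge_min lexx orbT.
have hb : h * (42 * b) <= 1 by rewrite -ler_pdivlMr ?mulr_gt0// !ge_min lexx !orbT.
pose X : set R := `]0, h]%classic.
have XE x : X x -> 0 < x <= h by rewrite /X /= in_itv.
have XR : X `<=` Rpos R by move=> x /XE /andP[x0 _]; rewrite /Rpos /= in_itv/= x0.
have near x : X x -> [/\ 19 / 20 * a * x <= T x, T x <= a * x, 19 / 20 * a <= derive1 T x,
    derive1 T x <= a & 1 <= expR (2 * b * x) <= 21 / 20].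
  move=> Xx; have /andP[x0 xh] := XE x Xx.
  have [|/andP[k1 k2] /andP[e1 e2]] := slope x; first by rewrite x0/=; lra.
  have Lx : L * x <= a / 20.
    have : L * x <= L * h by rewrite ler_pM2l.
    lra.
  have al : (19 / 20 * a) * x <= (a - L * x) * x by rewrite ler_pM2r//; lra.
  have b1 : 0 <= 2 * b * x by rewrite !mulr_ge0// ltW.
  have b2 : 2 * b * x <= 1 / 21.
    have : b * x <= b * h by rewrite ler_pM2l.
    lra.
  rewrite Tt// dTk//; split; [clear -al e1; lra|clear -e2; lra|clear -k1 Lx; lra|clear -k2; lra|].
  by rewrite exp_le// -[X in X <= _]expR0 ler_expR b1.
have Tp x : X x -> 0 < T x.
  move=> Xx; have /andP[x0 _] := XE x Xx; have [h1 _ _ _ _] := near x Xx.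
  by rewrite (lt_le_trans _ h1)// mulr_gt0// mulr_gt0.
have q0 : q h x @[x --> 0^'+] --> 0.
  have qh0 : q h 0 = 0 by rewrite /q expr0n mul0r.
  by have := cvg_at_right_filter (der_cont (der_q h 0)); rewrite qh0.
have out x : 0 < x -> ~ X x -> q h x = 0 /\ dq h x = 0.
  move=> x0; rewrite /X /= in_itv/= x0 /= => /negP; rewrite -ltNge => hx.
  by rewrite /q /dq /sqpos max_r ?expr0n/= ?mulr0 ?subrr//; lra.
have {H} := H X (q h) (dq h) XR Tp (fun x _ => der_q h x) (fun x _ => cont_dq (h := h) (x := x)) q0 out.
pose P1 x := 9 * (19 / 20 * a) ^+ 3 * (x ^+ 5 * (h - x) ^+ 4).
pose P2 x := 21 / 5 * a ^+ 3 * (4 * (x ^+ 5 * ((h - x) * (h - 2 * x)) ^+ 2)).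
pose Q1 x := 9 * (19 / 20 * a) ^+ 3 * (h ^+ 4 * x ^+ 6 * (1 / 6) - h ^+ 3 * x ^+ 7 * (4 / 7)
  + h ^+ 2 * x ^+ 8 * (6 / 8) - h * x ^+ 9 * (4 / 9) + x ^+ 10 * (1 / 10)).
pose Q2 x := 21 / 5 * a ^+ 3 * (4 * (h ^+ 4 * x ^+ 6 * (1 / 6) - h ^+ 3 * x ^+ 7 * (6 / 7)
  + h ^+ 2 * x ^+ 8 * (13 / 8) - h * x ^+ 9 * (12 / 9) + x ^+ 10 * (4 / 10))).
have dQ1 (x : R) : is_derive x 1 Q1 (P1 x).
  by eapply der_eq; [rewrite /Q1; der|rewrite /P1 /=; field].
have dQ2 (x : R) : is_derive x 1 Q2 (P2 x).
  by eapply der_eq; [rewrite /Q2; der|rewrite /P2 /=; field].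
have cP1 : continuous P1.
  move=> x; have [v dv] : exists v, is_derive x 1 P1 v by eexists; rewrite /P1; der.
  exact: der_cont dv.
have cP2 : continuous P2.
  move=> x; have [v dv] : exists v, is_derive x 1 P2 v by eexists; rewrite /P2; der.
  exact: der_cont dv.
have qE x : X x -> q h x = x ^+ 2 * (h - x) ^+ 2 /\ dq h x = 2 * x * ((h - x) * (h - 2 * x)).
  move=> /XE /andP[_ xh]; rewrite /q /dq /sqpos max_l ?subr_ge0//; split=> //; ring.
have mX : measurable X by exact: measurable_itv.
have mRX (v : R -> R) : (forall x, 0 < x -> {for x, continuous v}) -> measurable_fun X (EFin \o v).
  move=> cv; apply/measurable_EFinP; apply: (measurable_funS (@measurable_Rpos R) XR).
  apply: open_continuous_measurable_fun; first exact: interval_open.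
  by move=> y; rewrite inE /Rpos /= in_itv/= andbT => /cv.
have ce x : {for x, continuous (fun x => expR (2 * b * x))} by exact: der_cont (der_expRM (2 * b) x).
have cTx x : 0 < x -> {for x, continuous T} by move=> x0; exact: der_cont (C1_on_derive cT x0).
have cdT x : 0 < x -> {for x, continuous (derive1 T)}.
  by move=> x0; have [|_] := cT x; first by rewrite /Rpos /= in_itv/= x0.
have cq x : {for x, continuous (q h)} by exact: der_cont (der_q h x).
have I1 : (\int[mu]_(x in X) (P1 x)%:E <=
    \int[mu]_(x in X) (expR (2 * b * x) * (9 * T x * derive1 T x ^+ 2) * q h x ^+ 2)%:E)%E.
  apply: ge0_le_integral => //.
  - move=> x Xx; have /andP[x0 xh] := XE x Xx; rewrite lee_fin /P1 mulr_ge0//.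
      by rewrite mulr_ge0// exprn_ge0// mulr_ge0// ltW.
    by rewrite mulr_ge0// exprn_ge0 ?subr_ge0// ltW.
  - by apply: mRX => x _; exact: cP1.
  - apply: mRX => x x0; apply: cvgM; last by apply: cvg_exprn; exact: cq.
    apply: cvgM; first exact: ce.
    apply: cvgM; last by apply: cvg_exprn; exact: cdT.
    by apply: cvgM; [exact: cvg_cst|exact: cTx].
  - move=> x Xx; have [h1 h2 h3 h4 /andP[h5 h6]] := near x Xx; have [-> _] := qE x Xx.
    have /andP[x0 xh] := XE x Xx; rewrite lee_fin.
    have al0 : 0 <= 19 / 20 * a by rewrite mulr_ge0// ltW.
    have e1 : (19 / 20 * a) ^+ 2 <= derive1 T x ^+ 2 by rewrite lerXn2r ?nnegrE// (le_trans al0).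
    have e2 : 19 / 20 * a * x * (19 / 20 * a) ^+ 2 <= T x * derive1 T x ^+ 2.
      by rewrite ler_pM ?sqr_ge0// mulr_ge0// ltW.
    have e3 : 19 / 20 * a * x * (19 / 20 * a) ^+ 2 <= expR (2 * b * x) * (T x * derive1 T x ^+ 2).
      rewrite (le_trans e2)// -[leLHS]mul1r ler_wpM2r//.
      by rewrite (le_trans _ e2)// mulr_ge0 ?sqr_ge0// mulr_ge0// ltW.
    have -> : P1 x = 19 / 20 * a * x * (19 / 20 * a) ^+ 2 * (9 * (x ^+ 2 * (h - x) ^+ 2) ^+ 2).
      by rewrite /P1; ring.
    rewrite (_ : _ * _ * _ = expR (2 * b * x) * (T x * derive1 T x ^+ 2) *
      (9 * (x ^+ 2 * (h - x) ^+ 2) ^+ 2)); first by rewrite ler_wpM2r// mulr_ge0 ?sqr_ge0.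
    by move: (expR _) (T x) (derive1 T x) => *; ring.
have I2 : (\int[mu]_(x in X) (expR (2 * b * x) * (4 * T x ^+ 3) * dq h x ^+ 2)%:E <=
    \int[mu]_(x in X) (P2 x)%:E)%E.
  apply: ge0_le_integral => //.
  - move=> x Xx; rewrite lee_fin mulr_ge0 ?sqr_ge0// mulr_ge0 ?expR_ge0// mulr_ge0// exprn_ge0//.
    exact: ltW (Tp x Xx).
  - apply: mRX => x x0; apply: cvgM; last by apply: cvg_exprn; exact: cont_dq.
    apply: cvgM; first exact: ce.
    by apply: cvgM; [exact: cvg_cst|apply: cvg_exprn; exact: cTx].
  - by apply: mRX => x _; exact: cP2.
  - move=> x Xx; have [h1 h2 h3 h4 /andP[h5 h6]] := near x Xx; have [_ ->] := qE x Xx.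
    have /andP[x0 xh] := XE x Xx; rewrite lee_fin.
    have e1 : T x ^+ 3 <= (a * x) ^+ 3.
      by rewrite lerXn2r ?nnegrE ?(ltW (Tp x Xx))// mulr_ge0// ltW.
    have e2 : expR (2 * b * x) * T x ^+ 3 <= 21 / 20 * (a * x) ^+ 3.
      by rewrite ler_pM ?expR_ge0// exprn_ge0// ltW// Tp.
    have -> : P2 x = 21 / 20 * (a * x) ^+ 3 * (4 * (2 * x * ((h - x) * (h - 2 * x))) ^+ 2).
      by rewrite /P2; field.
    rewrite (_ : _ * _ * _ = expR (2 * b * x) * T x ^+ 3 *
      (4 * (2 * x * ((h - x) * (h - 2 * x))) ^+ 2)); first by rewrite ler_wpM2r// mulr_ge0 ?sqr_ge0.
    by move: (expR _) (T x) => *; ring.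
move=> H; have : (4%:E * \int[mu]_(x in X) (P1 x)%:E <= M%:E * \int[mu]_(x in X) (P2 x)%:E)%E.
  apply: le_trans (le_trans _ H) _; first by rewrite lee_pmul2l.
  by rewrite lee_pmul2l.
rewrite (int_poly_oc h0 dQ1 cP1) (int_poly_oc h0 dQ2 cP2) -!EFinM lee_fin.
(* With all error factors included, 4 (19/20)^3 / 140 > 1 / 50, so the inequality fails for every M
   < 1. *)
have -> : Q1 h - Q1 0 = (19 / 20) ^+ 3 / 140 * (a ^+ 3 * h ^+ 10) by rewrite /Q1; field.
have -> : Q2 h - Q2 0 = 1 / 50 * (a ^+ 3 * h ^+ 10) by rewrite /Q2; field.
have : 0 < a ^+ 3 * h ^+ 10 by rewrite mulr_gt0// exprn_gt0.
set w := a ^+ 3 * _ => w0.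
have : M * (1 / 50 * w) <= 1 / 50 * w by rewrite ler_piMl ?(ltW M1)// mulr_ge0// ltW.
lra.
Qed.

End cold_wall_spectral.

Theorem theorem3 (R : realType) (Tb : R) (psib : R -> R)
    (T : R -> R) (psi : R * R -> R)
    (hdata : milne_data Tb psib)
    (hsol : milne_solution Tb psib T psi)
    (hest : weighted_estimate Tb psib T psi)
    (hspec : spectral_assumption T) :
  (exists eps0 : R, 0 < eps0 /\
    forall eps : R, 0 < eps <= eps0 ->
    forall (T1 : R -> R) (psi1 : R * R -> R),
      milne_solution Tb psib T1 psi1 ->
      weighted_estimate Tb psib T1 psi1 ->
      calV eps T (T1, psi1) ->
      ae_equal T1 psi1 T psi)
  /\
  (forall alpha beta gamma : R,
    0 < beta -> beta < alpha -> alpha < 1 -> 0 < gamma ->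
    Tb <= gamma ->
    {ae @lebesgue_measure R, forall m, m \in `]0, 1] -> psib m <= gamma ^+ 4} ->
    (data_energy Tb psib <= (Cb Tb alpha beta gamma)%:E)%E ->
    (forall (T1 : R -> R) (psi1 : R * R -> R),
      milne_solution Tb psib T1 psi1 ->
      weighted_estimate Tb psib T1 psi1 ->
      ae_equal T1 psi1 T psi)
    /\ milne_unique Tb psib).
Proof.
have [Tb0 mpsib _] := hdata; split; last first.
  move=> alpha beta gamma b0 ba a1 g0 Tg _ hE.
  have hE' : (data_energy Tb psib <= (Tb ^+ 2 / 256)%:E)%E.
    by rewrite (le_trans hE)// lee_fin Cb_le.
  split; first by move=> T1 psi1 sol1 _; exact: small_data_unique hdata hE' sol1 hsol.
  by move=> T1 psi1 T2 psi2 sol1 sol2; exact: small_data_unique hdata hE' sol1 sol2.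
move: (Tb0); rewrite le_eqVlt => /predU1P[Tb00|Tb_gt0].
  (* A cold wall with positive energy contradicts the spectral assumption, so the energy is 0 and
     the small-data result applies with any radius. *)
  have hE : (data_energy Tb psib <= (Tb ^+ 2 / 256)%:E)%E.
    subst Tb; have [D [C1 [t1 [p1 [_ [_ [_ [fD r _]]]]]]]] := represented2 hsol hsol.
    have [cl _ _] := r; have := cold_not_spectral fD mpsib r hspec.
    by rewrite (data_energyE fD cl mpsib) lee_fin expr0n mul0r; lra.
  exists 1; split=> // eps _ T1 psi1 sol1 _ _.
  exact: small_data_unique hdata hE sol1 hsol.
have [e e0 He] := near_unique hdata Tb_gt0 hsol hspec.
(* The L^2 bound enters squared, and eps <= 1 gives eps^2 <= eps <= e. *)
exists (Num.min 1 e); split; first by rewrite lt_min ltr01.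
move=> eps /andP[eps0]; rewrite le_min => /andP[eps1 epse] T1 psi1 sol1 _ close.
apply: He => //; apply: le_trans (calV_int close) _.
by rewrite lee_fin (le_trans _ epse)// expr2 ler_piMr// ltW.
Qed.
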